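(* Let $k$ be an algebraically closed field, $R=k[x,y]$, let $d\le j$ be positive integers, and let $H$ be an acceptable $O$-sequence for $(d,j)$. Then the Zariski closure of $\mathrm{Grass}_H(d,j)$ in $\mathrm{Grass}(d,R_j)$ is $$\overline{\mathrm{Grass}_H(d,j)}=\bigcup_{H'\ge_{\mathcal P}H}\mathrm{Grass}_{H'}(d,j),$$ the union being over the acceptable $O$-sequences $H'$ for $(d,j)$ with $H'\ge_{\mathcal P}H$.
   Context: $R=k[x,y]$ has the standard grading; $R_i$ is the space of degree-$i$ forms. For a subspace $V\subset R_j$ and $i\ge0$, $R_iV=\mathrm{span}\{hf: h\in R_i, f\in V\}\subset R_{i+j}$ and $R_{-i}V=\{f\in R_{j-i}: R_i f\subset V\}$. The ancestor ideal of $V$ is $\overline V=(V)\oplus R_{-1}V\oplus\cdots\oplus R_{-j}V$. $H(A)_i=\dim_k A_i$. A proper $O$-sequence is a sequence $H=(1,2,\ldots,\mu,H_\mu,H_{\mu+1},\ldots)$ of non-negative integers with $\mu=\min\{i: H_i<i+1\}$ a positive integer, $\mu\ge H_\mu\ge H_{\mu+1}\ge\cdots$, and $c_H=\lim_{i\to\infty} H_i$. Put $e_i=H_{i-1}-H_i$ ($i\ge1$), $e_0=-1$. $H$ is acceptable for $(d,j)$ if: $e_i\le e_{i+1}$ for $0\le i\le j$; $e_i\ge e_{i+1}$ for $i\ge j$; $\sum_{0\le i\le j}(e_i+1)=d$; $\sum_{i>j}e_i=(j+1-d)-c_H$; and $0\le e_j=e_{j+1}\le\min\{j+1-d,d-1\}$.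 Partial order: $H'\ge_{\mathcal P}H$ means $H'_i\le H_i$ for all $i\le j$ and $H'_i\ge H_i$ for all $i\ge j$. $\mathrm{Grass}(d,R_j)$ is the Grassmannian of $d$-dimensional subspaces of $R_j$; $\mathrm{Grass}_H(d,j)$ (also written $\mathrm{Grass}(H)$) is its locally closed subscheme, defined by rank conditions, parametrizing the $V$ with $H(R/\overline V)=H$. *)

(* Defs.v *)
From HB Require Import structures.
From mathcomp Require Import all_boot all_order all_algebra.
From mathcomp Require Export mpoly.

Set Implicit Arguments.
Unset Strict Implicit.
Unset Printing Implicit Defensive.

Import GRing.Theory Num.Theory.
Local Open Scope ring_scope.

(* R_i : the space of degree-i forms of R = k[x, y] = {mpoly k[2]}, as a
   finite-dimensional k-vector space. *)
Notation forms k i := (dhomog 2 k i).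

Section Ancestor.
Context {k : fieldType}.

(* The product h * f of forms, as an element of R_m. Taking the degree-m
   component makes this total; it is only used with i + l = m, where
   [form_mulE] shows that it is h * f itself. *)
Definition form_mul (i l m : nat) (h : forms k i) (f : forms k l) : forms k m :=
  DHomog (pihomogP mdeg m (val h * val f)).

Lemma form_mulE (i l m : nat) (h : forms k i) (f : forms k l) :
  (i + l)%N = m -> val (form_mul m h f) = val h * val f.
Proof.
move=> <-; apply: pihomog_dE; apply: dhomogM; exact: dhomog_is_dhomog.
Qed.

Lemma form_mul_is_linear (i l m : nat) (h : forms k i) :
  linear (@form_mul i l m h).
Proof.
move=> c f g; by apply: val_inj; rewrite /= mulrDr -scalerAr linearP.
Qed.

HB.instance Definition _ (i l m : nat) (h : forms k i) :=
  GRing.isLinear.Build k (forms k l) (forms k m) _ (@form_mul i l m h)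
    (@form_mul_is_linear i l m h).

Lemma form_mul_coord (i l m : nat) (h : forms k i) (f : forms k l) :
  form_mul m h f = \sum_t coord (vbasis {: forms k i}) t h
                            *: form_mul m (vbasis {: forms k i})`_t f.
Proof.
rewrite {1}(coord_vbasis (memvf h)); apply: val_inj.
rewrite /= !linear_sum /= mulr_suml linear_sum; apply: eq_bigr => t _.
by rewrite -scalerAl linearZ.
Qed.

(* R_i V inside R_m, for V inside R_j and m = i + j. *)
Definition Rmul (i j m : nat) (V : {vspace forms k j}) : {vspace forms k m} :=
  (\sum_(h <- vbasis {: forms k i}) (linfun (form_mul m h) @: V))%VS.

(* R_{-i} V = {f in R_m | R_i f is contained in V}, for V inside R_j and
   m = j - i. *)
Definition Rdiv (i j m : nat) (V : {vspace forms k j}) : {vspace forms k m} :=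
  (\bigcap_(h <- vbasis {: forms k i}) (linfun (form_mul j h) @^-1: V))%VS.

(* The following two lemmas show that the choice of a basis of R_i in Rmul
   and Rdiv is immaterial. *)
Lemma Rmul_subP (i j m : nat) (V : {vspace forms k j})
    (W : {vspace forms k m}) :
  reflect (forall (h : forms k i) (f : forms k j),
             f \in V -> form_mul m h f \in W)
          (Rmul i m V <= W)%VS.
Proof.
apply: (iffP idP) => [sW h f fV | sW].
  have hW x : x \in vbasis {: forms k i} -> form_mul m x f \in W.
    move=> xb; apply: (subvP sW); rewrite /Rmul (big_rem x) //=.
    apply: (subvP (addvSl _ _)); rewrite -(lfunE (form_mul m x)).
    exact: memv_img.
  rewrite form_mul_coord; apply: rpred_sum => t _; apply: rpredZ.
  by apply: hW; rewrite mem_nth // size_tuple.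
rewrite /Rmul big_seq; elim/big_ind: _ => [|A B|h hb]; first exact: sub0v.
  by move=> *; rewrite subv_add; apply/andP; split.
apply/subvP=> _ /memv_imgP[f fV ->]; rewrite lfunE /=; exact: sW.
Qed.

Lemma Rdiv_memP (i j m : nat) (V : {vspace forms k j}) (f : forms k m) :
  reflect (forall h : forms k i, form_mul j h f \in V) (f \in Rdiv i m V).
Proof.
have E : (f \in Rdiv i m V)
    = all (fun h => form_mul j h f \in V) (vbasis {: forms k i}).
  rewrite /Rdiv; elim: {1 2}(tval (vbasis _)) => [|h s IHs].
    by rewrite big_nil memvf.
  by rewrite big_cons memv_cap IHs -memv_preim lfunE.
rewrite E; apply: (iffP allP) => [fV h | fV h _ //].
rewrite form_mul_coord; apply: rpred_sum => t _; apply: rpredZ.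
by apply: fV; rewrite mem_nth // size_tuple.
Qed.

(* The degree-i component of the ancestor ideal of V: in degrees >= j it is
   that of the ideal (V), in degrees i < j it is R_{-(j-i)} V. *)
Definition ancestor (j : nat) (V : {vspace forms k j}) (i : nat) :
    {vspace forms k i} :=
  if (j <= i)%N then Rmul (i - j) i V else Rdiv (j - i) i V.

(* Hilbert function of the quotient of R by the ancestor ideal of V. *)
Definition ancestor_hilbert (j : nat) (V : {vspace forms k j}) (i : nat) : nat :=
  (\dim {: forms k i} - \dim (ancestor V i))%N.

End Ancestor.

Definition proper_Oseq (H : nat -> nat) : Prop :=
  exists2 mu : nat, (0 < mu)%N &
    [/\ forall i, (i < mu)%N -> H i = i.+1,
        (H mu <= mu)%N
      & forall i, (mu <= i)%N -> (H i.+1 <= H i)%N].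

Definition ediff (H : nat -> nat) (i : nat) : int :=
  if i is i'.+1 then (H i')%:Z - (H i)%:Z else -1.

(* Convergence of a sequence of integers. *)
Definition int_limit (u : nat -> int) (l : int) : Prop :=
  exists N : nat, forall n, (N <= n)%N -> u n = l.

Definition acceptable (d j : nat) (H : nat -> nat) : Prop :=
  proper_Oseq H /\
  [/\ forall i, (i <= j)%N -> ediff H i <= ediff H i.+1,
      forall i, (j <= i)%N -> ediff H i.+1 <= ediff H i,
      \sum_(0 <= i < j.+1) (ediff H i + 1) = d%:Z,
      exists2 c : int, int_limit (fun n => (H n)%:Z) c
        & int_limit (fun n => \sum_(j.+1 <= i < n) ediff H i)
                    (j%:Z + 1 - d%:Z - c)
    & [/\ 0 <= ediff H j, ediff H j = ediff H j.+1
        & ediff H j.+1 <= Num.min (j%:Z + 1 - d%:Z) (d%:Z - 1)]].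

(* geP j H' H is H' >=_P H. *)
Definition geP (j : nat) (H' H : nat -> nat) : Prop :=
  (forall i, (i <= j)%N -> (H' i <= H i)%N) /\
  (forall i, (j <= i)%N -> (H i <= H' i)%N).

Section Grassmannian.
Context (k : fieldType) (d j : nat).

Record Grass := MkGrass {
  grass_space :> {vspace forms k j};
  grass_dim : \dim grass_space = d }.

Definition GrassH (H : nat -> nat) (V : Grass) : Prop :=
  forall i, ancestor_hilbert V i = H i.

(* The exponent of the monomial x^s y^(j-s). *)
Definition form_monom (s : nat) : 'X_{1..2} :=
  [multinom (if val t == 0%N then s else (j - s)%N) | t < 2].

(* The d rows are the coefficients, in the monomial basis of R_j, of the
   elements of a basis of V. *)
Definition grass_mx (V : Grass) : 'M[k]_(d, j.+1) :=
  \matrix_(r, s) (val (vbasis V)`_r)@_(form_monom s).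

Definition plucker_index : {set {set 'I_j.+1}} := [set I : {set 'I_j.+1} | #|I| == d].

(* The maximal minors of grass_mx V; another basis of V multiplies all of
   them by a common nonzero scalar. *)
Definition plucker (V : Grass) (t : 'I_#|plucker_index|) : k :=
  \det (\matrix_(r < d, s < d) grass_mx V r (nth ord0 (enum (enum_val t)) s)).

(* Zariski closed subsets of the Grassmannian in its Plücker embedding: the
   common zeros of a set of homogeneous polynomials in the Plücker
   coordinates. *)
Definition zariski_closed (Z : Grass -> Prop) : Prop :=
  exists2 P : {mpoly k[#|plucker_index|]} -> Prop,
    forall F, P F -> exists e : nat, F \is e.-homog
  & forall V, Z V <-> forall F, P F -> F.@[plucker V] = 0.

Definition zariski_closure (S : Grass -> Prop) (V : Grass) : Prop :=
  forall Z, zariski_closed Z -> (forall W, S W -> Z W) -> Z V.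

End Grassmannian.

(* Main.v *)
(** In the monomial coordinates of degree [j] put [y = 1], so that forms of
degree [j] become polynomials of size at most [j + 1].  The ancestor ideal of
[V] has generators [g_i] of degree [j + 1 - n_i] and a Hilbert-Burch matrix [M]
with entries of degree [n_i + m_l], where the partitions [n] and [m] are dual
to the differences of the Hilbert function below and above [j]; moreover [g] is
[f] times the vector of signed maximal minors of [M], with [f] of degree [c_H].
Here [V] is the direct sum of the [R_(n_i - 1) g_i].

The order on Hilbert functions is the dominance order on the pairs [(n, m)],
weakened so that [c_H] may feed the parts of [m].  It is generated by moving a
unit between two parts of [n], between two parts of [m], or from [c_H] to a
part of [m], and each such move is realized by a one-parameter family of
matrices.  Finally every space presented by a matrix of type [(n, m)] is a limit
of spaces with Hilbert function [H], by joining its matrix to a bidiagonal one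
on a line.  Conversely the stated inequalities are rank conditions, hence closed
in the Pluecker coordinates. *)
From HB Require Import structures.
Require Import Defs.
From mathcomp Require Import all_boot all_order all_algebra.
From mathcomp Require Import perm zify ring.

Set Implicit Arguments.
Unset Strict Implicit.
Unset Printing Implicit Defensive.

Import GRing.Theory.
Local Open Scope ring_scope.

(** * Row spaces spanned by polynomials *)

(** The presentations that are moved around are required to satisfy degree bounds only. Coprimality
    of the minors, which a deformation need not preserve, enters at two places: to find a
    presentation of a given space, and to compute the ranks of a generic member of a family.
    Parameter values where the rows become dependent are discarded by the curve criterion for
    closure. The two Hilbert functions may need different numbers of generators. The special space
    needs at most as many, so it is padded with zero generators having parts 0, and some parts of
    its [m] may then be 0. Dual partitions are never formed in the comparison: sums of minima with
    [s] are their partial sums, and these are what the ranks yield. Two further points carry weight.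
    The generators are free one degree beyond [j], which makes the parts of [m] positive and lets
    the ranks above [j] determine the values below. Genericity can impose only finitely many rank
    conditions; the others follow from strict growth of the rank. *)

Definition rows_mx (R : nzRingType) p (N : 'I_p -> nat) L
    (rho : 'I_p -> nat -> {poly R}) : 'M[R]_(\sum_i N i, L) :=
  \mxcol_i \matrix_(a < N i, b < L) (rho i a)`_b.

(** With [y = 1] the multiples of a form by all forms of degree [N i - 1] are spanned by its
    products with ['X^a] for [a < N i]. Coefficients from [L] on are cut off, so size bounds
    accompany the uses. *)
Definition gens_mx (R : nzRingType) p (N : 'I_p -> nat) L
    (g : 'I_p -> {poly R}) : 'M[R]_(\sum_i N i, L) :=
  rows_mx N L (fun i a => g i * 'X^a).

Lemma eq_rows_mx (R : nzRingType) p (N : 'I_p -> nat) L (rho rho' : 'I_p -> nat -> {poly R}) :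
  (forall i a, rho i a = rho' i a) -> rows_mx N L rho = rows_mx N L rho'.
Proof. by move=> e; apply/eq_mxcolP => i; apply/matrixP => a b; rewrite !mxE e. Qed.

Section Rows.
Variable k : fieldType.

Lemma poly_rV0 L : poly_rV (0 : {poly k}) = 0 :> 'rV_L.
Proof. exact: linear0. Qed.

Lemma poly_rV_eq0 L (q : {poly k}) : (size q <= L)%N -> poly_rV q = 0 :> 'rV_L -> q = 0.
Proof. by move=> sq /(congr1 rVpoly); rewrite poly_rV_K // linear0. Qed.

Lemma poly_rV_inj L (p q : {poly k}) : (size p <= L)%N -> (size q <= L)%N ->
  poly_rV p = poly_rV q :> 'rV_L -> p = q.
Proof. by move=> sp sq /(congr1 rVpoly); rewrite !poly_rV_K. Qed.

Lemma size_rVpoly L (v : 'rV[k]_L) : (size (rVpoly v) <= L)%N.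
Proof. exact: size_poly. Qed.

Section Fam.
Variables (p : nat) (N : 'I_p -> nat) (L : nat).
Implicit Type g : 'I_p -> {poly k}.

Definition fam_row (h : 'I_p -> {poly k}) : 'rV[k]_(\sum_i N i) :=
  \mxrow_i poly_rV (h i).

Lemma fam_rowK (v : 'rV[k]_(\sum_i N i)) :
  fam_row (fun i => rVpoly (submxrow v i)) = v.
Proof.
rewrite /fam_row -[RHS]submxrowK; apply/eq_mxrowP => i.
by rewrite rVpolyK.
Qed.

Lemma mul_gens_mx g (v : 'rV[k]_(\sum_i N i)) :
  v *m gens_mx N L g = poly_rV (\sum_i rVpoly (submxrow v i) * g i).
Proof.
rewrite -{1}(submxrowK v) mul_mxrow_mxcol linear_sum /=; apply: eq_bigr => i _.
rewrite {2}[submxrow v i]row_sum_delta !linear_sum /= mulr_suml linear_sum /=.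
rewrite mulmx_sum_row; apply: eq_bigr => a _.
rewrite [rVpoly _]linearZ /= rVpoly_delta -scalerAl [poly_rV _]linearZ /=.
by congr (_ *: _); apply/rowP => b; rewrite !mxE commr_polyXn.
Qed.

Lemma mul_fam_row g (h : 'I_p -> {poly k}) : (forall i, size (h i) <= N i)%N ->
  fam_row h *m gens_mx N L g = poly_rV (\sum_i h i * g i).
Proof.
move=> sh; rewrite mul_gens_mx; congr poly_rV; apply: eq_bigr => i _.
by rewrite mxrowK poly_rV_K.
Qed.

Lemma fam_row_eq0 (h : 'I_p -> {poly k}) : (forall i, size (h i) <= N i)%N ->
  fam_row h = 0 -> forall i, h i = 0.
Proof.
move=> sh h0 i; apply: (poly_rV_eq0 (sh i)).
by rewrite -[poly_rV _](mxrowK (fun i => poly_rV (h i))) -/(fam_row h) h0 submxrow0.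
Qed.

Lemma sub_gens_mx g (h : 'I_p -> {poly k}) : (forall i, size (h i) <= N i)%N ->
  (poly_rV (\sum_i h i * g i) <= gens_mx N L g)%MS.
Proof. by move=> sh; rewrite -mul_fam_row // submxMl. Qed.

Lemma sub_gens_mxP g (v : 'rV_L) : (v <= gens_mx N L g)%MS ->
  exists2 h : 'I_p -> {poly k}, forall i, (size (h i) <= N i)%N
    & v = poly_rV (\sum_i h i * g i).
Proof.
case/submxP=> w ->; exists (fun i => rVpoly (submxrow w i)).
  by move=> i; apply: size_rVpoly.
exact: mul_gens_mx.
Qed.

Lemma rows_mx_sub (rho : 'I_p -> nat -> {poly k}) M (B : 'M_(M, L)) :
  (forall i a, (a < N i)%N -> (poly_rV (rho i a) <= B)%MS) ->
  (rows_mx N L rho <= B)%MS.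
Proof.
move=> sB; apply/row_subP => x; rewrite row_mxcol.
set i := tagnat.sig1 x; have -> : row (tagnat.sig2 x) (\matrix_(a < N i, b < L) (rho i a)`_b)
   = poly_rV (rho i (tagnat.sig2 x)) by apply/rowP=> b; rewrite !mxE.
exact: sB.
Qed.

Lemma gens_mx_sub g M (B : 'M_(M, L)) :
  (forall i a, (a < N i)%N -> (poly_rV (g i * 'X^a) <= B)%MS) ->
  (gens_mx N L g <= B)%MS.
Proof. exact: rows_mx_sub. Qed.

Lemma sub_gens_mx1 g i a : (a < N i)%N ->
  (poly_rV (g i * 'X^a) <= gens_mx N L g)%MS.
Proof.
move=> ai; have -> : g i * 'X^a = \sum_l (if l == i then 'X^a else 0) * g l.
  rewrite (bigD1 i) //= eqxx big1 ?addr0 1?commr_polyXn // => l /negPf ->.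
  by rewrite mul0r.
by apply: sub_gens_mx => l; case: eqP => [->|_]; rewrite ?size_polyXn ?size_poly0.
Qed.

Lemma gens_mx_free g :
  (forall h : 'I_p -> {poly k}, (forall i, size (h i) <= N i)%N ->
     poly_rV (\sum_i h i * g i) = 0 :> 'rV_L -> forall i, h i = 0) <->
  row_free (gens_mx N L g).
Proof.
split=> [inj | free h sh e]; last first.
  apply: fam_row_eq0 => //; apply: (row_free_inj free).
  by rewrite mul0mx mul_fam_row.
rewrite -kermx_eq0; apply/rowV0P => v; rewrite sub_kermx mul_gens_mx => /eqP e.
rewrite -(fam_rowK v); apply/rowP => b.
rewrite /fam_row mxE (inj _ _ e) ?linear0 ?mxE // => i; exact: size_rVpoly.
Qed.

End Fam.

Lemma eqmx_gens p (N N' : 'I_p -> nat) L (g : 'I_p -> {poly k}) :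
  N =1 N' -> (gens_mx N L g :=: gens_mx N' L g)%MS.
Proof.
move=> NN; apply/eqmxP/andP; split; apply: gens_mx_sub => i a ai.
  by apply: sub_gens_mx1; rewrite -NN.
by apply: sub_gens_mx1; rewrite NN.
Qed.
End Rows.

(** * Signed maximal minors *)

(** Cofactors along an adjoined column do not depend on it, so a zero column serves. Thus [minors M]
    is the functional sending [w] to the determinant of [w] adjoined to [M], which settles all
    signs. *)
Definition minors (R : comNzRingType) r (M : 'M[R]_(r.+1, r)) : 'rV[R]_r.+1 :=
  \row_i cofactor (row_mx (0 : 'cV_r.+1) M : 'M_(1 + r)) i 0.

Lemma mul_rV_delta (R : nzRingType) p (v : 'rV[R]_p) i :
  (v *m (delta_mx i 0 : 'cV_p)) 0 0 = v 0 i.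
Proof. by rewrite -colE mxE. Qed.

Section Minors.
Variables (R : comNzRingType) (r : nat).
Implicit Types (M : 'M[R]_(r.+1, r)) (w : 'cV[R]_r.+1).

Lemma row_mx_col0 M w i : (row_mx w M : 'M_(1 + r)) i 0 = w i 0.
Proof. by rewrite mxE; case: splitP => // x _; rewrite ord1. Qed.

Lemma cofactor_row_mx M w i :
  cofactor (row_mx w M : 'M_(1 + r)) i 0 = minors M 0 i.
Proof.
rewrite mxE /cofactor; congr (_ * \det _); apply/matrixP => a b; rewrite !mxE.
by case: splitP => // x /=; rewrite ord1.
Qed.

Lemma det_row_mx_minors M w :
  \det (row_mx w M : 'M_(1 + r)) = (minors M *m w) 0 0.
Proof.
rewrite (expand_det_col _ 0) [RHS]mxE; apply: eq_bigr => i _.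
by rewrite cofactor_row_mx row_mx_col0 mulrC.
Qed.

Lemma minors_ext M (v : 'rV[R]_r.+1) :
  (forall w, \det (row_mx w M : 'M_(1 + r)) = (v *m w) 0 0) -> minors M = v.
Proof.
move=> e; apply/rowP => i.
rewrite -(mul_rV_delta (minors M)) -(mul_rV_delta v) -det_row_mx_minors.
exact: e.
Qed.

Lemma mul_minors M : minors M *m M = 0.
Proof.
apply/rowP => l.
have -> : (minors M *m M) 0 l = (minors M *m col l M) 0 0.
  by rewrite mxE [RHS]mxE; apply: eq_bigr => i _; rewrite [col l M _ _]mxE.
rewrite -det_row_mx_minors -det_tr mxE tr_row_mx.
apply: (@determinant_alternate _ _ _ (lshift r 0) (rshift 1 l)) => // x.
by rewrite (col_mxEu _ _ 0) (col_mxEd _ _ l) !mxE.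
Qed.

Lemma minors_mulr M (C : 'M_r) : minors (M *m C) = \det C *: minors M.
Proof.
apply: minors_ext => w; rewrite -scalemxAl mxE -det_row_mx_minors mulrC.
have -> : row_mx w (M *m C) = row_mx w M *m block_mx 1%:M 0 0 C.
  by rewrite mul_row_block mulmx1 !mulmx0 addr0 add0r.
by rewrite (det_mulmx (row_mx w M : 'M_(1 + r))) det_ublock det1 mul1r.
Qed.

Lemma minors_mull (E : 'M_r.+1) M : minors (E *m M) *m E = \det E *: minors M.
Proof.
symmetry; apply/rowP => i.
rewrite -(mul_rV_delta (_ *: _)) -(mul_rV_delta (_ *m E)) -mulmxA -det_row_mx_minors -scalemxAl mxE -det_row_mx_minors -mul_mx_row.
by rewrite (det_mulmx E (row_mx _ M : 'M_(1 + r))).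
Qed.

(** Let [A] be [M] with [w] adjoined. Then [g *m A] is zero outside its first entry, and the first
    row of the adjugate of [A] is [minors M]; multiplying the two gives the determinant times
    [g]. *)
Lemma minors_proportional M (g : 'rV_r.+1) w : g *m M = 0 ->
  (minors M *m w) 0 0 *: g = (g *m w) 0 0 *: minors M.
Proof.
move=> gM; rewrite -det_row_mx_minors -mul_mx_scalar.
have := mul_mx_adj (row_mx w M : 'M_(1 + r)).
move=> /(congr1 (mulmx (g : 'rV_(1 + r)))) <-.
rewrite mulmxA (mul_mx_row g w M) gM; apply/rowP => i; rewrite !mxE.
rewrite big_ord_recl big1 ?addr0 => [|l _]; last first.
  by rewrite mxE; case: splitP => [x|x _]; [rewrite ord1|rewrite mxE mul0r].
rewrite mxE; case: splitP => // x _; rewrite ord1 mxE; congr (_ * _).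
by rewrite mxE cofactor_row_mx mxE.
Qed.

End Minors.

Lemma map_minors (R S : comNzRingType) (f : {rmorphism R -> S}) r
    (M : 'M[R]_(r.+1, r)) : minors (map_mx f M) = map_mx f (minors M).
Proof.
apply/rowP => i; rewrite !mxE -(map_mx0 f) -map_row_mx.
exact: cofactor_map_mx.
Qed.

Lemma minors_inj (R : idomainType) r (M : 'M[R]_(r.+1, r)) (c : 'cV_r) :
  minors M != 0 -> M *m c = 0 -> c = 0.
Proof.
case/rV0Pn => i Mi Mc; pose w := delta_mx i 0 : 'cV[R]_r.+1.
have dw : \det (row_mx w M : 'M_(1 + r)) != 0.
  by rewrite det_row_mx_minors mul_rV_delta.
have : \adj (row_mx w M : 'M_(1 + r)) *m
   ((row_mx w M : 'M_(r.+1, 1 + r)) *m col_mx 0 c) = 0.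
  by rewrite mul_row_col Mc mulmx0 addr0 mulmx0.
rewrite mulmxA mul_adj_mx mul_scalar_mx => /eqP.
rewrite scalemx_eq0 (negPf dw) /= => /eqP /(congr1 (@dsubmx _ 1 _ _)).
by rewrite col_mxKd linear0.
Qed.

(** The columns span a proper subspace; a unit vector outside it completes them to an invertible
    matrix, whose determinant is an entry of [minors M]. *)
Lemma minors_neq0 (F : fieldType) r (M : 'M[F]_(r.+1, r)) :
  (forall c : 'cV_r, M *m c = 0 -> c = 0) -> minors M != 0.
Proof.
move=> inj; have rM : row_free M^T.
  rewrite -kermx_eq0; apply/rowV0P => v; rewrite sub_kermx => /eqP vM.
  apply: trmx_inj; rewrite trmx0; apply: inj.
  by rewrite -[M]trmxK -trmx_mul vM trmx0.
have nfull : ~~ row_full M^T by rewrite -col_leq_rank (eqP rM) ltnn.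
have [i iM] : exists i, ~~ (row i 1%:M <= M^T)%MS.
  by apply/row_subPn; rewrite sub1mx.
pose w : 'cV[F]_r.+1 := (row i 1%:M)^T.
suff : \det (row_mx w M : 'M_(1 + r)) != 0.
  by rewrite det_row_mx_minors; apply: contraNneq => ->; rewrite mul0mx mxE.
rewrite -unitfE -[_ \in _]unitmxE -unitmx_tr -row_free_unit tr_row_mx trmxK.
rewrite -kermx_eq0; apply/rowV0P => v; rewrite sub_kermx.
rewrite -[v](@hsubmxK _ 1 1 r) mul_row_col => /eqP e.
have v0 : lsubmx v = 0.
  apply/eqP; apply: contraNT iM => vn.
  rewrite [lsubmx v]mx11_scalar mul_scalar_mx in e.
  have n0 : lsubmx v 0 0 != 0.
    by apply: contraNneq vn => z; rewrite [lsubmx v]mx11_scalar z raddf0.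
  rewrite -(eqmx_scale _ n0); move/eqP: e; rewrite addr_eq0 => /eqP ->.
  by rewrite eqmx_opp submxMl.
rewrite v0 mul0mx add0r in e; rewrite v0.
have -> : rsubmx v = 0 by apply: (row_free_inj rM); rewrite e mul0mx.
exact: row_mx0.
Qed.

(** * Degrees of minors *)

Lemma coefM_top (R : comNzRingType) (p q : {poly R}) a b :
  (size p <= a.+1)%N -> (size q <= b.+1)%N -> (p * q)`_(a + b) = p`_a * q`_b.
Proof.
move=> sp sq; have lt : (a < (a + b).+1)%N by rewrite ltnS leq_addr.
rewrite coefM (bigD1 (Ordinal lt)) //= addKn [X in _ + X]big1 ?addr0 //.
case=> x xl; rewrite -val_eqE /= => xe; have [lx|gx] := ltnP x a.
  rewrite [X in _ * X]nth_default ?mulr0 //; apply: leq_trans sq _; lia.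
by rewrite nth_default ?mul0r //; apply: leq_trans sp _; lia.
Qed.

Lemma size_coef_prod (R : comNzRingType) (I : Type) (s : seq I) (F : I -> {poly R})
    (e : I -> nat) : (forall i, size (F i) <= (e i).+1)%N ->
  (size (\prod_(i <- s) F i)%R <= (\sum_(i <- s) e i).+1)%N
  /\ (\prod_(i <- s) F i)`_(\sum_(i <- s) e i) = \prod_(i <- s) (F i)`_(e i).
Proof.
move=> sF; elim: s => [|i s [IHs IHc]].
  by rewrite !big_nil size_poly1 coef1.
rewrite !big_cons coefM_top // IHc; split=> //.
by apply: leq_trans (size_polyMleq _ _) _; have := sF i; lia.
Qed.

(** As the bound on an entry is a sum [a i + b l], every permutation contributes in the same degree,
    so the coefficient there is the determinant of the top coefficients. *)
Lemma size_coef_det (R : comNzRingType) p (A : 'M[{poly R}]_p) (a b : 'I_p -> nat) :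
  (forall i l, size (A i l) <= (a i + b l).+1)%N ->
  (size (\det A)%R <= (\sum_i a i + \sum_l b l).+1)%N
  /\ (\det A)`_(\sum_i a i + \sum_l b l)
     = \det (\matrix_(i, l) (A i l)`_(a i + b l)).
Proof.
move=> sA.
have E (s : 'S_p) : (\sum_i a i + \sum_l b l = \sum_i (a i + b (s i)))%N.
  by rewrite big_split /= [X in (_ + X)%N](reindex_inj (@perm_inj _ s)).
have P (s : 'S_p) := @size_coef_prod R _ (index_enum 'I_p)
  (fun i => A i (s i)) (fun i => a i + b (s i))%N (fun i => sA i (s i)).
split.
  apply: leq_trans (size_sum _ _ _) _; apply/bigmax_leqP => s _.
  case: (odd_perm s); rewrite ?expr1 ?mulN1r ?size_polyN ?mul1r.
    by rewrite (E s); case: (P s).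
  by rewrite (E s); case: (P s).
rewrite coef_sum; apply: eq_bigr => s _.
case: (odd_perm s); rewrite ?expr1 ?mulN1r ?coefN ?mul1r (E s);
  case: (P s) => _ ->; [congr (- _)|]; apply: eq_bigr => i _; by rewrite mxE.
Qed.

Section MinorDeg.
Variables (R : comNzRingType) (r : nat) (n : 'I_r.+1 -> nat) (m : 'I_r -> nat).

Definition deg_le (M : 'M[{poly R}]_(r.+1, r)) :=
  forall i l, (size (M i l) <= (n i + m l).+1)%N.

Definition top_mx (M : 'M[{poly R}]_(r.+1, r)) : 'M[R]_(r.+1, r) :=
  \matrix_(i, l) (M i l)`_(n i + m l).

Lemma sum_lift (i : 'I_r.+1) : (\sum_x n x = n i + \sum_x n (lift i x))%N.
Proof. by rewrite (bigD1_ord i). Qed.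

Lemma size_coef_minors M : deg_le M -> forall i,
  (size (minors M 0 i)%R <= (\sum_x n (lift i x) + \sum_l m l).+1)%N
  /\ (minors M 0 i)`_(\sum_x n (lift i x) + \sum_l m l) = minors (top_mx M) 0 i.
Proof.
move=> dM i; rewrite !mxE /cofactor.
set A : 'M[{poly R}]_r := row' i (col' 0 _).
have AE x y : A x y = M (lift i x) y.
  rewrite !mxE; case: splitP => [z|z]; rewrite /= ?ord1 //.
  by rewrite /bump /= => [[zy]]; congr (M _ _); apply: val_inj.
have [] := @size_coef_det R r A (fun x => n (lift i x)) m.
  by move=> x y; rewrite AE.
move=> sA cA; split.
  rewrite -signr_odd; case: odd; rewrite ?expr1 ?mulN1r ?size_polyN ?mul1r //.
set B : 'M[R]_r := row' i (col' 0 _).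
have -> : B = \matrix_(x, y) (A x y)`_(n (lift i x) + m y).
  apply/matrixP => x y; rewrite 2!mxE [RHS]mxE AE mxE.
  case: splitP => [z|z]; rewrite /= ?ord1 // /bump /= => [[zy]].
  by rewrite mxE (_ : z = y) //; apply: val_inj.
rewrite -cA; move: (i + _)%N => e; rewrite -(signr_odd _ e) -(signr_odd R e).
by case: odd; rewrite ?expr1 ?mulN1r ?coefN ?mul1r.
Qed.

End MinorDeg.

Lemma poly_bezout (F : fieldType) p (v : 'I_p -> {poly F}) :
  exists w : 'I_p -> {poly F}, forall i, \sum_x v x * w x %| v i.
Proof.
elim: p v => [|p IHp] v; first by exists (fun=> 0) => -[].
have [w wP] := IHp (fun x => v (lift ord0 x)).
set q := \sum_x _ in wP.
have [[a b] /= ab] := Bezoutp (v ord0) q.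
exists (fun i => if unlift ord0 i is Some x then b * w x else a) => i.
rewrite big_ord_recl unlift_none.
rewrite (eq_bigr (fun x => b * (v (lift ord0 x) * w x))); last first.
  by move=> x _; rewrite liftK mulrCA.
rewrite -mulr_sumr -/q [v _ * a]mulrC (eqp_dvdl _ ab).
case: (unliftP ord0 i) => [x|] ->; last exact: dvdp_gcdl.
exact: dvdp_trans (dvdp_gcdr _ _) (wP x).
Qed.

(** * Relation matrices with coprime minors *)

Section Good.
Variables (k : fieldType) (r : nat) (n : 'I_r.+1 -> nat) (m : 'I_r -> nat).
Implicit Type M : 'M[{poly k}]_(r.+1, r).

(* Homogeneous coprimality of the maximal minors: the second condition says
   that they have no common zero at infinity. *)
Definition good M :=
  (exists w : 'cV[{poly k}]_r.+1, (minors M *m w) 0 0 = 1)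
  /\ (forall c : 'cV[k]_r, top_mx n m M *m c = 0 -> c = 0).

(** Exactness of the Hilbert-Burch complex with degree control. The Bezout vector [w] completes [M]
    to a matrix of determinant 1, so [h] has coordinates, and the one along [w] is [minors M *m h].
    The size bound comes from the condition at infinity. *)
Lemma good_kernel M s (h : 'cV[{poly k}]_r.+1) : deg_le n m M -> good M ->
    minors M *m h = 0 -> (forall i, size (h i 0)%R <= n i + s)%N ->
  exists2 c : 'cV[{poly k}]_r, h = M *m c
    & forall l, (size (c l 0)%R <= s - m l)%N.
Proof.
move=> dM [[w wM] topM] hM sh.
have [c hc] : exists c : 'cV[{poly k}]_r, h = M *m c.
  pose B := row_mx w M : 'M_(1 + r).
  have e : B *m (\adj B *m h) = h.
    by rewrite mulmxA mul_mx_adj det_row_mx_minors wM mul1mx.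
  have u0 : usubmx (\adj B *m h : 'cV_(1 + r)) = 0.
    apply/matrixP => a b; rewrite !ord1 {a b}.
    rewrite [RHS]mxE mxE mxE -[RHS](_ : (minors M *m h) 0 0 = 0); last first.
      by rewrite hM mxE.
    rewrite [RHS]mxE; apply: eq_bigr => i _; rewrite [\adj B _ _]mxE.
    by rewrite -(cofactor_row_mx _ w); congr (cofactor _ _ _ * _); apply: val_inj.
  exists (dsubmx (\adj B *m h : 'cV_(1 + r))).
  rewrite -{1}e -{1}[\adj B *m h](@vsubmxK _ 1 r) u0.
  by rewrite (mul_row_col w M) mulmx0 add0r.
exists c => // l0; rewrite leqNgt; apply/negP => bad.
pose D := \max_l (if c l 0%R == 0%R then 0 else size (c l 0)%R + m l)%N.
have cl0 : c l0 0 != 0 by apply: contraTneq bad => ->; rewrite size_poly0.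
have Dl l : c l 0 != 0 -> (size (c l 0)%R + m l <= D)%N.
  move=> cl; apply: leq_trans (leq_bigmax l); by rewrite (negPf cl).
have sD : (s < D)%N by apply: leq_trans (Dl _ cl0); lia.
have [l1 Dm] : {l | D = (if c l 0%R == 0%R then 0 else size (c l 0)%R + m l)%N}.
  by apply: eq_bigmax; rewrite card_ord; case: (l0) => x; lia.
move: D Dl sD Dm => D Dl sD Dm.
pose v : 'cV[k]_r := \col_l (c l 0)`_(D - m l).-1.
have /topM v0 : top_mx n m M *m v = 0.
  apply/colP => i; rewrite [RHS]mxE.
  have : (h i 0)`_(n i + D.-1) = 0.
    apply: nth_default; apply: leq_trans (sh i) _; lia.
  rewrite hc mxE coef_sum => <-; rewrite mxE; apply: eq_bigr => l _.
  rewrite !mxE; have [->|cl] := eqVneq (c l 0) 0; first by rewrite mulr0 !coef0 mulr0.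
  have := Dl _ cl; rewrite -size_poly_gt0 in cl => Dcl.
  rewrite (_ : n i + D.-1 = (n i + m l) + (D - m l).-1)%N; last by lia.
  have sc : (size (c l 0)%R <= (D - m l).-1.+1)%N.
    by move: Dcl cl; clear; lia.
  by rewrite (coefM_top (dM i l) sc).
have cl : c l1 0 != 0 by apply: contraTneq sD; rewrite Dm => ->; rewrite eqxx.
have := congr1 (fun A : 'cV[k]_r => A l1 0) v0; rewrite !mxE Dm (negPf cl) addnK.
by move/eqP; rewrite -lead_coefE lead_coef_eq0 (negPf cl).
Qed.

End Good.

Lemma minors_eq0_ker (F : fieldType) r (M : 'M[F]_(r.+1, r)) :
  minors M = 0 -> exists2 c : 'cV_r, c != 0 & M *m c = 0.
Proof.
move=> M0; have [kM|] := eqVneq (kermx M^T) 0.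
  have inj (c : 'cV_r) : M *m c = 0 -> c = 0.
    move=> Mc; apply: trmx_inj; rewrite trmx0; apply/eqP.
    by rewrite -submx0 -kM sub_kermx -trmx_mul Mc trmx0.
  by have := minors_neq0 inj; rewrite M0 eqxx.
case/rowV0Pn => v; rewrite sub_kermx => /eqP vM v0; exists v^T.
  by apply: contraNneq v0 => /(congr1 trmx); rewrite trmxK trmx0 => ->.
by rewrite -[M]trmxK -trmx_mul vM trmx0.
Qed.

Definition col_repl (R : Type) p r (M : 'M[R]_(p, r)) l (h : 'cV_p) : 'M_(p, r) :=
  \matrix_(i, x) if x == l then h i 0 else M i x.

Lemma det_col_repl1 (R : comNzRingType) r l (c : 'cV[R]_r) :
  \det (col_repl 1%:M l c) = c l 0.
Proof.
have cofE a : cofactor (col_repl 1%:M l c) a l = (l == a)%:R.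
  transitivity (cofactor (1%:M : 'M[R]_r) a l).
    rewrite /cofactor; congr (_ * \det _); apply/matrixP => x y.
    by rewrite !mxE eq_sym (negPf (neq_lift _ _)).
  have /matrixP/(_ l a) := mul_mx_adj (1%:M : 'M[R]_r).
  by rewrite mul1mx det1 !mxE.
rewrite (expand_det_col _ l) (bigD1 l) //= big1 => [|a al].
  by rewrite cofE mxE !eqxx mulr1 addr0.
by rewrite cofE eq_sym (negPf al) mulr0.
Qed.

(** Cramer's rule without division: [col_repl M l h] and [M] become equal after multiplication on
    the right by identity matrices with column [l] replaced, whose determinants are [d] and
    [c l 0]. *)
Lemma minors_col_repl (R : comNzRingType) r (M : 'M[R]_(r.+1, r)) l
    (h : 'cV_r.+1) (c : 'cV_r) d :
  d *: h = M *m c -> d *: minors (col_repl M l h) = c l 0 *: minors M.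
Proof.
move=> e; have <- : \det (col_repl 1%:M l (d *: delta_mx l 0)) = d.
  by rewrite det_col_repl1 !mxE !eqxx mulr1.
rewrite -(det_col_repl1 l c) -!minors_mulr; congr minors.
apply/matrixP => i x; rewrite !mxE; have [->|xl] := eqVneq x l.
  have /matrixP/(_ i 0) := e; rewrite !mxE => E.
  rewrite [RHS](eq_bigr (fun a => M i a * c a 0)); last by move=> a _; rewrite !mxE eqxx.
  rewrite -E (bigD1 l) //= big1 ?addr0; first by rewrite !mxE !eqxx mulr1 mulrC.
  by move=> a al; rewrite !mxE eqxx (negPf al) mulr0 mulr0.
by apply: eq_bigr => a _; rewrite !mxE (negPf xl); case: eqP => [->|_]; 
   rewrite ?(eq_sym l) ?(negPf xl) ?mulr0.
Qed.

(** * Reduction of a relation matrix to one with coprime minors *)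

Section Reduction.
Variables (k : closedFieldType) (r : nat) (n : 'I_r.+1 -> nat).
Variable g : 'rV[{poly k}]_r.+1.
Hypothesis g_indep : forall h : 'cV[{poly k}]_r.+1,
  (forall i, size (h i 0)%R <= n i)%N -> g *m h = 0 -> h = 0.
Implicit Type M : 'M[{poly k}]_(r.+1, r).

(* A combination of columns that is divisible by [d], or whose leading terms
   cancel, replaces a column of maximal degree by one of smaller degree. *)
Lemma relation_mx_step m M l (h : 'cV_r.+1) (c : 'cV_r) d :
    deg_le n m M -> g *m M = 0 -> minors M != 0 ->
    d != 0 -> d *: h = M *m c -> c l 0 != 0 ->
    (forall i, size (h i 0)%R <= n i + m l)%N ->
  exists m' M', [/\ (\sum_x m' x < \sum_x m x)%N, deg_le n m' M',
    g *m M' = 0 & minors M' != 0].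
Proof.
move=> dM gM M0 d0 dh cl sh.
have gh : g *m h = 0.
  apply/eqP; have : d *: (g *m h) = 0 by rewrite scalemxAr dh mulmxA gM mul0mx.
  by move/eqP; rewrite scalemx_eq0 (negPf d0).
(* Were this part 0, [h] would be a relation within the sizes [n i], hence zero, and [c] would lie
   in the kernel of [M]. So the part can really be lowered. *)
have ml : (0 < m l)%N.
  rewrite lt0n; apply: contraNneq cl => ml0.
  have h0 : h = 0 by apply: g_indep => // i; have := sh i; rewrite ml0 addn0.
  by rewrite (minors_inj M0 (esym _ : M *m c = 0)) ?mxE // -dh h0 scaler0.
exists (fun x => if x == l then (m l).-1 else m x), (col_repl M l h); split.
- rewrite (bigD1 l) //= eqxx [X in (_ < X)%N](bigD1 l) //=.
  rewrite (eq_bigr m) => [|x /negPf -> //]; lia.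
- move=> i x; rewrite mxE; case: eqP => [_|_]; last exact: dM.
  by apply: leq_trans (sh i) _; lia.
- apply/matrixP => a x; rewrite [a]ord1 mxE [RHS]mxE; have [xl|xl] := eqVneq x l.
    rewrite -[RHS](_ : (g *m h) 0 0 = 0); last by rewrite gh mxE.
    by rewrite mxE; apply: eq_bigr => i _; rewrite mxE xl eqxx.
  rewrite -[RHS](_ : (g *m M) 0 x = 0); last by rewrite gM mxE.
  by rewrite mxE; apply: eq_bigr => i _; rewrite mxE (negPf xl).
- have := minors_col_repl l dh; apply: contra_eqN => /eqP ->.
  by rewrite scaler0 eq_sym scalemx_eq0 negb_or cl.
Qed.

(** Descent on the sum of [m]: a common zero of the minors, at infinity or at a finite point, yields
    a vector to which [relation_mx_step] applies. *)
Lemma exists_good m M : deg_le n m M -> g *m M = 0 -> minors M != 0 ->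
  exists m' M', [/\ deg_le n m' M', g *m M' = 0, minors M' != 0 & good n m' M'].
Proof.
have [N] := ubnP (\sum_x m x); elim: N => // N IHN in m M *.
move=> leN dM gM M0.
have step (h : 'cV_r.+1) (c : 'cV_r) d l : d != 0 -> d *: h = M *m c -> c l 0 != 0 ->
    (forall i, size (h i 0)%R <= n i + m l)%N ->
  exists m' M', [/\ deg_le n m' M', g *m M' = 0, minors M' != 0 & good n m' M'].
  move=> d0 dh cl sh.
  have [m' [M' [lt dM' gM' M'0]]] := relation_mx_step dM gM M0 d0 dh cl sh.
  by apply: (IHN m' M') => //; lia.
have argmax (c : 'cV[k]_r) : c != 0 -> exists2 l, c l 0 != 0 &
    forall x, c x 0 != 0 -> (m x <= m l)%N.
  move=> /cV0Pn[x0 cx0]; case: (arg_maxnP (P := fun x => c x 0 != 0) m cx0) => l cl lmax.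
  by exists l.
have [w wP] := poly_bezout (fun i => minors M 0 i).
set q := \sum_x _ in wP.
have q0 : q != 0.
  case/rV0Pn: M0 => i; apply: contraNneq => q0; have := wP i.
  by rewrite q0 dvd0p.
(* Zero at infinity: a constant kernel vector of the top matrix, made homogeneous by powers of ['X]
   relative to the largest [m l] on its support, combines the columns so that the top coefficients
   cancel. Here [d] is 1. *)
have [|topinj] := eqVneq (minors (top_mx n m M)) 0.
  case/minors_eq0_ker => c0 c0n Mc; have [l cl lmax] := argmax _ c0n.
  pose c : 'cV_r := \col_x ((c0 x 0) *: 'X^(m l - m x)).
  apply: (step (M *m c) c 1 l); rewrite ?oner_eq0 ?scale1r //.
    by rewrite mxE subnn expr0 scaler_eq0 oner_eq0 orbF.
  move=> i; apply/leq_sizeP => b leb; rewrite mxE coef_sum.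
  have tm x : (size (M i x * c x 0)%R <= (n i + m l).+1)%N.
    rewrite mxE; have [->|cx] := eqVneq (c0 x 0) 0; first by rewrite scale0r mulr0 size_poly0.
    rewrite -scalerAr; apply: leq_trans (size_scale_leq _ _) _.
    apply: leq_trans (size_polyMleq _ _) _; rewrite size_polyXn addnS /=.
    apply: leq_trans (leq_add (dM i x) (leqnn _)) _; have := lmax x cx; lia.
  have [->|nb] := eqVneq b (n i + m l)%N; last first.
    rewrite big1 // => x _; rewrite nth_default //; apply: leq_trans (tm x) _; lia.
  have := congr1 (fun A : 'cV[k]_r.+1 => A i 0) Mc; rewrite !mxE => E; rewrite -[RHS]E.
  apply: eq_bigr => x _; rewrite !mxE.
  have [->|cx] := eqVneq (c0 x 0) 0; first by rewrite scale0r mulr0 coef0 mulr0.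
  rewrite (_ : n i + m l = n i + m x + (m l - m x))%N; last by have := lmax x cx; lia.
  rewrite coefM_top //; first by rewrite coefZ coefXn eqxx mulr1.
  by apply: leq_trans (size_scale_leq _ _) _; rewrite size_polyXn.
have [/size_poly1P[e e0 qe]|sq] := boolP (size q == 1%N).
  exists m, M; split=> //; split; last first.
    move=> c; exact: minors_inj.
  exists (\col_i (e^-1 *: w i)); rewrite mxE.
  transitivity (e^-1 *: q).
    by rewrite scaler_sumr; apply: eq_bigr => i _; rewrite [(\col_i _) _ _]mxE scalerAr.
  by rewrite qe -mul_polyC -rmorphM mulVf.
(* Zero at a finite point [a]: a constant kernel vector of [M] evaluated at [a] gives a combination
   of columns divisible by ['X - a%:P], and the quotient is the new column. *)
have [a ra] := closed_rootP q sq.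
have : minors (map_mx (horner_eval a) M) = 0.
  rewrite map_minors; apply/rowP => i; rewrite [LHS]mxE [RHS]mxE /=.
  by have /dvdpP[u ->] := wP i; rewrite /horner_eval hornerM (rootP ra) mulr0.
case/minors_eq0_ker => c0 c0n Mc; have [l cl lmax] := argmax _ c0n.
pose c : 'cV_r := map_mx polyC c0.
have rt i : root ((M *m c) i 0) a.
  have := congr1 (fun A : 'cV[k]_r.+1 => A i 0) Mc; rewrite !mxE rootE => E; rewrite -[X in _ == X]E.
  rewrite horner_sum; apply/eqP; apply: eq_bigr => x _.
  by rewrite hornerM !mxE hornerC.
apply: (step (\col_i ((M *m c) i 0 %/ ('X - a%:P))) c ('X - a%:P) l).
- by rewrite polyXsubC_eq0.
- apply/colP => i; rewrite !mxE mulrC divpK // dvdp_XsubCl.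
  by have := rt i; rewrite mxE.
- by rewrite mxE polyC_eq0.
move=> i; rewrite mxE size_divp ?polyXsubC_eq0 // size_XsubC /=.
rewrite leq_subLR add1n mxE; apply: leq_trans (size_sum _ _ _) _.
apply/bigmax_leqP => x _; rewrite mxE.
have [->|cx] := eqVneq (c0 x 0) 0; first by rewrite mulr0 size_poly0.
rewrite mulrC mul_polyC; apply: leq_trans (size_scale_leq _ _) _.
by apply: leq_trans (dM i x) _; have := lmax x cx; lia.
Qed.

End Reduction.

Section Presentation.
Variables (k : closedFieldType) (r : nat) (n : 'I_r.+1 -> nat).
Variable g : 'rV[{poly k}]_r.+1.
Implicit Type M : 'M[{poly k}]_(r.+1, r).

Lemma good_minors_neq0 m M : good n m M -> minors M != 0.
Proof.
case=> -[w wM] _; apply: contra_eq_neq wM => ->.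
by rewrite mul0mx mxE eq_sym oner_eq0.
Qed.

(** Koszul relations against one nonzero generator; up to sign, the minor omitting its row is the
    [r]-th power of that generator. This is only the start of the descent. *)
Lemma exists_relation_mx J : g != 0 -> (forall i, size (g 0 i)%R <= J.+1)%N ->
  exists m M, [/\ deg_le n m M, g *m M = 0 & minors M != 0].
Proof.
case/rV0Pn => i0 gi0 sg.
pose M : 'M[{poly k}]_(r.+1, r) := \matrix_(i, l)
  if i == lift i0 l then g 0 i0 else if i == i0 then - g 0 (lift i0 l) else 0.
exists (fun=> J), M; split.
- move=> i l; rewrite mxE.
  case: eqP => _; last case: eqP => _; rewrite ?size_polyN ?size_poly0 //.
    by apply: leq_trans (sg _) _; lia.
  by apply: leq_trans (sg _) _; lia.
- apply/rowP => l; rewrite !mxE (bigD1 i0) //= (bigD1 (lift i0 l)) 1?eq_sym ?neq_lift //=.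
  rewrite big1 => [|i /andP[ii0 il]]; last by rewrite mxE (negPf ii0) (negPf il) mulr0.
  by rewrite !mxE !eqxx (negPf (neq_lift _ _)) addr0 mulrN mulrC addNr.
apply/rV0Pn; exists i0; rewrite mxE /cofactor.
set A := row' _ _; have -> : A = (g 0 i0)%:M.
  apply/matrixP => x y; rewrite !mxE; case: splitP => [z|z]; rewrite /= ?ord1 //.
  rewrite /bump /= => -[yz]; have {yz} -> : z = y by apply: val_inj.
  have li : (lift i0 x == i0) = false by rewrite eq_sym (negPf (neq_lift _ _)).
  by rewrite mxE (inj_eq lift_inj) li; case: (x == y).
by rewrite det_scalar mulf_eq0 signr_eq0 /= expf_neq0.
Qed.

(** Proportionality with a Bezout vector [w] gives [f] as [g *m w]. Since the top matrix is
    injective some minor attains its top degree, and the size of the corresponding entry of [g]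
    bounds that of [f]. *)
Lemma good_factor J m M : deg_le n m M -> good n m M -> g *m M = 0 -> g != 0 ->
  (forall i, size (g 0 i)%R + n i <= J.+1)%N ->
  exists f, [/\ f != 0, g = f *: minors M
    & (\sum_i n i + \sum_l m l + size f <= J.+1)%N].
Proof.
move=> dM gdM gM g0 sg; case: (gdM) => -[w wM] topM.
have e := minors_proportional w gM; rewrite wM scale1r in e.
have f0 : (g *m w) 0 0 != 0.
  by apply: contraNneq g0 => z; rewrite e z scale0r.
move: ((g *m w) 0 0) => f in e f0 *; exists f; split=> //.
have /rV0Pn[i ti] := minors_neq0 topM.
have [si ci] := size_coef_minors dM i; rewrite -ci in ti.
have ms : size (minors M 0 i) = (\sum_x n (lift i x) + \sum_l m l).+1.
  apply/eqP; rewrite eqn_leq si /= ltnNge; apply: contra ti => /leq_sizeP -> //.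
have mi0 : minors M 0 i != 0 by rewrite -size_poly_eq0 ms.
have := sg i; rewrite e mxE size_mul // ms (sum_lift n i) addnS /=.
by move: (size f) => sf; lia.
Qed.

Lemma exists_presentation J :
    (forall h : 'cV[{poly k}]_r.+1,
      (forall i, size (h i 0)%R <= n i)%N -> g *m h = 0 -> h = 0) ->
    g != 0 -> (forall i, size (g 0 i)%R + n i <= J.+1)%N ->
  exists m M f, [/\ deg_le n m M, good n m M, f != 0, g = f *: minors M
    & (\sum_i n i + \sum_l m l + size f <= J.+1)%N].
Proof.
move=> gi g0 sg; have sg' i : (size (g 0 i)%R <= J.+1)%N by apply: leq_trans (sg i); lia.
have [m0 [M0 [dM0 gM0 M00]]] := exists_relation_mx g0 sg'.
have [m [M [dM gM M1 gdM]]] := exists_good gi dM0 gM0 M00.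
by have [f [? ? ?]] := good_factor dM gdM gM g0 sg; exists m, M, f.
Qed.

End Presentation.

(** * Ranks of the generated spaces in higher degrees *)

Section Ranks.
Variables (k : fieldType) (r : nat) (n : 'I_r.+1 -> nat) (m : 'I_r -> nat).
Variables (M : 'M[{poly k}]_(r.+1, r)) (g : 'rV[{poly k}]_r.+1) (s L : nat).
Hypothesis dM : deg_le n m M.

(** The syzygies that the columns of [M] provide [s] degrees up. Truncated subtraction makes a
    column with [s <= m l] contribute nothing. *)
Definition rel_mx : 'M[k]_(\sum_l (s - m l), \sum_i (n i + s)) :=
  \mxrow_i gens_mx (fun l => s - m l)%N (n i + s) (fun l => M i l).

Lemma mul_rel_mx (c : 'I_r -> {poly k}) : (forall l, size (c l) <= s - m l)%N ->
  fam_row _ c *m rel_mx = fam_row _ (fun i => \sum_l M i l * c l).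
Proof.
move=> sc; rewrite mul_mxrow; apply/eq_mxrowP => i; rewrite mul_fam_row //.
by congr poly_rV; apply: eq_bigr => l _; rewrite mulrC.
Qed.

Lemma size_rel (c : 'I_r -> {poly k}) i : (forall l, size (c l) <= s - m l)%N ->
  (size (\sum_l M i l * c l)%R <= n i + s)%N.
Proof.
move=> sc; apply: leq_trans (size_sum _ _ _) _; apply/bigmax_leqP => l _.
have [->|cl] := eqVneq (c l) 0; first by rewrite mulr0 size_poly0.
apply: leq_trans (size_polyMleq _ _) _; rewrite -size_poly_gt0 in cl.
move: cl (dM i l) (sc l); move: (size (M i l)) (size (c l)) => a b; lia.
Qed.

Lemma rel_mx_free : minors M != 0 -> row_free rel_mx.
Proof.
move=> M0; rewrite -kermx_eq0; apply/rowV0P => v; rewrite sub_kermx -(fam_rowK v).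
have sc l : (size (rVpoly (submxrow v l)) <= s - m l)%N by apply: size_rVpoly.
rewrite mul_rel_mx // => /eqP/fam_row_eq0 h0.
have c0 := @minors_inj _ _ M (\col_l rVpoly (submxrow v l)) M0.
have {}c0 : \col_l rVpoly (submxrow v l) = 0 :> 'cV[{poly k}]_r.
  apply: c0; apply/colP => i; rewrite !mxE -[RHS](h0 _ i).
    by apply: eq_bigr => l _; rewrite mxE.
  by move=> i'; apply: size_rel.
apply/rowP => b; rewrite [RHS]mxE /fam_row mxE.
by have /colP/(_ (tagnat.sig1 b)) := c0; rewrite !mxE => ->; rewrite coef0.
Qed.

(** A nonzero minor makes the syzygies from the columns of [M] independent. This half therefore
    applies to every member of a family with nonzero minors. *)
Lemma rank_gens_le : minors M != 0 -> g *m M = 0 ->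
  (\rank (gens_mx (fun i => n i + s)%N L (g 0%R)) + \sum_l (s - m l)
    <= \sum_i (n i + s))%N.
Proof.
move=> M0 gM; have /eqP <- := rel_mx_free M0; rewrite addnC.
apply: mulmx0_rank_max; apply/row_matrixP => x; rewrite row_mul row0.
rewrite rowE; move: (delta_mx _ _) => v; rewrite -(fam_rowK v).
have sc l : (size (rVpoly (submxrow v l)) <= s - m l)%N by apply: size_rVpoly.
rewrite mul_rel_mx // mul_fam_row; last by move=> i; apply: size_rel.
rewrite (_ : \sum_i _ = (g *m M *m \col_l rVpoly (submxrow v l)) 0 0).
  by rewrite gM mul0mx mxE poly_rV0.
rewrite -mulmxA mxE; apply: eq_bigr => i _; rewrite mulrC; congr (_ * _).
by rewrite mxE; apply: eq_bigr => l _; rewrite mxE.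
Qed.

(** By [good_kernel] the columns of a good matrix give all syzygies. The size bounds ensure that
    nothing is cut off at [L], so that a kernel vector is a true syzygy. *)
Lemma rank_gens_ge (f : {poly k}) : good n m M -> f != 0 -> g = f *: minors M ->
    (forall i, size (g 0%R i) + n i + s <= L.+1)%N ->
  (\sum_i (n i + s) <=
   \rank (gens_mx (fun i => n i + s)%N L (g 0%R)) + \sum_l (s - m l))%N.
Proof.
move=> gdM f0 ge sg.
suff : (\rank (kermx (gens_mx (fun i => n i + s)%N L (g 0%R)))
    <= \sum_l (s - m l))%N by rewrite mxrank_ker leq_subLR.
apply: leq_trans (rank_leq_row rel_mx); apply/mxrankS/rV_subP => v.
rewrite sub_kermx -(fam_rowK v); set h := fun i => rVpoly _.
have sh i : (size (h i) <= n i + s)%N by apply: size_rVpoly.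
rewrite mul_fam_row // => /eqP/poly_rV_eq0 hg0.
have hg : \sum_i h i * g 0 i = 0.
  apply: hg0; apply: leq_trans (size_sum _ _ _) _; apply/bigmax_leqP => i _.
  have [->|hi] := eqVneq (h i) 0; first by rewrite mul0r size_poly0.
  apply: leq_trans (size_polyMleq _ _) _; rewrite -size_poly_gt0 in hi.
  by move: hi (sh i) (sg i); move: (size (h i)) (size (g 0 i)) => a b; lia.
have mh : minors M *m \col_i h i = 0.
  apply/eqP; have : f *: (minors M *m \col_i h i) = 0.
    rewrite scalemxAl -ge; apply/matrixP => a b; rewrite !ord1 [RHS]mxE -[RHS]hg mxE.
    by apply: eq_bigr => i _; rewrite mxE mulrC.
  by move/eqP; rewrite scalemx_eq0 (negPf f0).
have [|c hc sc] := good_kernel dM gdM mh (s := s); first by move=> i; rewrite mxE.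
have -> : fam_row (fun i => n i + s)%N h = fam_row (fun l => s - m l)%N (fun l => c l 0) *m rel_mx.
  rewrite mul_rel_mx //; apply/eq_mxrowP => i; congr poly_rV.
  by have /colP/(_ i) := hc; rewrite !mxE.
exact: submxMl.
Qed.

End Ranks.

(** * Free generation of saturated filtrations *)

Section Saturated.
Variables (k : fieldType) (L S : nat) (X : 'M[k]_L.+1) (N : nat -> 'M[k]_L.+1).
Hypothesis N0 : N 0 = 0.
Hypothesis N_incr : forall s, (s < S)%N -> (N s <= N s.+1)%MS.
Hypothesis N_shift : forall s, (s < S)%N -> (N s *m X <= N s.+1)%MS.
Hypothesis N_sat : forall s (v : 'rV_L.+1), (s < S)%N ->
  (v <= N s.+1)%MS -> (v *m X <= N s.+1)%MS -> (v <= N s)%MS.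
Hypothesis N_inj : forall v : 'rV_L.+1, (v <= N S)%MS -> v *m X = 0 -> v = 0.
Implicit Type gs : seq (nat * 'rV[k]_L.+1).

(** [N s] plays the part of degree [s - 1] of a graded module: multiplication by [y] is the
    inclusion into [N s.+1] and multiplication by [x] is [X]. A generator entering at step [x.1]
    thus contributes its images under [X ^+ a] for [a + x.1 <= s]. *)
Definition shift_span s gs : 'M[k]_L.+1 :=
  (\sum_(x <- gs) \sum_(a < s.+1 - x.1) <<x.2 *m X ^+ a>>)%MS.

Definition shift_count s gs : nat := (\sum_(x <- gs) (s.+1 - x.1))%N.

Lemma shift_spanP s gs m (B : 'M_(m, L.+1)) :
  reflect (forall x a, x \in gs -> (a + x.1 <= s)%N -> (x.2 *m X ^+ a <= B)%MS)
          (shift_span s gs <= B)%MS.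
Proof.
rewrite /shift_span; apply: (iffP idP) => [sB x a xgs ax | sB].
  apply: submx_trans sB; have lt : (a < s.+1 - x.1)%N by lia.
  rewrite (big_rem x xgs) /=; apply: submx_trans (addsmxSl _ _).
  by apply: (sumsmx_sup (Ordinal lt)) => //=; rewrite genmxE.
rewrite big_seq; elim/big_ind: _ => [|A C|x xgs]; first exact: sub0mx.
  by move=> *; rewrite addsmx_sub; apply/andP.
by apply/sumsmx_subP => a _; rewrite genmxE; apply: sB => //; rewrite addnC -ltnS -ltn_subRL.
Qed.

Lemma shift_span_mem s gs x a : x \in gs -> (a + x.1 <= s)%N ->
  (x.2 *m X ^+ a <= shift_span s gs)%MS.
Proof. by have /shift_spanP := submx_refl (shift_span s gs); apply. Qed.

Lemma shift_span_cat s gs gs' :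
  (shift_span s (gs ++ gs') :=: shift_span s gs + shift_span s gs')%MS.
Proof. by rewrite /shift_span big_cat /=. Qed.

Lemma N_le s t : (s <= t)%N -> (t <= S)%N -> (N s <= N t)%MS.
Proof.
elim: t => [|t IHt]; first by rewrite leqn0 => /eqP ->.
rewrite leq_eqVlt => /predU1P[-> //|st tS].
by apply: submx_trans (IHt _ _) (N_incr _) => //; lia.
Qed.

(** [shift_count] is the rank of a free module on these generators, so the equality of ranks says
    that there is no syzygy up to step [t]. *)
Definition gen_inv t gs :=
  [/\ sorted leq (unzip1 gs),
      forall x, x \in gs -> (0 < x.1 <= t)%N /\ (x.2 <= N x.1)%MS
    & forall s, (s <= t)%N -> (N s :=: shift_span s gs)%MS /\ \rank (N s) = shift_count s gs].

(* Saturation identifies [N t :&: N t *m X] with [N t.-1 *m X], so the rank of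
   [N t + N t *m X] is [2 rank (N t) - rank (N t.-1)], as for a free module. *)
Lemma gen_inv_shift t gs : (t <= S)%N -> gen_inv t gs ->
  (N t + N t *m X :=: shift_span t.+1 gs)%MS
  /\ \rank (N t + N t *m X)%MS = shift_count t.+1 gs.
Proof.
move=> tS [_ gsP gsN]; split.
  apply/eqmxP/andP; split; last first.
    apply/shift_spanP => x a xgs; rewrite leq_eqVlt => /predU1P[e|lt].
      have {gsN}[Nt _] := gsN t (leqnn t).
      case: a e => [|a] e; first by have [] := gsP _ xgs; lia.
      apply: submx_trans (addsmxSr _ _); rewrite exprSr -mulmxE mulmxA.
      apply: submxMr; rewrite Nt; apply: shift_span_mem => //.
      exact: eq_leq e.
    apply: submx_trans (addsmxSl _ _); have [Nt _] := gsN t (leqnn t).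
    by rewrite Nt; apply: shift_span_mem.
  have [Nt _] := gsN t (leqnn t); rewrite addsmx_sub.
  rewrite Nt (eqmxMr X Nt); apply/andP; split.
    by apply/shift_spanP => x a xgs ax; apply: shift_span_mem => //; exact: leqW.
  have -> : (shift_span t gs *m X <= shift_span t.+1 gs)%MS
     = (shift_span t gs <= kermx (X *m cokermx (shift_span t.+1 gs)))%MS.
    by rewrite sub_kermx mulmxA -submxE.
  apply/shift_spanP => x a xgs ax; rewrite sub_kermx mulmxA -submxE -mulmxA.
  by rewrite mulmxE -exprSr; apply: shift_span_mem.
have capE : (N t :&: N t *m X :=: N t.-1 *m X)%MS.
  case: t tS gsN gsP => [|t] tS gsN gsP; first by
    rewrite N0 mul0mx; apply/eqmxP/andP; split; [exact: capmxSr | exact: sub0mx].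
  apply/eqmxP/andP; split.
    apply/rV_subP => v; rewrite sub_capmx => /andP[vN /submxP[w vw]].
    rewrite vw mulmxA; apply: submxMr; apply: N_sat; rewrite ?submxMl //.
    by rewrite -mulmxA -vw.
  by rewrite sub_capmx N_shift //= submxMr // N_incr.
have rX s : (s <= S)%N -> \rank (N s *m X) = \rank (N s).
  move=> sS; apply/mxrank_injP/rowV0P => v; rewrite sub_capmx => /andP[vN].
  rewrite sub_kermx => /eqP; apply: N_inj; apply: submx_trans vN _; exact: N_le.
have := mxrank_sum_cap (N t) (N t *m X); rewrite capE !rX //; last by lia.
have [_ ->] := gsN t (leqnn t); have [_ ->] := gsN t.-1 (leq_pred t).
move=> e; apply: (@addIn (shift_count t.-1 gs)); rewrite {}e /shift_count -!big_split /=.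
rewrite big_seq [RHS]big_seq; apply: eq_bigr => x /gsP[/andP[x0 xt] _].
by move: x0 xt; move: (x.1) => a; lia.
Qed.

(** The new generators at step [t.+1] are a basis of a complement of [N t + N t *m X], which has its
    free rank by [gen_inv_shift]. Appending them keeps the list sorted by degree. *)
Lemma gen_inv_ex t : (t <= S)%N -> exists gs, gen_inv t gs.
Proof.
elim: t => [|t IHt] tS.
  exists [::]; split=> // s; rewrite leqn0 => /eqP ->.
  by rewrite N0 /shift_span /shift_count !big_nil mxrank0.
have [gs gsi] := IHt (ltnW tS); have [W rW] := gen_inv_shift (ltnW tS) gsi.
case: gsi => gss gsP gsN.
set D := (N t.+1 :\: (N t + N t *m X))%MS.
pose news := [seq (t.+1, row i (row_base D)) | i <- enum 'I_(\rank D)].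
have sW : (N t + N t *m X <= N t.+1)%MS by rewrite addsmx_sub N_incr // N_shift.
have newsP x : x \in news -> x.1 = t.+1 /\ (x.2 <= D)%MS.
  by case/mapP => i _ -> /=; split=> //; rewrite (submx_trans (row_sub _ _)) // eq_row_base.
have news_span : (shift_span t.+1 news :=: D)%MS.
  apply/eqmxP/andP; split.
    apply/shift_spanP => x a /newsP[-> xD] a0.
    by rewrite (_ : a = 0%N) ?expr0 ?mulmx1 //; lia.
  rewrite -(eq_row_base D); apply/row_subP => i.
  have := @shift_span_mem t.+1 news (t.+1, row i (row_base D)) 0.
  by rewrite expr0 mulmx1; apply; rewrite ?add0n // map_f // mem_enum.
exists (gs ++ news); split.
- rewrite /unzip1 map_cat -map_comp /=.
  have -> : [seq fst (t.+1, row i (row_base D)) | i <- enum 'I_(\rank D)]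
     = nseq (\rank D) t.+1.
    rewrite -[X in nseq X _]card_ord cardE; by elim: (enum _) => //= ? s <-.
  rewrite sorted_pairwise; last exact: leq_trans.
  rewrite pairwise_cat -!sorted_pairwise; try exact: leq_trans.
  rewrite gss /=; apply/andP; split; last first.
    by elim: (\rank D) => //= -[|e] //= ->; rewrite leqnn.
  apply/allrelP => a b /mapP[x /gsP[/andP[_ xt] _] ->] /nseqP[-> _].
  exact: leq_trans xt _.
- move=> x; rewrite mem_cat => /orP[/gsP[]|/newsP[-> xD]].
    by move=> /andP[-> /leqW ->].
  by split; [rewrite leqnn | apply: submx_trans xD (diffmxSl _ _)].
move=> s; rewrite leq_eqVlt => /predU1P[->|st].
  split.
    apply: eqmx_trans (eqmx_sym (shift_span_cat _ _ _)).
    apply: eqmx_trans (adds_eqmx W (eqmx_sym news_span)).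
    apply/eqmxP; rewrite /D; apply/andP; split.
      have /eqmxP/andP[_ le] := addsmx_diff_cap_eq (N t.+1) (N t + N t *m X)%MS.
      apply: submx_trans le _; rewrite addsmxC addsmxS //; exact: capmxSr.
    by rewrite addsmx_sub sW diffmxSl.
  rewrite -(mxrank_cap_compl (N t.+1) (N t + N t *m X)%MS) (capmx_idPr sW) rW.
  rewrite /shift_count big_cat /=; congr addn; rewrite big_map big_enum /=.
  by rewrite subSnn sum1_card card_ord.
have {gsN}[Ns rs] := gsN s st; split.
  apply: eqmx_trans Ns _; apply: eqmx_trans (eqmx_sym (shift_span_cat _ _ _)).
  have /eqP-> : shift_span s news == 0.
    by rewrite -submx0; apply/shift_spanP => x a /newsP[-> _]; lia.
  exact: eqmx_sym (addsmx0 _ _).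
rewrite rs /shift_count big_cat /= [X in (_ + X)%N]big1_seq ?addn0 // => x /andP[_ /newsP[-> _]].
by lia.
Qed.

End Saturated.

(** * Ancestors and descendants of a row space *)

Definition shift_mx (R : nzRingType) a p q : 'M[R]_(p, q) :=
  \matrix_(u, v) (v == u + a :> nat)%N%:R.

(** This is [R_s V]: with [y = 1] the monomials of degree [s] become the ['X^a] with [a <= s]. *)
Definition up (R : nzRingType) d J (A : 'M[R]_(d, J)) L s :
    'M[R]_(\sum_(a < s.+1) d, L) :=
  \mxcol_(a < s.+1) (A *m shift_mx R a J L).

Section UpDown.
Variable k : fieldType.

Lemma mul_shift_mx a p q (v : 'rV[k]_p) :
  v *m shift_mx k a p q = poly_rV (rVpoly v * 'X^a).
Proof.
apply/rowP => b; rewrite mxE [RHS]mxE coefMXn coef_rVpoly.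
have [ba|ab] := ltnP b a.
  by rewrite big1 // => i _; rewrite mxE (_ : _ == _ = false) ?mulr0 //; lia.
case: insubP => [u _ ub|nu].
  rewrite (bigD1 u) //= big1 => [|i iu].
    by rewrite addr0 mxE ub subnK // eqxx mulr1.
  rewrite mxE (_ : _ == _ = false) ?mulr0 //; apply/negP => /eqP e.
  by move/negP: iu; apply; rewrite -val_eqE /= ub e addnK.
rewrite big1 // => i _; rewrite mxE (_ : _ == _ = false) ?mulr0 //.
by apply: contraNF nu => /eqP ->; rewrite addnK.
Qed.

Lemma shift_mx_free a p q : (p + a <= q)%N -> row_free (shift_mx k a p q).
Proof.
move=> le; rewrite -kermx_eq0; apply/rowV0P => v; rewrite sub_kermx mul_shift_mx.
move/eqP/poly_rV_eq0 => e; rewrite -[v]rVpolyK.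
have /eqP : rVpoly v * 'X^a = 0.
  apply: e; apply: leq_trans (size_polyMleq _ _) _; rewrite size_polyXn.
  by have := size_rVpoly v; move: (size _) => z; lia.
by rewrite mulf_eq0 expf_eq0 polyX_eq0 andbF orbF => /eqP ->; rewrite poly_rV0.
Qed.

Section Def.
Variables (d J : nat) (A : 'M[k]_(d, J)).

(** This is [R_{-s} V], the common kernel of the [s.+1] shifts read modulo [A]. *)
Definition down p s : 'M[k]_p :=
  kermx (\mxrow_(a < s.+1) (shift_mx k a p J *m cokermx A)).

Lemma up_subP L s m (B : 'M_(m, L)) :
  reflect (forall a, (a <= s)%N -> (A *m shift_mx k a J L <= B)%MS) (up A L s <= B)%MS.
Proof.
rewrite /up eqmx_col; apply: (iffP sumsmx_subP) => [sB a as_|sB a _].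
  have lt : (a < s.+1)%N by [].
  by have := sB (Ordinal lt) isT; rewrite genmxE.
by rewrite genmxE; apply: sB; have := ltn_ord a; lia.
Qed.

Lemma sub_up L s a : (a <= s)%N -> (A *m shift_mx k a J L <= up A L s)%MS.
Proof. by move: a; apply/up_subP. Qed.

Lemma down_subP p s (v : 'rV_p) :
  reflect (forall a, (a <= s)%N -> (v *m shift_mx k a p J <= A)%MS) (v <= down p s)%MS.
Proof.
rewrite sub_kermx mul_mxrow; apply: (iffP eqP) => [e a as_|sA].
  have lt : (a < s.+1)%N by [].
  have /(congr1 (fun B => submxrow B (Ordinal lt))) := e.
  by rewrite mxrowK submxrow0 mulmxA submxE => ->.
apply/rowP => x; rewrite mxE [RHS]mxE mulmxA.
by have := sA (tagnat.sig1 x) (leq_ord _); rewrite submxE => /eqP ->; rewrite mxE.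
Qed.

End Def.

Lemma eqmx_up d d' J L s (A : 'M[k]_(d, J)) (B : 'M[k]_(d', J)) :
  (A :=: B)%MS -> (up A L s :=: up B L s)%MS.
Proof.
move=> AB; apply/eqmxP/andP; split; apply/up_subP => a as_;
  [rewrite (eqmxMr _ AB)|rewrite -(eqmxMr _ AB)]; exact: sub_up.
Qed.

Lemma eqmx_down d d' J p s (A : 'M[k]_(d, J)) (B : 'M[k]_(d', J)) :
  (A :=: B)%MS -> (down A p s :=: down B p s)%MS.
Proof.
move=> AB; apply/eqmxP/andP; split; apply/rV_subP => v /down_subP vA;
  apply/down_subP => a /vA; by rewrite AB.
Qed.

(** The first hypothesis excludes a nonzero generator with [n i = 0]: it has no multiple among the
    rows on the left but would acquire some on the right. *)
Lemma up_gens r (n : 'I_r -> nat) J s (g : 'I_r -> {poly k}) :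
  (forall i, (0 < n i)%N \/ g i = 0) -> (forall i, (size (g i) + n i <= J.+1)%N) ->
  (up (gens_mx n J g) (J + s) s :=: gens_mx (fun i => n i + s)%N (J + s) g)%MS.
Proof.
move=> n0 sg; apply/eqmxP/andP; split.
  apply/up_subP => a as_; apply/row_subP => x; rewrite row_mul mul_shift_mx.
  have /sub_gens_mxP[h sh ->] := row_sub x (gens_mx n J g).
  rewrite poly_rV_K; last first.
    apply: leq_trans (size_sum _ _ _) _; apply/bigmax_leqP => i _.
    have [->|hi] := eqVneq (h i) 0; first by rewrite mul0r size_poly0.
    apply: leq_trans (size_polyMleq _ _) _; rewrite -size_poly_gt0 in hi.
    by move: hi (sh i) (sg i); move: (size (h i)) (size (g i)); lia.
  rewrite mulr_suml (eq_bigr (fun i => (h i * 'X^a) * g i)); last by move=> i _; ring.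
  apply: sub_gens_mx => i; apply: leq_trans (size_polyMleq _ _) _.
  by rewrite size_polyXn addnS /=; apply: leq_add.
apply: gens_mx_sub => i e ei; have [ni|->] := n0 i; last first.
  by rewrite mul0r poly_rV0 sub0mx.
(* ['X^e] is split into a multiplier already among the [n i] rows and a shift by at most [s]. *)
pose b := minn e (n i).-1; have eb : e = (b + (e - b))%N by rewrite /b; lia.
have ebs : (e - b <= s)%N by rewrite /b; lia.
apply: submx_trans (sub_up _ _ ebs).
have bi : (b < n i)%N by rewrite /b; lia.
have := submxMr (shift_mx k (e - b) J (J + s)) (@sub_gens_mx1 _ _ n J g i b bi).
rewrite mul_shift_mx poly_rV_K; first by rewrite -mulrA -exprD -eb.
apply: leq_trans (size_polyMleq _ _) _; rewrite size_polyXn.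
by have := sg i; move: (size (g i)); lia.
Qed.

(** * Free generators of the ancestor ideal *)

Section Generators.
Variables (d J : nat) (A : 'M[k]_(d, J)).

Let L := J.+1.
Let X : 'M[k]_L := shift_mx k 1 L L.
Let N t : 'M[k]_L := <<down A t (J - t) *m shift_mx k 0 t L>>%MS.

Let N_P t (v : 'rV_L) : (t <= J)%N ->
  reflect ((size (rVpoly v) <= t)%N /\
     forall a, (a <= J - t)%N -> (poly_rV (rVpoly v * 'X^a) <= A)%MS) (v <= N t)%MS.
Proof.
move=> tJ; rewrite /N genmxE; apply: (iffP submxP) => [[w ->]|[sv vA]].
  rewrite mulmxA mul_shift_mx expr0 mulr1.
  have sw := size_rVpoly (w *m down A t (J - t)).
  rewrite poly_rV_K; last by apply: leq_trans sw _; apply: leqW.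
  split=> // a aJ; rewrite -mul_shift_mx.
  by have /down_subP := submxMl w (down A t (J - t)); apply.
have /submxP[w we] : ((poly_rV (rVpoly v) : 'rV_t) <= down A t (J - t)%N)%MS.
  by apply/down_subP => a aJ; rewrite mul_shift_mx poly_rV_K // vA.
exists w; rewrite mulmxA -we mul_shift_mx expr0 mulr1 poly_rV_K //.
by rewrite rVpolyK.
Qed.

(** Up to the degree of [A], if [x f] and [y f] lie in the ancestor ideal then so does [f]; this is
    the saturation that makes the filtration free. One more use of [gen_inv_shift], at the last
    step, gives independence one degree beyond that of [A]. *)
Lemma exists_generators : row_free A ->
  exists p (n : 'I_p -> nat) (g : 'I_p -> {poly k}),
  [/\ forall i, (0 < n i)%N,
      forall i i' : 'I_p, (i <= i')%N -> (n i' <= n i)%N,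
      forall i, (size (g i) + n i <= J.+1)%N,
      (gens_mx n J g :=: A)%MS
    & (forall t, (t <= J)%N -> \rank (down A t (J - t)) = \sum_i (n i - (J - t)))%N
      /\ \rank (gens_mx (fun i => n i + 1)%N J.+1 g) = (\sum_i (n i + 1))%N].
Proof.
move=> freeA.
have N0 : N 0 = 0 by apply/eqP; rewrite -submx0 /N genmxE [down _ _ _]flatmx0 mul0mx sub0mx.
have N_incr s : (s < J)%N -> (N s <= N s.+1)%MS.
  move=> sJ; apply/rV_subP => v /(N_P _ (ltnW sJ))[sv vA].
  by apply/N_P => //; split=> [|a aJ]; [exact: leqW | apply: vA; lia].
have N_shift s : (s < J)%N -> (N s *m X <= N s.+1)%MS.
  move=> sJ; apply/rV_subP => _ /submxP[w ->]; rewrite mulmxA.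
  have /(N_P _ (ltnW sJ))[sv vA] := submxMl w (N s).
  have sX : (size (rVpoly (w *m N s) * 'X^1)%R <= s.+1)%N.
    by rewrite expr1 (leq_trans (size_polyMleq _ _)) // size_polyX addn2.
  apply/N_P => //; rewrite mul_shift_mx poly_rV_K; last exact: leq_trans sX (leqW sJ).
  split=> // a aJ; rewrite -mulrA -exprD; apply: vA; lia.
have N_sat s (v : 'rV_L) : (s < J)%N ->
    (v <= N s.+1)%MS -> (v *m X <= N s.+1)%MS -> (v <= N s)%MS.
  move=> sJ /(N_P _ sJ)[sv vA] /(N_P _ sJ).
  have sX : (size (rVpoly v * 'X^1)%R <= L)%N.
    by rewrite expr1 (leq_trans (size_polyMleq _ _)) // size_polyX addn2 /= ltnS;
      apply: leq_trans sv _.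
  rewrite mul_shift_mx poly_rV_K // => -[sv' vA'].
  apply/N_P; first exact: ltnW.
  split=> [|[|a] aJ].
  - have [->|v0] := eqVneq (rVpoly v) 0; first by rewrite size_poly0.
    by move: sv'; rewrite expr1 size_mulX.
  - exact: vA.
  - have aJ' : (a <= J - s.+1)%N by lia.
    by have := vA' a aJ'; rewrite -mulrA -exprD.
have N_inj (v : 'rV_L) : (v <= N J)%MS -> v *m X = 0 -> v = 0.
  move=> /(N_P _ (leqnn J))[sv _]; rewrite mul_shift_mx => /poly_rV_eq0 e.
  rewrite -[v]rVpolyK; have /eqP : rVpoly v * 'X^1 = 0.
    by apply: e; rewrite expr1 (leq_trans (size_polyMleq _ _)) // size_polyX addn2.
  by rewrite mulf_eq0 expf_eq0 polyX_eq0 orbF => /eqP ->; rewrite poly_rV0.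
have [gs gi] := gen_inv_ex N0 N_incr N_shift N_sat N_inj (leqnn J).
have [_ rNX] := gen_inv_shift N0 N_incr N_shift N_sat N_inj (leqnn J) gi.
have [gss gsP gsN] := gi.
have [sNX _] := gen_inv_shift N0 N_incr N_shift N_sat N_inj (leqnn J) gi.
have expX a : X ^+ a = shift_mx k a L L.
  elim: a => [|a IHa]; first by rewrite expr0; apply/matrixP => x y; rewrite !mxE addn0 eq_sym.
  rewrite exprSr IHa -mulmxE; apply/row_matrixP => x; rewrite row_mul !rowE.
  rewrite !mul_shift_mx; apply/rowP => b; rewrite !mxE expr1 [in RHS]exprSr mulrA coefMX [in RHS]coefMX.
  case: eqP => // b0; rewrite coef_rVpoly.
  have lt : (b.-1 < L)%N by have := ltn_ord b; lia.
  by rewrite insubT mxE.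
pose p := size gs; pose x_ i := tnth (in_tuple gs) i.
(* A generator entering at step [x.1] has [J.+1 - x.1] shifts in step [J], the degree of [A]. *)
pose n i := (J.+1 - (x_ i).1)%N; pose g i := rVpoly (x_ i).2.
have xP i : (0 < (x_ i).1 <= J)%N /\ ((x_ i).2 <= N (x_ i).1)%MS.
  by apply: gsP; apply: mem_tnth.
have gP i : (size (g i) <= (x_ i).1)%N /\
    forall a, (a < n i)%N -> (poly_rV (g i * 'X^a) <= A)%MS.
  have [/andP[_ xJ] /(N_P _ xJ)[sg gA]] := xP i.
  by split=> // a aJ; apply: gA; move: aJ xJ; rewrite /n; move: (x_ i).1; lia.
have span_gens s : (shift_span X (J + s) gs <= gens_mx (fun i => n i + s)%N L g)%MS.
  apply/shift_spanP => x a xgs ax; rewrite expX mul_shift_mx.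
  have /tnthP[i xi] : x \in in_tuple gs by [].
  have xi' : x_ i = x by rewrite /x_ xi.
  have := @sub_gens_mx1 _ p (fun i => n i + s)%N L g i a; rewrite /g xi'; apply.
  have [/andP[_ xJ] _] := xP i; move: ax xJ; rewrite /n xi'.
  by move: x.1; lia.
have count_gens s : shift_count s gs = (\sum_i (s.+1 - (x_ i).1))%N.
  by rewrite /shift_count (big_tnth _ _ gs).
exists p, n, g; split.
- by move=> i; rewrite subn_gt0; have [/andP[_ xJ] _] := xP i.
- move=> i i' ii; apply: leq_sub2l; rewrite /x_ !(tnth_nth (0%N, 0)) /=.
  rewrite -!(nth_map _ 0%N fst) //; apply: (sorted_leq_nth leq_trans leqnn _ gss) => //.
    by rewrite inE size_map.
  by rewrite inE size_map.
- move=> i; have [sg _] := gP i; have [/andP[_ xJ] _] := xP i.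
  by move: sg xJ; rewrite /n; move: (size _) (x_ i).1; lia.
- apply/eqmxP/andP; split; first by apply: gens_mx_sub => i a /(proj2 (gP i)).
  apply/rV_subP => v vA.
  have vN : (v *m shift_mx k 0 J L <= N J)%MS.
    have sv := size_rVpoly v.
    apply/N_P => //; rewrite mul_shift_mx expr0 mulr1 poly_rV_K; last exact: leqW.
    by split=> // a; rewrite subnn leqn0 => /eqP ->; rewrite expr0 mulr1 rVpolyK.
  have [NJ _] := gsN J (leqnn J); rewrite NJ in vN.
  have /sub_gens_mxP[h sh e] := submx_trans vN (eq_ind _ (fun s => (shift_span X s gs <= _)%MS) (span_gens 0%N) _ (addn0 J)).
  rewrite -[v]rVpolyK; have -> : rVpoly v = \sum_i h i * g i.
    apply: (@poly_rV_inj _ L); last by rewrite -e mul_shift_mx expr0 mulr1.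
      by apply: leqW; apply: size_rVpoly.
    apply: leq_trans (size_sum _ _ _) _; apply/bigmax_leqP => i _.
    have [->|hi] := eqVneq (h i) 0; first by rewrite mul0r size_poly0.
    apply: leq_trans (size_polyMleq _ _) _; rewrite -size_poly_gt0 in hi.
    have [sg _] := gP i; have [/andP[_ xJ] _] := xP i.
    have := sh i; move: hi sg xJ; rewrite /n.
    by move: (size (h i)) (size (g i)) (x_ i).1; lia.
  by apply: sub_gens_mx => i; rewrite -[n i]addn0.
split=> [t tJ|].
  have [_ rN] := gsN t tJ; move: rN.
  rewrite /N mxrank_gen mxrankMfree ?shift_mx_free //; last by lia.
  move=> ->; rewrite count_gens; apply: eq_bigr => i _; rewrite /n.
  by have [/andP[_ xJ] _] := xP i; move: xJ; move: (x_ i).1; lia.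
apply/eqP; rewrite eqn_leq rank_leq_row /=.
have := mxrankS (span_gens 1%N); rewrite addn1 -sNX rNX count_gens.
apply: leq_trans; apply: leq_sum => i _; rewrite /n.
by have [/andP[_ xJ] _] := xP i; move: xJ; move: (x_ i).1; lia.
Qed.

End Generators.
End UpDown.

(** * Dehomogenization *)

Section Dehomogenize.
Variable k : fieldType.

Definition dehom : {mpoly k[2]} -> {poly k} :=
  mmap (@polyC k) (fun t : 'I_2 => if val t == 0%N then 'X else 1).

Lemma dehomM p q : dehom (p * q) = dehom p * dehom q.
Proof. exact: rmorphM. Qed.

Lemma mdeg2 (m : 'X_{1..2}) : mdeg m = (m ord0 + m (lift ord0 ord0))%N.
Proof. by rewrite mdegE big_ord_recl big_ord_recl big_ord0 addn0. Qed.

Lemma form_monom0 i s : form_monom i s ord0 = s.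
Proof. by rewrite mnmE. Qed.

Lemma form_monomE i (m : 'X_{1..2}) : mdeg m = i -> form_monom i (m ord0) = m.
Proof.
rewrite mdeg2 => e; apply/mnmP => t; rewrite mnmE.
case: (unliftP ord0 t) => [x|] -> //=; rewrite -e addKn.
by congr (m _); apply: val_inj; rewrite /= ord1.
Qed.

Lemma coef_dehom i (f : forms k i) s :
  (dehom (val f))`_s = if (s <= i)%N then (val f)@_(form_monom i s) else 0.
Proof.
have hf m : m \in msupp (val f) -> mdeg m = i.
  by move: m; apply/dhomogP/dhomog_is_dhomog.
have E m : mmap1 (fun t : 'I_2 => if val t == 0%N then 'X else 1 : {poly k}) m = 'X^(m ord0).
  by rewrite /mmap1 big_ord_recl big_ord_recl big_ord0 /= expr1n !mulr1.
rewrite /dehom /mmap coef_sum.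
under eq_bigr do rewrite E mul_polyC coefZ coefXn.
case: leqP => [si|is_].
  have [ms|nms] := boolP (form_monom i s \in msupp (val f)).
    rewrite (bigD1_seq _ ms (msupp_uniq _)) /= form_monom0 eqxx mulr1.
    rewrite big_seq_cond big1 ?addr0 // => m /andP[mf mne].
    case: eqP => [sm|_]; rewrite ?mulr0 //.
    by move: mne; rewrite sm form_monomE ?hf // eqxx.
  rewrite memN_msupp_eq0 // big_seq big1 // => m mf.
  case: eqP => [sm|_]; rewrite ?mulr0 //.
  by move: nms; rewrite sm form_monomE ?hf // mf.
rewrite big_seq big1 // => m mf; case: eqP => [sm|_]; rewrite ?mulr0 //.
by have := hf _ mf; rewrite mdeg2 -sm; lia.
Qed.

Definition form_row i (f : forms k i) : 'rV[k]_i.+1 :=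
  \row_s (val f)@_(form_monom i s).

Lemma form_row_is_linear i : linear (@form_row i).
Proof.
by move=> c f g; apply/rowP => s; rewrite !mxE /= mcoeffD mcoeffZ.
Qed.

HB.instance Definition _ i := GRing.isLinear.Build k (forms k i) 'rV[k]_i.+1 _
  (@form_row i) (@form_row_is_linear i).

Lemma rVpoly_form_row i (f : forms k i) : rVpoly (form_row f) = dehom (val f).
Proof.
apply/polyP => s; rewrite coef_dehom coef_rVpoly.
case: insubP => [u us <-|]; first by rewrite mxE -ltnS ltn_ord.
by rewrite ltnS => /negPf ->.
Qed.

Lemma form_row_inj i : injective (@form_row i).
Proof.
move=> f g e; apply: val_inj; apply/mpolyP => m.
have [mi|mi] := eqVneq (mdeg m) i; last first.
  by rewrite !(dhomog_nemf_coeff (dhomog_is_dhomog _)).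
have := congr1 (fun v : 'rV_i.+1 => v 0 (inord (m ord0))) e; rewrite !mxE inordK.
  by rewrite form_monomE.
by rewrite ltnS -mi mdeg2 leq_addr.
Qed.

Lemma form_row_mul i l m (h : forms k i) (f : forms k l) : (i + l)%N = m ->
  rVpoly (form_row (form_mul m h f)) = rVpoly (form_row h) * rVpoly (form_row f).
Proof. by move=> e; rewrite !rVpoly_form_row form_mulE // dehomM. Qed.

Lemma dim_forms i : \dim {: forms k i} = i.+1.
Proof. by rewrite dimvf /dim /= addn1 binSn. Qed.

Definition space_mx i (U : {vspace forms k i}) : 'M[k]_(\dim U, i.+1) :=
  \matrix_(x < \dim U) form_row (vbasis U)`_x.

Lemma mem_space_mx i (U : {vspace forms k i}) f :
  (form_row f <= space_mx U)%MS = (f \in U).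
Proof.
apply/idP/idP => [/submxP[w e]|fU].
  have -> : f = \sum_x w 0 x *: (vbasis U)`_x.
    apply: form_row_inj; rewrite e linear_sum /= mulmx_sum_row.
    by apply: eq_bigr => x _; rewrite linearZ rowK.
  apply: rpred_sum => x _; apply: rpredZ; apply: vbasis_mem.
  by rewrite mem_nth // size_tuple.
rewrite (coord_vbasis fU) linear_sum /=; apply: summx_sub => x _.
rewrite linearZ scalemx_sub //; apply: (eq_row_sub x).
by rewrite rowK.
Qed.

Lemma rank_space_mx i (U : {vspace forms k i}) : \rank (space_mx U) = \dim U.
Proof.
apply/eqP; rewrite -/(row_free _) -kermx_eq0; apply/rowV0P => v.
rewrite sub_kermx mulmx_sum_row => /eqP e.
have /freeP fr := basis_free (vbasisP U).
apply/rowP => x; rewrite [RHS]mxE; apply: (fr (fun x => v 0 x)).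
apply: form_row_inj; rewrite linear0 -[RHS]e linear_sum; apply: eq_bigr => y _.
by rewrite linearZ rowK.
Qed.

Lemma form_row_surj i (v : 'rV[k]_i.+1) : exists f : forms k i, v = form_row f.
Proof.
have full : row_full (space_mx {: forms k i}).
  by rewrite /row_full rank_space_mx dim_forms.
have /submxP[w ->] := submx_full v full.
exists (\sum_x w 0 x *: (vbasis {: forms k i})`_x).
rewrite linear_sum /= mulmx_sum_row; apply: eq_bigr => x _.
by rewrite linearZ rowK.
Qed.

Lemma exists_mx_space i m (B : 'M[k]_(m, i.+1)) :
  exists U : {vspace forms k i}, (space_mx U :=: B)%MS.
Proof.
pose f (u : forms k i) : 'rV[k]_i.+1 := form_row u *m cokermx B.
have lf : linear f by move=> c u v; rewrite /f linearP mulmxDl -scalemxAl.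
pose lfB := GRing.isLinear.Build k (forms k i) 'rV[k]_i.+1 _ f lf.
pose F : {linear forms k i -> 'rV[k]_i.+1} := HB.pack f lfB.
exists (lker (linfun F)); apply/eqmxP/andP.
have E u : (u \in lker (linfun F)) = (form_row u <= B)%MS.
  by rewrite memv_ker lfunE /= /f submxE.
split; apply/rV_subP => v; have [u ->] := form_row_surj v; rewrite mem_space_mx E //.
Qed.

Lemma space_mx_Rmul j s m (V : {vspace forms k j}) : (s + j)%N = m ->
  (space_mx (Rmul s m V) :=: up (space_mx V) m.+1 s)%MS.
Proof.
move=> e; apply/eqmxP/andP; split.
  have [U UE] := exists_mx_space (up (space_mx V) m.+1 s).
  apply/rV_subP => v; have [u ->] := form_row_surj v.
  rewrite -UE !mem_space_mx; apply/subvP/Rmul_subP => h f fV.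
  rewrite -mem_space_mx UE -[form_row _]rVpolyK form_row_mul //.
  rewrite -[form_row h in X in (X <= _)%MS]rVpolyK [rVpoly (poly_rV _)]poly_def.
  rewrite mulr_suml linear_sum; apply: summx_sub => a _.
  rewrite -scalerAl linearZ scalemx_sub //= mulrC -mul_shift_mx.
  apply: submx_trans (sub_up _ _ (leq_ord a)); apply: submxMr.
  by rewrite mem_space_mx.
apply/up_subP => a as_; apply/row_subP => x; rewrite row_mul mul_shift_mx.
have [h hE] := @form_row_surj s (delta_mx 0 (inord a)).
rewrite rowK -[rVpoly _ * _](_ : rVpoly (form_row (form_mul m h (vbasis V)`_x)) = _).
  rewrite rVpolyK mem_space_mx; have /Rmul_subP := subvv (Rmul s m V); apply.
  by rewrite vbasis_mem // mem_nth // size_tuple.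
by rewrite form_row_mul // -hE rVpoly_delta inordK // mulrC.
Qed.

Lemma space_mx_Rdiv j s m (V : {vspace forms k j}) : (s + m)%N = j ->
  (space_mx (Rdiv s m V) :=: down (space_mx V) m.+1 s)%MS.
Proof.
move=> e; apply/eqmxP/andP; split; apply/rV_subP => v; have [f ->] := form_row_surj v;
  rewrite mem_space_mx.
  move/Rdiv_memP => fV; apply/down_subP => a as_.
  have [h hE] := @form_row_surj s (delta_mx 0 (inord a)).
  have := fV h; rewrite -mem_space_mx -[form_row (form_mul _ _ _)]rVpolyK form_row_mul //.
  by rewrite -hE rVpoly_delta inordK // mulrC -mul_shift_mx.
move/down_subP => fA; apply/Rdiv_memP => h.
rewrite -mem_space_mx -[form_row (form_mul _ _ _)]rVpolyK form_row_mul //.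
rewrite -[form_row h in X in (X <= _)%MS]rVpolyK [rVpoly (poly_rV _)]poly_def.
rewrite mulr_suml linear_sum; apply: summx_sub => a _.
by rewrite -scalerAl linearZ scalemx_sub //= mulrC -mul_shift_mx fA // leq_ord.
Qed.

Section Grass.
Variables (d j : nat).

Lemma grass_mx_space (V : Grass k d j) : (grass_mx V :=: space_mx V)%MS.
Proof.
apply/eqmxP/andP; split; apply/row_subP => x.
  have lt : (x < \dim V)%N by rewrite grass_dim.
  apply: (eq_row_sub (Ordinal lt)); apply/rowP => b; rewrite !mxE.
  by [].
have lt : (x < d)%N by apply: leq_trans (ltn_ord x) _; rewrite grass_dim.
apply: (eq_row_sub (Ordinal lt)); apply/rowP => b; rewrite !mxE.
by [].
Qed.

Lemma grass_mx_free (V : Grass k d j) : row_free (grass_mx V).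
Proof. by rewrite /row_free grass_mx_space rank_space_mx grass_dim. Qed.

Lemma exists_grass m (B : 'M[k]_(m, j.+1)) : \rank B = d ->
  exists V : Grass k d j, (grass_mx V :=: B)%MS.
Proof.
have [U UB] := exists_mx_space B; rewrite -UB rank_space_mx => dU.
exists (MkGrass dU); apply: eqmx_trans UB; exact: (grass_mx_space (MkGrass dU)).
Qed.

Lemma ancestor_hilbert_up (V : Grass k d j) s :
  ancestor_hilbert V (j + s) = ((j + s).+1 - \rank (up (grass_mx V) (j + s).+1 s))%N.
Proof.
rewrite /ancestor_hilbert dim_forms /ancestor leq_addr addKn -rank_space_mx.
rewrite space_mx_Rmul ?(addnC s) //; congr (_ - _)%N.
by rewrite (eqmx_up _ _ (grass_mx_space V)).
Qed.

Lemma ancestor_hilbert_down (V : Grass k d j) s : (0 < s <= j)%N ->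
  ancestor_hilbert V (j - s) = ((j - s).+1 - \rank (down (grass_mx V) (j - s).+1 s))%N.
Proof.
move=> sj; rewrite /ancestor_hilbert dim_forms /ancestor leqNgt.
rewrite (_ : (j - s < j)%N = true) /=; last by lia.
rewrite -rank_space_mx space_mx_Rdiv; last by lia.
rewrite (_ : j - (j - s) = s)%N; last by lia.
by rewrite (eqmx_down _ _ (grass_mx_space V)).
Qed.

End Grass.
End Dehomogenize.

(** * Zariski closure and one-parameter families *)

(** Compression by constant matrices turns a lower rank bound into the nonvanishing of one
    determinant, polynomial in the entries of [A]. It serves both for closed conditions and for
    generic ones. *)
Lemma rank_ge_det (k : fieldType) p q (A : 'M[k]_(p, q)) a :
  (a <= \rank A)%N <-> exists (X : 'M_(a, p)) (Y : 'M_(q, a)), \det (X *m A *m Y) != 0.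
Proof.
split=> [le|[X [Y]]]; last first.
  rewrite -unitfE -[_ \in _]unitmxE => /mxrank_unit rXAY; rewrite -{1}rXAY.
  by apply: leq_trans (mxrankM_maxl _ _) (mxrankM_maxr _ _).
have /row_freeP[Y0 hY] := row_base_free A; have /row_fullP[X0 hX] := col_base_full A.
pose P : 'M[k]_(a, \rank A) := pid_mx a; pose P' : 'M[k]_(\rank A, a) := pid_mx a.
exists (P *m X0), (Y0 *m P').
have e : X0 *m A *m Y0 = 1%:M.
  transitivity (X0 *m (col_base A *m row_base A) *m Y0); first by rewrite mulmx_base.
  by rewrite mulmxA hX mul1mx.
have -> : P *m X0 *m A *m (Y0 *m P') = 1%:M.
  have -> : P *m X0 *m A *m (Y0 *m P') = P *m (X0 *m A *m Y0) *m P' by rewrite !mulmxA.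
  by rewrite e mulmx1 /P /P' mul_pid_mx minnn (minn_idPr le) pid_mx_1.
by rewrite det1 oner_neq0.
Qed.

Section Curve.
Variables (k : closedFieldType) (d j : nat).

Lemma poly_eq0_everywhere (p : {poly k}) : (forall x, p.[x] = 0) -> p = 0.
Proof.
move=> p0; apply/eqP/negPn/negP => /closed_nonrootP[x] /negP; apply.
by rewrite rootE p0.
Qed.

Definition maximal_minors (R : comNzRingType) (A : 'M[R]_(d, j.+1))
    (t : 'I_#|plucker_index d j|) : R :=
  \det (\matrix_(r < d, s < d)
    A r (nth ord0 (enum (enum_val t : {set 'I_j.+1})) s) : 'M_d).

Notation pl A := (fun t : 'I_#|plucker_index d j| => maximal_minors A t).

Lemma maximal_minorsM (R : comNzRingType) U (A : 'M[R]_(d, j.+1)) t :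
  maximal_minors (U *m A) (t : 'I_#|plucker_index d j|) = \det U * maximal_minors A t.
Proof.
rewrite /maximal_minors -det_mulmx; congr (\det _).
by apply/matrixP => x y; rewrite !mxE; apply: eq_bigr => z _; rewrite !mxE.
Qed.

Lemma meval_scale N (F : {mpoly k[N]}) e c (v : 'I_N -> k) : F \is e.-homog ->
  F.@[fun t => c * v t] = c ^+ e * F.@[v].
Proof.
move=> /dhomogP hF; rewrite !mevalE mulr_sumr big_seq [RHS]big_seq.
apply: eq_bigr => m mF; have <- : mdeg m = e := hF m mF.
rewrite mulrCA; congr (_ * _).
rewrite mdegE -prodrXr -big_split /=; apply: eq_bigr => i _.
by rewrite exprMn.
Qed.

(** An equation [F] of a closed set, pulled back to the minors of [A], becomes a polynomial in the
    parameter. It vanishes outside the zeros of [Q] and [D], hence identically, and so at 0. *)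
Lemma closure_curve (S : Grass k d j -> Prop) (V : Grass k d j)
    (A : 'M[{poly k}]_(d, j.+1)) (Q : {poly k}) : Q != 0 ->
    (map_mx (horner_eval 0) A :=: grass_mx V)%MS ->
    (forall t, Q.[t] != 0 -> forall W : Grass k d j,
      (grass_mx W :=: map_mx (horner_eval t) A)%MS -> zariski_closure S W) ->
  zariski_closure S V.
Proof.
move=> Q0 A0 AS Z Zc SZ; case: (Zc) => P homP ZP; apply/ZP => F PF.
have [e Fe] := homP F PF.
pose Phi : {poly k} := mmap (@polyC k) (pl A) F.
have PhiE t : Phi.[t] = F.@[pl (map_mx (horner_eval t) A)].
  rewrite /Phi /mmap mevalE horner_sum; apply: eq_bigr => m _.
  rewrite hornerM hornerC; congr (_ * _); rewrite /mmap1 horner_prod.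
  apply: eq_bigr => i _; rewrite horner_exp; congr (_ ^+ _).
  rewrite -/(horner_eval t _) -det_map_mx; congr (\det _).
  by apply/matrixP => x y; rewrite !mxE.
have /row_freeP[Y AY] : row_free (map_mx (horner_eval 0) A).
  by rewrite /row_free A0 -/(row_free _) grass_mx_free.
(* [Y] is a right inverse at 0, so [D] is 1 there. Where [D] is nonzero the rows are independent and
   define a point of the Grassmannian. *)
pose D := \det (A *m map_mx polyC Y).
have DE t : D.[t] = \det (map_mx (horner_eval t) A *m Y).
  rewrite -/(horner_eval t _) -det_map_mx map_mxM; congr (\det (_ *m _)).
  by apply/matrixP => x y; rewrite !mxE /= /horner_eval hornerC.
have D0 : D != 0.
  apply: contraTneq (oner_neq0 k) => D0; rewrite -(det1 _ d) -AY -DE D0 horner0.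
  by rewrite eqxx.
have minors_grass (B : 'M[k]_(d, j.+1)) (W : Grass k d j) :
    (grass_mx W :=: B)%MS -> exists2 u, u != 0 & F.@[pl B] = u ^+ e * F.@[plucker W].
  move=> WB; have /submxP[U BU] : (B <= grass_mx W)%MS by rewrite WB.
  exists (\det U).
    rewrite -unitfE -[_ \in _]unitmxE -row_free_unit /row_free eqn_leq rank_leq_row /=.
    have := grass_mx_free W; rewrite /row_free WB BU => /eqP {1}<-; exact: mxrankM_maxl.
  rewrite -(meval_scale _ _ Fe) BU; apply: meval_eq => t; exact: maximal_minorsM.
have Phi0 : Phi = 0.
  have : Phi * (Q * D) = 0.
    apply: poly_eq0_everywhere => t; rewrite !hornerM.
    have [->|Qt] := eqVneq Q.[t] 0; first by rewrite mul0r mulr0.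
    have [->|Dt] := eqVneq D.[t] 0; first by rewrite !mulr0.
    suff -> : Phi.[t] = 0 by rewrite mul0r.
    have rA : \rank (map_mx (horner_eval t) A) = d.
      apply/eqP; rewrite eqn_leq rank_leq_row rank_ge_det.
      by exists 1%:M, Y; rewrite mul1mx -DE.
    have [W WA] := exists_grass rA.
    have [u u0 e1] := minors_grass _ _ WA.
    have /ZP/(_ F PF) := AS t Qt W WA Z Zc SZ.
    by rewrite PhiE e1 => ->; rewrite mulr0.
  by move/eqP; rewrite !mulf_eq0 (negPf Q0) (negPf D0) !orbF => /eqP.
have [u u0 e1] := minors_grass _ _ (eqmx_sym A0).
have := PhiE 0; rewrite Phi0 horner0 e1 => /esym/eqP.
by rewrite mulf_eq0 expf_eq0 (negPf u0) andbF => /eqP.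
Qed.

Lemma zariski_closure_trans (S S' : Grass k d j -> Prop) V :
  (forall W, S W -> zariski_closure S' W) -> zariski_closure S V -> zariski_closure S' V.
Proof. by move=> SS' SV Z Zc S'Z; apply: SV => // W /SS'; apply. Qed.

Lemma sub_zariski_closure (S : Grass k d j -> Prop) V : S V -> zariski_closure S V.
Proof. by move=> SV Z _; apply. Qed.

End Curve.

(** * Rank conditions are closed in the Plücker embedding *)

Lemma dhomog_det (R : comNzRingType) N p (A : 'M[{mpoly R[N]}]_p) :
  (forall x y, A x y \is 1.-homog) -> \det A \is p.-homog.
Proof.
move=> hA; apply: rpred_sum => s _.
have hprod (l : seq 'I_p) : \prod_(i <- l) A i (s i) \is (size l).-homog.
  elim: l => [|i l IHl]; first by rewrite big_nil dhomog1.
  by rewrite big_cons -[size _]/(1 + size l)%N dhomogM.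
have := hprod (enum 'I_p); rewrite size_enum_ord big_enum /= => hp.
by case: (odd_perm s); rewrite ?expr1 ?mulN1r ?expr0 ?mul1r ?rpredN.
Qed.

Section BlockDiag.
Variables (k : fieldType) (e J s : nat).

Definition block_diag (R : nzRingType) (B : 'M[R]_(e, J)) :
    'M[R]_(\sum_(a < s.+1) e, \sum_(a < s.+1) J) :=
  \mxblock_(a < s.+1, b < s.+1) (if a == b then B else 0).

Definition shift_row (R : nzRingType) p : 'M[R]_(p, \sum_(a < s.+1) J) :=
  \mxrow_(a < s.+1) shift_mx R a p J.

Lemma sub_block_diag (B : 'M[k]_(e, J)) (v : 'rV_(\sum_(a < s.+1) J)) :
  (v <= block_diag B)%MS <-> (forall b, submxrow v b <= B)%MS.
Proof.
have E (w : 'rV[k]_(\sum_(a < s.+1) e)) :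
    w *m block_diag B = \mxrow_b (submxrow w b *m B).
  rewrite -{1}[w]submxrowK mul_mxrow_mxblock; apply/eq_mxrowP => b.
  rewrite (bigD1 b) //= eqxx big1 ?addr0 // => a /negPf ->; exact: mulmx0.
split=> [/submxP[w ->] b|vB]; first by rewrite E mxrowK submxMl.
apply/submxP; exists (\mxrow_b (submxrow v b *m pinvmx B)).
rewrite E -[LHS]submxrowK; apply/eq_mxrowP => b.
by rewrite mxrowK mulmxKpV.
Qed.

Lemma sub_mxdiag (B : 'M[k]_J) (v : 'rV_(\sum_(a < s.+1) J)) :
  (v <= \mxdiag_(a < s.+1) B)%MS <-> (forall b, submxrow v b <= B)%MS.
Proof.
have E (w : 'rV[k]_(\sum_(a < s.+1) J)) :
    w *m \mxdiag_(a < s.+1) B = \mxrow_b (submxrow w b *m B).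
  by rewrite -{1}[w]submxrowK mul_mxrow_mxdiag.
split=> [/submxP[w ->] b|vB]; first by rewrite E mxrowK submxMl.
apply/submxP; exists (\mxrow_b (submxrow v b *m pinvmx B)).
rewrite E -[LHS]submxrowK; apply/eq_mxrowP => b.
by rewrite mxrowK mulmxKpV.
Qed.

Lemma rank_block_diag (B : 'M[k]_(e, J)) : \rank (block_diag B) = (s.+1 * \rank B)%N.
Proof.
have -> : \rank (block_diag B) = \rank (\mxdiag_(a < s.+1) <<B>>%MS).
  apply: eqmx_rank; apply/andP; split; apply/rV_subP => v.
    by move/sub_block_diag => vB; apply/sub_mxdiag => b; rewrite genmxE.
  by move/sub_mxdiag => vB; apply/sub_block_diag => b; rewrite -(genmxE B).
by rewrite rank_mxdiag sum_nat_const card_ord mxrank_gen.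
Qed.

(** A row lies in [down B p s] when its shifts lie in the row space of [block_diag B]. A lower bound
    on that kernel thus becomes an upper bound on the rank of a stacked matrix; the scalar [c]
    allows all entries to be made linear. *)
Lemma rank_down (B : 'M[k]_(e, J)) p c : c != 0 ->
  (\rank (col_mx (c *: shift_row k p) (block_diag B)) + \rank (down B p s)
     = p + s.+1 * \rank B)%N.
Proof.
move=> c0; pose f := \mxdiag_(a < s.+1) cokermx B.
have kf : (kermx f :=: block_diag B)%MS.
  apply/eqmxP/andP; split; apply/rV_subP => v.
    rewrite sub_kermx /f -{1}[v]submxrowK mul_mxrow_mxdiag => /eqP e0.
    apply/sub_block_diag => b; rewrite submxE.
    by rewrite -[_ *m _](mxrowK (fun b => submxrow v b *m cokermx B)) e0 submxrow0.
  move/sub_block_diag => vB; rewrite sub_kermx /f -{1}[v]submxrowK mul_mxrow_mxdiag.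
  apply/eqP; rewrite -[RHS]submxrowK; apply/eq_mxrowP => b; rewrite submxrow0.
  by apply/eqP; rewrite -submxE.
have e1 := mxrank_mul_ker (shift_row k p) f.
have e2 := mxrank_sum_cap (shift_row k p) (block_diag B).
have e3 : \rank (shift_row k p :&: kermx f)%MS = \rank (shift_row k p :&: block_diag B)%MS.
  by apply: eqmx_rank; rewrite !(cap_eqmx (eqmx_refl _) kf) submx_refl.
have e4 : \rank (col_mx (c *: shift_row k p) (block_diag B))
    = \rank (shift_row k p + block_diag B)%MS.
  by rewrite -addsmxE (adds_eqmx (eqmx_scale _ c0) (eqmx_refl _)).
have e5 : \rank (down B p s) = (p - \rank (shift_row k p *m f))%N.
  by rewrite mxrank_ker /shift_row /f mul_mxrow_mxdiag.
have le := rank_leq_row (shift_row k p *m f).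
rewrite e4 e5; rewrite rank_block_diag in e2; rewrite e3 in e1.
by move: e1 e2 le; do 5! move: (\rank _); lia.
Qed.

End BlockDiag.

Section Closed.
Variables (k : closedFieldType) (d j : nat).
Notation N := #|plucker_index d j|.
Notation Gr := (Grass k d j).

(** A repeated column makes the minor zero; otherwise sorting the columns turns it into a Pluecker
    coordinate up to sign. *)
Lemma minor_plucker (psi : 'I_d -> 'I_j.+1) : exists F : {mpoly k[N]},
  F \is 1.-homog /\ forall V : Gr,
    \det (\matrix_(x, y < d) grass_mx V x (psi y)) = F.@[plucker V].
Proof.
have [/injectiveP inj|/injectivePn[x [y xy e]]] := boolP (injectiveb psi); last first.
  exists 0; split=> [|V]; first exact: dhomog0.
  rewrite meval0 -det_tr; apply: (determinant_alternate xy) => z.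
  by rewrite !mxE e.
pose I : {set 'I_j.+1} := [set psi x | x : 'I_d].
have cI : #|I| = d by rewrite card_imset // card_ord.
have II : I \in plucker_index d j by rewrite inE cI.
pose t := enum_rank_in II I; have tI : enum_val t = I by rewrite enum_rankK_in.
have psiI x : psi x \in enum I by rewrite mem_enum imset_f.
have lt x : (index (psi x) (enum I) < d)%N by rewrite -[X in (_ < X)%N]cI cardE index_mem.
pose f x := Ordinal (lt x).
have f_inj : injective f.
  move=> x y /(congr1 val) /= e; apply: inj.
  by rewrite -(nth_index ord0 (psiI x)) e nth_index.
pose s := perm f_inj.
exists ((-1) ^+ s *: 'X_t); split=> [|V].
  apply: dhomogZ; apply/dhomogP => m; rewrite msuppX inE => /eqP ->; exact: mdeg1.
rewrite mevalZ mevalXU /plucker tI; set A := \matrix_(_, _) _; set B := \matrix_(_, _) _.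
have -> : A = col_perm s B.
  by apply/matrixP => x y; rewrite !mxE permE /= nth_index.
by rewrite col_permE det_mulmx det_perm odd_permV mulrC.
Qed.

End Closed.

Section Closed2.
Variables (k : closedFieldType) (d' j : nat).
Let d := d'.+1.
Notation N := #|plucker_index d j|.
Notation Gr := (Grass k d j).

(** With [d'] columns fixed by [phi] and one column [y] free, the minors form a vector of [V], by
    expansion along the free column. These vectors span: for columns where the basis is an
    invertible [C], they include up to sign the rows of [\adj C *m A]. *)
Lemma plucker_mx : exists e (B : 'M[{mpoly k[N]}]_(e, j.+1)),
  (forall x y, B x y \is 1.-homog) /\
  forall V : Gr, (map_mx (meval (plucker V)) B :=: grass_mx V)%MS.
Proof.
pose T := {ffun 'I_d' -> 'I_j.+1}.
pose psi (u : T * 'I_j.+1) (x : 'I_d) : 'I_j.+1 :=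
  if unlift ord0 x is Some y then u.1 y else u.2.
have [F FP] := fin_all_exists (fun u => @minor_plucker k d j (psi u)).
exists #|T|, (\matrix_(x < #|T|, y < j.+1) F (enum_val x, y)).
split=> [x y|V]; first by rewrite mxE; case: (FP (enum_val x, y)).
set A := grass_mx V; set B := map_mx _ _.
have BE (phi : T) y : B (enum_rank phi) y = \det (\matrix_(r, x < d) A r (psi (phi, y) x)).
  by rewrite mxE mxE enum_rankK; have [_ ->] := FP (phi, y).
pose cof (phi : T) : 'rV[k]_d :=
  \row_r cofactor (\matrix_(r, x < d) A r (psi (phi, ord0) x)) r ord0.
have rowB phi : row (enum_rank phi) B = cof phi *m A.
  apply/rowP => y; rewrite mxE BE (expand_det_col _ ord0) [RHS]mxE.
  apply: eq_bigr => r _; rewrite mulrC; congr (_ * _); last by rewrite mxE /psi unlift_none.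
  rewrite [RHS]mxE /cofactor; congr (_ * \det _); apply/matrixP => a b.
  by rewrite !mxE /psi !liftK.
apply/eqmxP/andP; split.
  by apply/row_subP => x; rewrite -(enum_valK x) rowB submxMl.
have fullA : row_full A^T by rewrite -col_leq_rank mxrank_tr row_leq_rank grass_mx_free.
pose f : 'I_d -> 'I_j.+1 := fullrankfun fullA.
pose C := colsub f A.
have uC : C \in unitmx.
  by rewrite -unitmx_tr; have := fullrowsub_unit fullA; rewrite /C trmx_mxsub.
pose phi (x : 'I_d) : T := [ffun y => f (lift x y)].
have adjC x : cof (phi x) = (-1) ^+ x *: row x (\adj C).
  apply/rowP => r; rewrite !mxE /cofactor mulrA.
  rewrite (exprD _ r x) mulrCA -expr2 sqrr_sign mulr1 addn0.
  congr (_ * \det _); apply/matrixP => a b; rewrite !mxE /psi liftK ffunE.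
  by [].
have AE : A = (\det C)^-1 *: (C *m (\adj C *m A)).
  rewrite mulmxA mul_mx_adj mul_scalar_mx scalerA mulVf ?scale1r //.
  by rewrite -unitfE -[_ \in _]unitmxE.
rewrite AE scalemx_sub // (submx_trans (submxMl _ _)) //.
apply/row_subP => x; rewrite row_mul.
have -> : row x (\adj C) = (-1) ^+ x *: cof (phi x).
  by rewrite adjC scalerA -expr2 sqrr_sign scale1r.
by rewrite -scalemxAl scalemx_sub // -rowB row_sub.
Qed.

Lemma rank_le_closed (I : Type) p q (B : I -> 'M[{mpoly k[N]}]_(p, q)) a :
  (forall i x y, B i x y \is 1.-homog) ->
  zariski_closed (fun V : Gr => forall i,
    (\rank (map_mx (meval (plucker V)) (B i)) <= a)%N).
Proof.
move=> hB.
exists (fun F => exists i (X : 'M[k]_(a.+1, p)) (Y : 'M[k]_(q, a.+1)),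
  F = \det (map_mx (@mpolyC N k) X *m B i *m map_mx (@mpolyC N k) Y)).
  move=> _ [i [X [Y ->]]]; exists a.+1; apply: dhomog_det => x y.
  rewrite mxE; apply: rpred_sum => z _; rewrite mxE mulrC mxE mul_mpolyC.
  apply: dhomogZ; apply: rpred_sum => t _; rewrite mxE mul_mpolyC; exact: dhomogZ.
have E V i X Y : (\det (map_mx (@mpolyC N k) X *m B i *m map_mx (@mpolyC N k) Y)).@[plucker V]
    = \det (X *m map_mx (meval (plucker V)) (B i) *m Y :> 'M_a.+1).
  rewrite -det_map_mx !map_mxM -!map_mx_comp; congr (\det (_ *m _ *m _));
  by apply/matrixP => x y; rewrite mxE /= mevalC.
move=> V; split=> [rV _ [i [X [Y ->]]] | FV i].
  apply/eqP; rewrite E; apply: contraTT (rV i) => D; rewrite -ltnNge rank_ge_det.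
  by exists X, Y.
rewrite leqNgt; apply/negP; rewrite rank_ge_det => -[X [Y]].
by rewrite -E FV ?eqxx //; exists i, X, Y.
Qed.

Lemma rank_up_closed L s a :
  zariski_closed (fun V : Gr => \rank (up (grass_mx V) L s) <= a)%N.
Proof.
have [e [B [hB BV]]] := plucker_mx.
have hup x y : up B L s x y \is 1.-homog.
  rewrite /up mxE mxE; apply: rpred_sum => z _; rewrite !mxE.
  by rewrite mulr_natr; apply: rpredMn.
have [P hP VP] := @rank_le_closed unit _ _ (fun=> up B L s) a (fun=> hup).
exists P => // V; rewrite -VP.
have -> : map_mx (meval (plucker V)) (up B L s) = up (map_mx (meval (plucker V)) B) L s.
  apply/matrixP => x y; rewrite !mxE rmorph_sum; apply: eq_bigr => z _.
  by rewrite !mxE rmorphM rmorph_nat.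
by rewrite (eqmx_up _ _ (BV V)); split=> [?|/(_ tt)].
Qed.

Lemma rank_down_closed p s b : (b <= p)%N ->
  zariski_closed (fun V : Gr => b <= \rank (down (grass_mx V) p s))%N.
Proof.
move=> bp; have [e [B [hB BV]]] := plucker_mx.
pose M t := col_mx ('X_t *: shift_row j.+1 s {mpoly k[N]} p) (block_diag s B).
have hM t x y : M t x y \is 1.-homog.
  rewrite mxE; case: splitP => u _; rewrite !mxE.
    rewrite mulr_natr; apply: rpredMn; apply/dhomogP => m.
    by rewrite msuppX inE => /eqP ->; exact: mdeg1.
  by case: ifP => _; rewrite ?mxE; [exact: hB | exact: dhomog0].
have [P hP VP] := @rank_le_closed _ _ _ M (p + s.+1 * d - b)%N hM.
exists P => // V; rewrite -VP.
have ME t : map_mx (meval (plucker V)) (M t) =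
    col_mx (plucker V t *: shift_row j.+1 s k p) (block_diag s (map_mx (meval (plucker V)) B)).
  rewrite map_col_mx; congr col_mx; apply/matrixP => x y; rewrite !mxE.
    by rewrite mevalM mevalXU rmorph_nat.
  by case: ifP => _; rewrite !mxE ?meval0.
have rB : \rank (map_mx (meval (plucker V)) B) = d.
  by rewrite BV; apply/eqP; apply: grass_mx_free.
have [t pt] : exists t, plucker V t != 0.
  apply/existsP; apply: contraT; rewrite negb_exists => /forallP p0.
  suff : \rank (map_mx (meval (plucker V)) B) = 0%N by rewrite rB.
  apply/eqP; rewrite mxrank_eq0; apply/eqP/matrixP => x y; rewrite mxE [RHS]mxE.
  rewrite (meval_eq _ (v2 := fun t => 0 * plucker V t)).
    by rewrite (meval_scale _ _ (hB x y)) expr1 mul0r.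
  by move=> t; rewrite mul0r; apply/eqP; have := p0 t; rewrite negbK.
have dp : (\rank (down (grass_mx V) p s) <= p)%N by apply: rank_leq_row.
rewrite -(eqmx_down p s (BV V)) in dp *; split=> [bd t'|/(_ t)]; rewrite ME.
  (* If this coordinate vanishes at [V], the shifts disappear and the bound holds by [b <= p]. The
     information comes from a nonzero coordinate, which exists. *)
  have [-> |pt'] := eqVneq (plucker V t') 0.
    rewrite scale0r rank_col_0mx rank_block_diag rB; lia.
  have := rank_down s (map_mx (meval (plucker V)) B) p pt'.
  by rewrite rB; move: bd; do 2! move: (\rank _); lia.
have := rank_down s (map_mx (meval (plucker V)) B) p pt.
by rewrite rB; move: dp; do 2! move: (\rank _); lia.
Qed.

End Closed2.

(** * Acceptable sequences and pairs of partitions *)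

Section Partitions.
Import Order.TTheory Num.Theory.

(** These are the partial sums of the partition dual to [u]. For equal totals, comparing them for
    all [s] is the reverse of the dominance order. *)
Definition min_sum p (u : 'I_p -> nat) (s : nat) : nat := (\sum_i minn (u i) s)%N.

(* [n] is the partition of [d] dual to the differences of [H] up to degree
   [j], and [m] the partition of [j + 1 - d - c_H] dual to those above [j]. *)
Definition has_type r (n : 'I_r.+1 -> nat) (m : 'I_r -> nat) (d j : nat)
    (H : nat -> nat) : Prop :=
  [/\ (forall i, 0 < n i)%N /\ (forall l, 0 < m l)%N,
      (\sum_i n i = d)%N /\ (d + \sum_l m l <= j.+1)%N,
      forall s, (s <= j)%N -> (H (j - s) + d = (j - s).+1 + min_sum n s)%N
    & forall s, (H (j + s) + d + min_sum m s = j.+1)%N].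

Section MinSum.
Variables (p : nat) (u : 'I_p -> nat).

Lemma min_sum0 : min_sum u 0 = 0%N.
Proof. by rewrite /min_sum big1 // => i _; rewrite minn0. Qed.

Lemma min_sum_le s t : (s <= t)%N -> (min_sum u s <= min_sum u t)%N.
Proof. by move=> st; apply: leq_sum => i _; lia. Qed.

Lemma min_sum_large s : (forall i, u i <= s)%N -> min_sum u s = (\sum_i u i)%N.
Proof. by move=> us; apply: eq_bigr => i _; apply/minn_idPl. Qed.

Lemma min_sum_leq s : (min_sum u s <= \sum_i u i)%N.
Proof. by apply: leq_sum => i _; lia. Qed.

Lemma min_sum_concave s : (min_sum u s.+2 + min_sum u s <= 2 * min_sum u s.+1)%N.
Proof. by rewrite /min_sum big_distrr -big_split /=; apply: leq_sum => i _; lia. Qed.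

Lemma min_sum1 : (forall i, 0 < u i)%N -> min_sum u 1 = p.
Proof.
move=> u0; rewrite /min_sum (eq_bigr (fun=> 1%N)); first by rewrite sum1_card card_ord.
by move=> i _; have := u0 i; lia.
Qed.

Lemma sum_sub_min s : (\sum_i (u i - s) + min_sum u s = \sum_i u i)%N.
Proof. by rewrite -big_split /=; apply: eq_bigr => i _; lia. Qed.

Lemma sum_subr_min s : (\sum_i (s - u i) + min_sum u s = p * s)%N.
Proof.
rewrite -big_split /= (eq_bigr (fun=> s)); last by move=> i _; lia.
by rewrite sum_nat_const card_ord.
Qed.

Lemma leq_sum_ord i : (u i <= \sum_x u x)%N.
Proof. by rewrite (bigD1 i) //= leq_addr. Qed.

End MinSum.

(** Differences of [min_sum] count the parts exceeding [s], so they decrease; this gives both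
    monotonicity conditions. At [j] and [j.+1] they count the generators minus one and the
    relations, both equal to [r]. *)
Lemma type_acceptable r (n : 'I_r.+1 -> nat) (m : 'I_r -> nat) d j H :
  (0 < d <= j)%N -> has_type n m d j H -> acceptable d j H.
Proof.
move=> /andP[d0 dj] [[n0 m0] [sn sm] HD HU].
have nj i : (n i <= j)%N by apply: leq_trans dj; rewrite -sn leq_sum_ord.
have nuj s : (j <= s)%N -> min_sum n s = d.
  by move=> js; rewrite -sn; apply: min_sum_large => i; apply: leq_trans js.
have H0 : H 0%N = 1%N by have := HD j (leqnn j); rewrite subnn nuj //; lia.
have Hj : (H j + d = j.+1)%N by have := HU 0%N; rewrite addn0 min_sum0; lia.
have eD s : (s <= j)%N -> ediff H (j - s) = (min_sum n s.+1)%:Z - (min_sum n s)%:Z - 1.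
  rewrite leq_eqVlt => /predU1P[->|sj].
    by rewrite subnn /= !nuj //; lia.
  have -> : (j - s = (j - s.+1).+1)%N by lia.
  rewrite /=; have := HD s (ltnW sj); have := HD s.+1 sj.
  rewrite (_ : j - s = (j - s.+1).+1)%N; last by lia.
  by lia.
have eU s : ediff H (j + s).+1 = (min_sum m s.+1)%:Z - (min_sum m s)%:Z.
  by rewrite /=; have := HU s; have := HU s.+1; rewrite addnS; lia.
have ej : ediff H j = r%:Z.
  by have := eD 0%N isT; rewrite subn0 min_sum0 min_sum1 // => ->; lia.
have ej1 : ediff H j.+1 = r%:Z.
  by have := eU 0%N; rewrite addn0 min_sum0 min_sum1 // => ->; lia.
pose K := (\max_i n i)%N.
have Kn i : (n i <= K)%N by apply: leq_bigmax.
have c0 : (0 < #|'I_r.+1|)%N by rewrite card_ord.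
have [i0 Ki0] := bigop.eq_bigmax n c0; rewrite -/K in Ki0; move: K Kn Ki0 => K Kn Ki0.
have K0 : (0 < K)%N by rewrite Ki0.
have Kj : (K <= j)%N by rewrite Ki0.
have incr s : (s < K)%N -> (min_sum n s < min_sum n s.+1)%N.
  move=> sK; rewrite /min_sum (bigD1 i0) //= [X in (_ < X)%N](bigD1 i0) //=.
  rewrite -addSn; apply: leq_add; first by rewrite -Ki0; lia.
  by apply: leq_sum => i _; lia.
have HK s : (s < j)%N -> (H (j - s.+1) + 1 = H (j - s) + (min_sum n s.+1 - min_sum n s))%N.
  move=> sj; have := HD s (ltnW sj); have := HD s.+1 sj.
  by have := min_sum_le n (leqnSn s); lia.
split.
  (* With [K] the largest part, this is the least degree of a generator. *)
  exists (j.+1 - K)%N; first by lia.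
  split=> [i iK||i].
  - have := HD (j - i)%N (leq_subr _ _).
    have -> : min_sum n (j - i) = d.
      by rewrite -sn; apply: min_sum_large => x; apply: leq_trans (Kn x) _; lia.
    by rewrite subKn; lia.
  - have := HD K.-1; rewrite (_ : j - K.-1 = j.+1 - K)%N; last by lia.
    have := incr K.-1; rewrite prednK // leqnn => /(_ isT).
    by have := min_sum_leq n K; rewrite sn; lia.
  move=> Ki; have [ji|ij] := leqP j i.
    have := HU (i - j)%N; have := HU (i - j).+1; rewrite addnS subnKC //.
    by have := min_sum_le m (leqnSn (i - j)); lia.
  have [t it] : exists t, (j = i.+1 + t)%N by exists (j - i.+1)%N; lia.
  have tj : (t < j)%N by lia.
  have tK : (t < K)%N by lia.
  have := HK t tj; have := incr t tK.
  by rewrite (_ : j - t.+1 = i)%N 1?(_ : j - t = i.+1)%N; lia.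
split.
- move=> i ij; have [->|ne] := eqVneq i j; first by rewrite ej ej1.
  have -> : (i.+1 = j - (j - i).-1)%N by lia.
  have {1}-> : (i = j - (j - i).-1.+1)%N by lia.
  by rewrite !eD; [have := min_sum_concave n (j - i).-1 | |]; lia.
- move=> i ji; have [->|ne] := eqVneq i j; first by rewrite ej ej1.
  have [t ->] : exists t, i = (j + t).+1 by exists (i - j.+1)%N; lia.
  by have := eU t.+1; rewrite addnS eU => ->; have := min_sum_concave m t; lia.
- have sumE N : \sum_(0 <= i < N.+1) (ediff H i + 1) = N%:Z + 1 - (H N)%:Z.
    elim: N => [|N IHN]; first by rewrite big_nat1 /= H0.
    by rewrite big_nat_recr //= IHN; lia.
  by rewrite sumE; lia.
- have lim N : (j + \sum_l m l <= N)%N -> (H N + d + \sum_l m l = j.+1)%N.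
    move=> jN; have := HU (N - j)%N; rewrite subnKC; last by lia.
    by rewrite min_sum_large // => l; apply: leq_trans (leq_sum_ord m l) _; lia.
  exists (j.+1 - d - \sum_l m l)%N%:Z.
    by exists (j + \sum_l m l)%N => N /lim; lia.
  exists (j + \sum_l m l).+1 => -[//|N] jN.
  have sumE s : \sum_(j.+1 <= i < (j + s).+1) ediff H i = (H j)%:Z - (H (j + s)%N)%:Z.
    elim: s => [|s IHs]; first by rewrite addn0 big_geq // subrr.
    by rewrite addnS big_nat_recr /= ?IHs; lia.
  have := sumE (N - j)%N; rewrite subnKC; last by lia.
  by move=> ->; have := lim N jN; lia.
split; rewrite ?ej ?ej1 //.
have rm : (r <= \sum_l m l)%N.
  by rewrite -[X in (X <= _)%N](min_sum1 m0); apply: min_sum_leq.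
have rn : (r.+1 <= d)%N by rewrite -sn -[X in (X <= _)%N](min_sum1 n0); apply: min_sum_leq.
by rewrite le_min; lia.
Qed.

(** The true values of [P] form an initial segment, so cutting its length at [s] counts its members
    below [s]. This exchanges sums over a partition with sums over its dual. *)
Lemma count_initial (P : nat -> bool) B s : (forall x, P x.+1 -> P x) ->
  (forall x, (B <= x)%N -> P x = false) ->
  minn (\sum_(x < B) P x) s = (\sum_(x < s) P x)%N.
Proof.
move=> Pd PB.
have Ple x y : (x <= y)%N -> P y -> P x.
  elim: y => [|y IH]; first by rewrite leqn0 => /eqP ->.
  by rewrite leq_eqVlt => /predU1P[->//|xy /Pd]; apply: IH.
have sumP N : (\sum_(x < N) P x <= N)%N /\ (P N -> \sum_(x < N) P x = N)%N.
  elim: N => [|N [IH1 IH2]]; first by rewrite big_ord0.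
  rewrite big_ord_recr /=; split; first by rewrite -addn1 leq_add ?leq_b1.
  by move=> /Pd PN; rewrite IH2 // PN addn1.
have E N t : (\sum_(x < N) P x <= \sum_(x < N + t) P x)%N /\
    (P N = false -> \sum_(x < N + t) P x = \sum_(x < N) P x)%N.
  elim: t => [|t [IH1 IH2]]; first by rewrite addn0.
  rewrite addnS big_ord_recr /=; split; first exact: leq_trans IH1 (leq_addr _ _).
  move=> PN; rewrite IH2 //; case Pt: (P (N + t)%N); last by rewrite addn0.
  by rewrite (Ple N (N + t)%N) ?leq_addr in PN.
have [le|gt] := leqP s B.
  have [e1 e2] := E s (B - s)%N; rewrite subnKC // in e1 e2.
  have [f1 f2] := sumP s.
  case Ps: (P s); first by rewrite f2 // in e1 *; apply/minn_idPr.
  by rewrite e2 //; apply/minn_idPl.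
have [e1 e2] := E B (s - B)%N; rewrite subnKC in e1 e2; last by lia.
rewrite e2 ?PB //; apply/minn_idPl; have [f1 _] := sumP B; lia.
Qed.

Lemma count_le_int (z : int) N : -1 <= z -> z < N%:Z ->
  (\sum_(i < N) (i%:Z <= z)%R)%:Z = z + 1.
Proof.
elim: N => [|N IHN] z1 zN; first by rewrite big_ord0; lia.
rewrite big_ord_recr /=; have [Nz|zN'] := lerP N%:Z z; last by rewrite addn0 IHN.
have -> : z = N%:Z by lia.
rewrite (eq_bigr (fun=> 1%N)) => [|i _]; last by have := ltn_ord i; lia.
by rewrite sum1_card card_ord; lia.
Qed.

(** Both partitions are duals of difference sequences: [n i] counts the [x] with [i <= e_{j-x}] and
    [m i] those with [i < e_{j+1+x}]. As [e_j = e_{j+1} = r], this gives [r.+1] and [r] positive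
    parts. *)
Lemma acceptable_type d j H : (0 < d <= j)%N -> acceptable d j H ->
  exists r (n : 'I_r.+1 -> nat) (m : 'I_r -> nat),
  [/\ has_type n m d j H, forall i i' : 'I_r.+1, (i <= i')%N -> (n i' <= n i)%N
    & forall l l' : 'I_r, (l <= l')%N -> (m l' <= m l)%N].
Proof.
move=> /andP[d0 dj] [[mu mu0 [H1 H2 H3]] [eD eU sd [c Hc _] [ej0 ejj _]]].
have H0 : H 0%N = 1%N by apply: H1.
have sumE N : \sum_(0 <= i < N.+1) (ediff H i + 1) = N%:Z + 1 - (H N)%:Z.
  elim: N => [|N IHN]; first by rewrite big_nat1 /= H0.
  by rewrite big_nat_recr //= IHN; lia.
have Hj : (H j + d = j.+1)%N by have := sumE j; rewrite sd; lia.
case: Hc => B0 HB.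
pose B := (B0 + j).+1.
have eB l : (B <= l)%N -> ediff H l = 0.
  by case: l => [|l] Bl; rewrite /B in Bl; [lia|rewrite /= !HB ?subrr; lia].
have eUle l l' : (j <= l)%N -> (l <= l')%N -> ediff H l' <= ediff H l.
  move=> jl; elim: l' => [|l' IH]; first by rewrite leqn0 => /eqP ->.
  rewrite leq_eqVlt => /predU1P[->//|ll']; apply: le_trans (IH ll').
  by apply: eU; lia.
have eDle l l' : (l <= l')%N -> (l' <= j)%N -> ediff H l <= ediff H l'.
  elim: l' => [|l' IH]; first by rewrite leqn0 => /eqP ->.
  rewrite leq_eqVlt => /predU1P[->//|ll'] l'j; apply: le_trans (IH _ _) (eD _ _) => //; lia.
have eU0 l : (j <= l)%N -> 0 <= ediff H l.
  move=> jl; have [Bl|lB] := leqP B l; first by rewrite eB.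
  by rewrite -(eB B (leqnn B)); apply: eUle => //; apply: ltnW.
have eD1 l : (l <= j)%N -> -1 <= ediff H l.
  by move=> lj; have := eDle 0%N l isT lj.
have [r er] : exists r : nat, ediff H j = r%:Z.
  by exists `|ediff H j|%N; lia.
have eDr l : (l <= j)%N -> ediff H l < r.+1%:Z.
  by move=> lj; have := eDle l j lj (leqnn j); rewrite er; lia.
have eUr l : (j <= l)%N -> ediff H l - 1 < r%:Z.
  by move=> lj; have := eUle j l (leqnn j) lj; rewrite er; lia.
pose P (i x : nat) := (x <= j)%N && (i%:Z <= ediff H (j - x)).
pose P' (i x : nat) := i%:Z <= ediff H (j.+1 + x)%N - 1.
have Pd i x : P i x.+1 -> P i x.
  move=> /andP[xj ix]; rewrite /P ltnW //=; apply: le_trans ix _.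
  by apply: eDle; lia.
have Pj i x : (j.+1 <= x)%N -> P i x = false by move=> jx; rewrite /P leqNgt jx.
have P'd i x : P' i x.+1 -> P' i x.
  by rewrite /P' addnS => ix; have := eUle (j.+1 + x)%N (j.+1 + x).+1; lia.
have P'B i x : (B <= x)%N -> P' i x = false.
  by move=> Bx; rewrite /P' eB; lia.
pose n (i : 'I_r.+1) := (\sum_(x < j.+1) P i x)%N.
pose m (i : 'I_r) := (\sum_(x < B) P' i x)%N.
have nuE s : (s <= j.+1)%N -> (min_sum n s)%:Z = \sum_(x < s) (ediff H (j - x)%N + 1).
  move=> sj; rewrite /min_sum (eq_bigr (fun i : 'I_r.+1 => \sum_(x < s) P i x)%N); last first.
    by move=> i _; apply: count_initial; [apply: Pd|apply: Pj].
  rewrite exchange_big /= (big_morph Posz PoszD (erefl _)) /=.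
  apply: eq_bigr => x _; have xj : (x <= j)%N by have := ltn_ord x; lia.
  rewrite -(@count_le_int _ r.+1) ?eD1 ?eDr ?leq_subr //.
  by congr Posz; apply: eq_bigr => i _; rewrite /P xj.
have muE s : (min_sum m s)%:Z = \sum_(x < s) ediff H (j.+1 + x)%N.
  rewrite /min_sum (eq_bigr (fun i : 'I_r => \sum_(x < s) P' i x)%N); last first.
    by move=> i _; apply: count_initial; [apply: P'd|apply: P'B].
  rewrite exchange_big /= (big_morph Posz PoszD (erefl _)) /=.
  apply: eq_bigr => x _; have jx : (j <= j.+1 + x)%N by lia.
  have a1 : -1 <= ediff H (j.+1 + x)%N - 1 by have := eU0 _ jx; lia.
  by rewrite (count_le_int a1 (eUr _ jx)) subrK.
have nuH s : (s <= j)%N -> (min_sum n s)%:Z = (H (j - s)%N)%:Z - (H j)%:Z + s%:Z.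
  move=> sj; rewrite nuE; last by lia.
  elim: s sj => [|s IHs] sj; first by rewrite big_ord0 subn0; lia.
  rewrite big_ord_recr /= IHs; last by lia.
  by rewrite (_ : j - s = (j - s.+1).+1)%N /=; lia.
have muH s : (min_sum m s)%:Z = (H j)%:Z - (H (j + s)%N)%:Z.
  rewrite muE; elim: s => [|s IHs]; first by rewrite big_ord0 addn0; lia.
  by rewrite big_ord_recr /= IHs addSn /= addnS; lia.
have n_le i : (n i <= j.+1)%N.
  rewrite /n -[X in (_ <= X)%N]card_ord -sum1_card; apply: leq_sum => x _.
  by case: (P _ _).
have sn : (\sum_i n i)%N = d.
  have e1 := nuE j.+1 (leqnn _); rewrite (min_sum_large n_le) in e1.
  have : (\sum_i n i)%N%:Z = d%:Z.
    rewrite e1 -sd big_mkord (reindex_inj rev_ord_inj) /=.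
    by apply: eq_bigr => x _; congr (ediff H _ + 1); have := ltn_ord x; lia.
  by lia.
have m_le l : (m l <= B)%N.
  rewrite /m -[X in (_ <= X)%N]card_ord -sum1_card; apply: leq_sum => x _.
  by case: (P' _ _).
exists r, n, m; split.
- split.
  + split=> i.
      rewrite /n big_ord_recl /P subn0 /= er.
      by rewrite (_ : _ <= _ = true) //; have := ltn_ord i; lia.
    rewrite /m big_ord_recl /P' addn0 -ejj er.
    by rewrite (_ : _ <= _ = true) //; have := ltn_ord i; lia.
  + by split=> //; have := muH B; rewrite (min_sum_large m_le); lia.
  + by move=> s sj; have := nuH s sj; lia.
  + by move=> s; have := muH s; lia.
- move=> i i' ii; apply: leq_sum => x _; rewrite /P.
  by case: (x <= j)%N => //=; lia.
- move=> i i' ii; apply: leq_sum => x _; rewrite /P'; lia.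
Qed.

End Partitions.

(** * Dominance order *)

Section DominanceOrder.
Local Open Scope nat_scope.

Definition transfer p (u : 'I_p -> nat) a b (x : 'I_p) : nat :=
  if x == b then (u b).+1 else if x == a then (u a).-1 else u x.

Definition bump_at p (u : 'I_p -> nat) b (x : 'I_p) : nat :=
  if x == b then (u b).+1 else u x.

Section Dominance.
Variables (p : nat) (u : 'I_p -> nat).
Hypothesis u_sorted : forall x y : 'I_p, x <= y -> u y <= u x.

Let tail (v : 'I_p -> nat) (t : nat) : nat := \sum_(x < p | t <= x) v x.

Let tail_lt v (l : 'I_p) t : t <= l -> v l < u l ->
  (forall x : 'I_p, t <= x -> x < l -> v x <= u x) -> tail v l.+1 <= tail u l.+1 ->
  tail v t < tail u t.
Proof.
move=> tl vl vu; rewrite /tail => le.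
have E f : \sum_(x < p | t <= x) f x =
    f l + \sum_(x : 'I_p | (t <= x) && (x < l)) f x + \sum_(x < p | l.+1 <= x) f x.
  rewrite (bigD1 l) //= -addnA; congr addn; rewrite (bigID (fun x : 'I_p => x < l)) /=.
  congr addn; apply: eq_bigl => x; rewrite -val_eqE /=; lia.
rewrite !E -addSn; apply: leq_add => //; rewrite -addSn; apply: leq_add => //.
by apply: leq_sum => x /andP[tx xl]; apply: vu.
Qed.

(** Take [min_sum] at the height of the last part of [v] before the tail: for [v] it is the tail
    plus a full rectangle, for [u] at most its tail plus the same rectangle. Tails are compared
    because the totals may differ. *)
Let tail_min v : (forall x y : 'I_p, x <= y -> v y <= v x) ->
  (forall s, min_sum v s <= min_sum u s) -> forall t, tail v t <= tail u t.
Proof.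
move=> vs le t; case: (ltnP t p) => tp; last first.
  by rewrite /tail big_pred0 // => x; have := ltn_ord x; lia.
case: t tp => [|t] tp.
  pose s := (\sum_x v x + \sum_x u x)%N.
  have e w : (forall i, w i <= s) -> tail w 0 = min_sum w s.
    by move=> ws; rewrite min_sum_large.
  rewrite !e ?le // => i; have := leq_sum_ord u i; have := leq_sum_ord v i; rewrite /s; lia.
pose a : 'I_p := Ordinal (ltnW tp).
have := le (v a); rewrite /min_sum.
rewrite (bigID (fun x : 'I_p => t < x)) /= [X in _ <= X](bigID (fun x : 'I_p => t < x)) /=.
rewrite (eq_bigr v) => [|x tx]; last by apply/minn_idPl; apply: vs => /=; lia.
rewrite [X in _ + X](eq_bigr (fun=> v a)) => [|x tx]; last first.
  by apply/minn_idPr; apply: vs => /=; lia.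
have : \sum_(x < p | t < x) minn (u x) (v a) <= tail u t.+1.
  by apply: leq_sum => x _; lia.
have : \sum_(i < p | ~~ (t < i)) minn (u i) (v a) <= \sum_(i < p | ~~ (t < i)) v a.
  by apply: leq_sum => x _; lia.
rewrite /tail => le1 le2 le3; rewrite -(leq_add2r (\sum_(i < p | ~~ (t < i)) v a)).
by apply: leq_trans le3 _; apply: leq_add.
Qed.

Variable Q : ('I_p -> nat) -> Prop.
Hypothesis Q_ext : forall v w, v =1 w -> Q v -> Q w.
Hypothesis Q_transfer : forall v a b, v b < v a -> Q v -> Q (transfer v a b).
Hypothesis Q_bump : forall v b, \sum_x v x < \sum_x u x -> Q v -> Q (bump_at v b).

Let sum_delta (i : 'I_p) t : \sum_(x : 'I_p | t <= x) (x == i) = (t <= i).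
Proof.
case: (leqP t i) => ti.
  by rewrite (bigD1 i) //= eqxx big1 ?addn0 // => x /andP[_ /negPf ->].
by rewrite big1 // => x tx; case: eqP => // xi; move: ti; rewrite -xi; lia.
Qed.

(** Induction on the total deficit of [v]. At the first index where [v] is too small a unit is
    added, taken from the last earlier index where [v] is too large, or from outside if there is
    none. These extremal choices keep [v] decreasing and its tails below those of [u]. *)
Lemma dominance_ind v : (forall x y : 'I_p, x <= y -> v y <= v x) ->
  (forall s, min_sum v s <= min_sum u s) -> Q v -> Q u.
Proof.
move=> vs /(tail_min vs){}.
have [N] := ubnP (\sum_x (u x - v x)); elim: N => // N IHN in v vs *.
move=> vN tl Qv.
have step w (l : 'I_p) : v l < u l -> w l = (v l).+1 ->
    (forall x, x != l -> u x - w x <= u x - v x) ->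
    (forall x y : 'I_p, x <= y -> w y <= w x) ->
    (forall t, tail w t <= tail u t) -> Q w -> Q u.
  move=> vl wl wle ws wt Qw; apply: (IHN w) => //.
  rewrite -ltnS; apply: leq_trans vN; rewrite ltnS.
  rewrite (bigD1 l) //= [X in _ < X](bigD1 l) //= wl -addSn.
  by apply: leq_add; [lia | apply: leq_sum => x /wle].
have [l0 vl0|vu] := pickP (fun l => v l < u l); last first.
  apply: Q_ext Qv => x; apply/eqP; rewrite eqn_leq [X in _ && X]leqNgt vu andbC /=.
  have := tl 0; rewrite /tail (bigD1 x) //= [X in _ <= X](bigD1 x) //=.
  have : \sum_(i < p | i != x) u i <= \sum_(i < p | i != x) v i.
    by apply: leq_sum => i _; rewrite leqNgt vu.
  by move: (\sum_(i < p | i != x) u i) (\sum_(i < p | i != x) v i) => A B; lia.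
case: (arg_minnP (P := fun l => v l < u l) (fun l : 'I_p => l : nat) vl0) => l vl lmin {l0 vl0}.
have lmin' (x : 'I_p) : x < l -> u x <= v x.
  by move=> xl; rewrite leqNgt; apply/negP => /lmin; lia.
have mid t : t <= l -> (forall x : 'I_p, t <= x -> x < l -> v x <= u x) -> tail v t < tail u t.
  by move=> tl' vu; apply: tail_lt tl' vl vu (tl _).
have [i0 vi0|vu] := pickP (fun i : 'I_p => (i < l) && (u i < v i)); last first.
  have vu' (x : 'I_p) : x < l -> v x = u x.
    by move=> xl; have := lmin' x xl; have := vu x; rewrite xl /=; lia.
  have tw t : tail (bump_at v l) t = tail v t + (t <= l).
    rewrite -(sum_delta l t) /tail -big_split /=; apply: eq_bigr => x _.
    by rewrite /bump_at; case: eqP => [->|_]; lia.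
  apply: (step (bump_at v l) l vl).
  - by rewrite /bump_at eqxx.
  - by move=> x /negPf xl; rewrite /bump_at xl.
  - move=> x y xy; rewrite /bump_at; case: eqP => [yl|_]; case: eqP => [xl|xl] //.
    + have xl' : x < l by have : (x : nat) <> l by [move=> e; apply: xl; apply: val_inj]; rewrite -yl in xl *; lia.
      by rewrite (vu' x xl'); have := u_sorted (ltnW xl'); lia.
    + by rewrite xl in xy; apply: leq_trans (vs _ _ xy) _.
    + exact: vs.
  - move=> t; rewrite tw; case: (leqP t l) => tl'; last by rewrite addn0.
    by rewrite addn1; apply: mid => // x _ xl; rewrite vu'.
  - apply: Q_bump => //; have := mid 0 isT; apply; move=> x _ xl; by rewrite vu'.
case: (arg_maxnP (P := fun i : 'I_p => (i < l) && (u i < v i)) (fun l : 'I_p => l : nat) vi0) => i /andP[il vi] imax {i0 vi0}.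
have vu' (x : 'I_p) : i < x -> x < l -> v x = u x.
  move=> ix xl; have := lmin' x xl; case: (ltnP (u x) (v x)) => h; last by lia.
  by have := imax x; rewrite xl h /= => /(_ isT); lia.
have li : (l == i) = false by apply/negP => /eqP e; move: il; rewrite e ltnn.
have uil := u_sorted (ltnW il).
have tw t : tail (transfer v i l) t + (t <= i) = tail v t + (t <= l).
  rewrite -(sum_delta l t) -(sum_delta i t) /tail -!big_split /=; apply: eq_bigr => x _.
  rewrite /transfer; have [->|xl] := eqVneq x l; first by rewrite li; lia.
  by have [->|xi] := eqVneq x i; lia.
apply: (step (transfer v i l) l vl).
- by rewrite /transfer eqxx.
- move=> x /negPf xl; rewrite /transfer xl; case: eqP => [->|_] //; lia.
- move=> x y xy; have vxy := vs _ _ xy.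
  have ne (a b : 'I_p) : a <> b -> (a : nat) <> b by move=> ab /val_inj.
  rewrite /transfer; case: (eqVneq y l) => [yl|/eqP/ne yl]; case: (eqVneq x l) => [xl|/eqP/ne xl] //.
  + have xl' : x < l by rewrite yl in xy; lia.
    have := lmin' x xl'; have := u_sorted (ltnW xl').
    by case: eqP => [->|_]; lia.
  + case: eqP => [yi|_]; first by move: xy il; rewrite yi xl; lia.
    by rewrite xl in vxy; lia.
  + case: (eqVneq y i) => [yi|/eqP/ne yi]; case: (eqVneq x i) => [xi|/eqP/ne xi].
    * by [].
    * by rewrite yi in vxy; lia.
    * have iy : i < y by rewrite xi in xy; lia.
      case: (ltnP y l) => yl'.
        by rewrite (vu' y iy yl'); have := u_sorted (ltnW iy); lia.
      by have := vs _ _ yl'; lia.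
    * exact: vxy.
- move=> t; have := tw t; case: (leqP t i) => ti.
    by rewrite (leq_trans ti (ltnW il)) => /addIn ->.
  rewrite addn0 => ->; case: (leqP t l) => tl'; last by rewrite addn0.
  by rewrite addn1; apply: mid => // x tx xl; rewrite vu' //; lia.
- by apply: Q_transfer => //; lia.
Qed.

End Dominance.

End DominanceOrder.

(** * Presentations of a point of the Grassmannian *)

Section Presentations.
Variables (k : closedFieldType) (d j : nat).
Implicit Type V : Grass k d j.

(* [g] generates the ancestor ideal of [V], with [g_i] of degree
   [j + 1 - n_i]. *)
Definition generates r (n : 'I_r.+1 -> nat) (g : 'rV[{poly k}]_r.+1) V : Prop :=
  [/\ forall i, (0 < n i)%N \/ g 0 i = 0,
      forall i, (size (g 0%R i) + n i <= j.+2)%N,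
      (grass_mx V :=: gens_mx n j.+1 (g 0))%MS,
      (\sum_i n i = d)%N
    & forall s, (s <= j)%N -> (ancestor_hilbert V (j - s) + d = (j - s).+1 + min_sum n s)%N].

Lemma generates_indep r (n : 'I_r.+1 -> nat) g V : generates n g V ->
  forall h : 'cV[{poly k}]_r.+1, (forall i, size (h i 0%R) <= n i)%N -> g *m h = 0 -> h = 0.
Proof.
case=> _ _ Vg sn _ h sh gh.
have free : row_free (gens_mx n j.+1 (g 0)).
  rewrite /row_free -Vg sn; exact: grass_mx_free.
have /gens_mx_free inj := free.
apply/colP => i; rewrite [RHS]mxE; apply: (inj (fun x => h x 0)) => //.
rewrite (_ : \sum_i _ = (g *m h) 0 0); first by rewrite gh mxE poly_rV0.
by rewrite mxE; apply: eq_bigr => x _; rewrite mulrC.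
Qed.

Lemma grass_generators V : (0 < d)%N ->
  exists r (n : 'I_r.+1 -> nat) (g : 'rV[{poly k}]_r.+1),
  [/\ generates n g V, forall i, (0 < n i)%N,
      forall i i' : 'I_r.+1, (i <= i')%N -> (n i' <= n i)%N
    & forall h : 'cV[{poly k}]_r.+1,
        (forall i, size (h i 0%R) <= (n i).+1)%N -> g *m h = 0 -> h = 0].
Proof.
move=> d0; have [p [n [g [n0 ns sg gA [dn r1]]]]] := exists_generators (grass_mx_free V).
case: p n g n0 ns sg gA dn r1 => [|r] n g n0 ns sg gA dn r1.
  exfalso; have := grass_mx_free V; rewrite /row_free -gA => /eqP e.
  by have := rank_leq_row (gens_mx n j.+1 g); rewrite e big_ord0; lia.
have K1 (h : 'cV[{poly k}]_r.+1) :
    (forall i, size (h i 0%R) <= (n i).+1)%N -> (\row_i g i) *m h = 0 -> h = 0.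
  move=> sh gh; have /gens_mx_free free : row_free (gens_mx (fun i => n i + 1)%N j.+2 g).
    by rewrite /row_free r1.
  apply/colP => i; rewrite [RHS]mxE; apply: (free (fun x => h x 0)); first by move=> x; rewrite addn1.
  rewrite (_ : \sum_i _ = ((\row_i g i) *m h) 0 0); first by rewrite gh mxE poly_rV0.
  by rewrite mxE; apply: eq_bigr => x _; rewrite mxE mulrC.
have sn : (\sum_i n i)%N = d.
  have free : row_free (gens_mx n j.+1 g).
    apply/gens_mx_free => h sh /poly_rV_eq0 e i.
    have hz : \col_i h i = 0 :> 'cV[{poly k}]_r.+1.
      apply: K1 => [x|]; first by rewrite mxE; apply: leq_trans (sh x) _.
      apply/matrixP => a b; rewrite !mxE -[RHS]e.
        by apply: eq_bigr => x _; rewrite !mxE mulrC.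
      apply: leq_trans (size_sum _ _ _) _; apply/bigmax_leqP => x _.
      have [->|hx] := eqVneq (h x) 0; first by rewrite mul0r size_poly0.
      apply: leq_trans (size_polyMleq _ _) _; rewrite -size_poly_gt0 in hx.
      by move: hx (sh x) (sg x); move: (size (h x)) (size (g x)); lia.
    by have /colP/(_ i) := hz; rewrite !mxE.
  by move/eqP: free; rewrite gA => <-; apply/eqP; apply: grass_mx_free.
exists r, n, (\row_i g i); split=> //; split=> //.
- by move=> i; left.
- by move=> i; rewrite mxE; apply: sg.
- apply: eqmx_trans (eqmx_sym gA) _; apply/eqmxP.
  have -> : gens_mx n j.+1 g = gens_mx n j.+1 ((\row_i g i) 0); last by rewrite submx_refl.
  rewrite /gens_mx /rows_mx; apply/eq_mxcolP => i.
  by apply/matrixP => a b; rewrite !mxE.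
move=> s sj; have := dn (j - s).+1; rewrite ltnS leq_subr subSS => /(_ isT).
rewrite subKn // => rd; have sm := sum_sub_min n s; rewrite sn in sm.
have rle := rank_leq_col (down (grass_mx V) (j - s).+1 s); rewrite rd in rle.
have [s0|s0] := posnP s.
  subst s; rewrite min_sum0 subn0 in sm rle *.
  have e := ancestor_hilbert_up V 0; rewrite addn0 in e; rewrite e.
  have -> : \rank (up (grass_mx V) j.+1 0) = d.
    have A := @up_gens k r.+1 n j.+1 0 g (fun i => or_introl (n0 i)) sg.
    rewrite addn0 in A.
    rewrite (eqmx_up _ _ (eqmx_sym gA)) A.
    rewrite (eqmx_gens _ _ (fun i => addn0 (n i))) gA.
    by apply/eqP; apply: grass_mx_free.
  by move: sm rle; move: (\sum_i (n i - 0))%N; lia.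
by rewrite ancestor_hilbert_down ?s0 // rd; lia.
Qed.

End Presentations.

Lemma exists_sorting_perm r (m : 'I_r -> nat) : exists s : 'S_r,
  forall l l' : 'I_r, (l <= l')%N -> (m (s l') <= m (s l))%N.
Proof.
pose t := [tuple m i | i < r].
have sz : size (sort geq t) == r by rewrite size_sort size_tuple.
pose t' := Tuple sz.
have /tuple_permP[s e] : perm_eq t' t by rewrite perm_sort.
exists s => l l' ll.
have E x : m (s x) = nth 0%N t' x.
  by rewrite e (nth_map x) ?size_enum_ord // nth_ord_enum tnth_mktuple.
rewrite !E; have so : sorted geq t' by apply: sort_sorted => x y; apply: leq_total.
apply: (sorted_leq_nth _ _ 0%N so) => //; rewrite ?inE ?size_tuple //.
- by move=> x y z yx zx; apply: leq_trans zx yx.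
- by move=> x; apply: leqnn.
Qed.

Section Pad.
Variables (r r' : nat).
Hypothesis rr : (r <= r')%N.

Definition pad (T : Type) (x0 : T) (u : 'I_r -> T) (i : 'I_r') : T :=
  if insub (val i) is Some x then u x else x0.

Lemma pad_widen T (x0 : T) u x : pad x0 u (widen_ord rr x) = u x.
Proof. by rewrite /pad /= valK. Qed.

Lemma pad_sumn T (x0 : T) (u : 'I_r -> T) (F : T -> nat) : F x0 = 0%N ->
  (\sum_i F (pad x0 u i) = \sum_i F (u i))%N.
Proof.
move=> F0; pose G (i : nat) := F (if (insub i : option 'I_r) is Some x then u x else x0).
rewrite [LHS](eq_bigr (fun i : 'I_r' => G i)) //.
rewrite [RHS](eq_bigr (fun i : 'I_r => G i)); last by move=> i _; rewrite /G valK.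
rewrite [RHS](big_ord_widen r' _ rr) big_mkcond [RHS]big_mkcond /=.
apply: eq_bigr => i _; case: ltnP => // ri.
by rewrite /G insubF // ltnNge ri.
Qed.

End Pad.

Section Presentations.
Variables (k : closedFieldType) (d j : nat).
Implicit Type V : Grass k d j.

(** The added generators are zero with parts 0, so they contribute neither rows nor terms of
    [min_sum]; this equalizes the sizes of two presentations. *)
Lemma generates_pad r r' (n : 'I_r.+1 -> nat) g V : (r <= r')%N ->
  (forall i i' : 'I_r.+1, (i <= i')%N -> (n i' <= n i)%N) -> generates n g V ->
  exists (n' : 'I_r'.+1 -> nat) g', generates n' g' V
    /\ forall i i' : 'I_r'.+1, (i <= i')%N -> (n' i' <= n' i)%N.
Proof.
move=> rr' ns [n0 sg Vg sn HD]; have rr : (r.+1 <= r'.+1)%N by [].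
pose n' := @pad r.+1 r'.+1 _ 0%N n; pose g' := @pad r.+1 r'.+1 _ 0 (g 0).
have key i : (n' i = 0%N /\ g' i = 0) \/ exists x : 'I_r.+1, n' i = n x /\ g' i = g 0 x.
  by rewrite /n' /g' /pad; case: insub => [x|]; [right; exists x | left].
exists n', (\row_i g' i); split; last first.
  move=> i i' ii; rewrite /n' /pad; case: insubP => [x _ xi|//].
  case: insubP => [y _ yi|]; last by have := ltn_ord x; rewrite /= in xi *; lia.
  by apply: ns; rewrite /= in xi yi; lia.
split.
- move=> i; rewrite mxE; case: (key i) => [[_ ->]|[x [-> ->]]]; first by right.
  exact: n0.
- move=> i; rewrite mxE; case: (key i) => [[-> ->]|[x [-> ->]]]; last exact: sg.
  by rewrite size_poly0.
- apply: eqmx_trans Vg _; apply/eqmxP/andP; split; apply: gens_mx_sub => i a ai.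
    have [en eg] : n' (widen_ord rr i) = n i /\ g' (widen_ord rr i) = g 0 i.
      by rewrite /n' /g' !pad_widen.
    have := @sub_gens_mx1 _ _ n' j.+1 ((\row_i g' i) 0) (widen_ord rr i) a.
    by rewrite en mxE eg; apply.
  rewrite mxE; case: (key i) => [[e _]|[x [en ->]]]; first by move: ai; rewrite e.
  by apply: sub_gens_mx1; rewrite -en.
- by rewrite -sn; apply: (pad_sumn rr n (F := id)).
move=> s sj; rewrite HD //; congr (_ + _)%N; symmetry.
by apply: (pad_sumn rr n (F := fun x => minn x s)); rewrite min0n.
Qed.

(** [f] stands for a form of degree [c], and a size below [c.+1] means that a power of [y] divides
    it. The conditions on [f] and [M] are linear, so two choices can be joined by a line. *)
Definition presents r (n : 'I_r.+1 -> nat) (m : 'I_r -> nat) c V : Prop :=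
  exists (f : {poly k}) (M : 'M[{poly k}]_(r.+1, r)),
  [/\ deg_le n m M, (size f <= c.+1)%N & (grass_mx V :=: gens_mx n j.+1 ((f *: minors M) 0))%MS].

Lemma presents_col_perm r (n : 'I_r.+1 -> nat) (m : 'I_r -> nat) c V (s : 'S_r) :
  presents n m c V -> presents n (m \o s) c V.
Proof.
case=> f [M [dM sf Vg]]; exists ((-1) ^+ s *: f), (col_perm s M); split.
- by move=> i l; rewrite mxE; apply: dM.
- by apply: leq_trans (size_scale_leq _ _) sf.
suff -> : ((-1) ^+ s *: f) *: minors (col_perm s M) = f *: minors M by [].
rewrite col_permE minors_mulr det_perm odd_permV.
rewrite !scalerA -scalerAl mulrC; case: (odd_perm s); rewrite ?expr1 ?expr0 ?mul1r ?scale1r //.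
by rewrite scaleN1r mulN1r opprK.
Qed.

Lemma hilbert_up r (n : 'I_r.+1 -> nat) (m : 'I_r -> nat) g V (M : 'M[{poly k}]_(r.+1, r)) f :
  generates n g V -> deg_le n m M -> good n m M -> f != 0 -> g = f *: minors M ->
  forall s, (ancestor_hilbert V (j + s) + d + min_sum m s = j.+1)%N.
Proof.
move=> [n0 sg Vg sn _] dM gdM f0 ge s.
have gM : g *m M = 0 by rewrite ge -scalemxAl mul_minors scaler0.
have M0 := good_minors_neq0 gdM.
have le := rank_gens_le s (j.+1 + s) dM M0 gM.
have sg' i : (size (g 0%R i) + n i + s <= (j.+1 + s).+1)%N.
  by have := sg i; move: (size _) => z; lia.
have ge' := rank_gens_ge dM gdM f0 ge sg'.
have sgi i : (size (g 0%R i) + n i <= j.+2)%N by apply: sg.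
have up_eq := up_gens s n0 sgi.
have e := sum_subr_min m s.
have e2 : (\sum_i (n i + s) = d + r.+1 * s)%N.
  by rewrite big_split /= sn sum_nat_const card_ord.
have rk : (\rank (up (grass_mx V) (j + s).+1 s) = d + s + min_sum m s)%N.
  rewrite (eqmx_up _ _ Vg) up_eq; move: le ge'; move: (\rank _) => A.
  by rewrite e2 mulSn; move: e; move: (min_sum m s) (\sum_l (s - m l))%N => B C; lia.
have := rank_leq_col (up (grass_mx V) (j + s).+1 s).
by rewrite ancestor_hilbert_up rk; lia.
Qed.

Lemma generates_presentation r (n : 'I_r.+1 -> nat) g V : (0 < d)%N -> generates n g V ->
  exists m c, [/\ presents n m c V, (d + \sum_l m l + c = j.+1)%N,
    forall s, (ancestor_hilbert V (j + s) + d + min_sum m s = j.+1)%N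
    & (forall h : 'cV[{poly k}]_r.+1,
        (forall i, size (h i 0%R) <= (n i).+1)%N -> g *m h = 0 -> h = 0) ->
      forall l, (0 < m l)%N].
Proof.
move=> d0 gV; case: (gV) => n0 sg Vg sn _.
have g0 : g != 0.
  apply: contraTneq d0 => g0; rewrite -leqNgt -(eqP (grass_mx_free V)) Vg leqn0 mxrank_eq0.
  rewrite -submx0; apply: gens_mx_sub => i a _.
  by rewrite g0 mxE mul0r poly_rV0 sub0mx.
have [m [M [f [dM gdM f0 ge le]]]] := exists_presentation (generates_indep gV) g0 sg.
have sf : (0 < size f)%N by rewrite size_poly_gt0.
rewrite sn in le; exists m, (j.+1 - d - \sum_l m l)%N; split.
- exists f, M; split=> //; last by rewrite -ge.
  by move: le sf; move: (size f); lia.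
- by move: le sf; move: (size f); lia.
- exact: hilbert_up gV dM gdM f0 ge.
(* A column with part 0 would be a relation within the sizes [(n i).+1], hence zero, against the
   nonzero minors. *)
move=> K1 l; rewrite lt0n; apply/eqP => ml.
have cl0 : col l M = 0.
  apply: K1 => [i|]; first by rewrite mxE; have := dM i l; rewrite ml addn0.
  by rewrite colE mulmxA ge -scalemxAl mul_minors scaler0 mul0mx.
have M0 := good_minors_neq0 gdM.
have : delta_mx l 0 = 0 :> 'cV[{poly k}]_r by apply: (minors_inj M0); rewrite -colE.
by move=> /colP/(_ l); rewrite !mxE !eqxx => /eqP; rewrite oner_eq0.
Qed.

Lemma grass_has_type V : (0 < d)%N -> exists r (n : 'I_r.+1 -> nat) m,
  has_type n m d j (ancestor_hilbert V).
Proof.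
move=> d0; have [r [n [g [gV n0 ns K1]]]] := grass_generators V d0.
have [m [c [_ sc HU m0]]] := generates_presentation d0 gV.
case: gV => _ _ _ sn HD; exists r, n, m; split=> //; first by split=> //; apply: m0.
by split=> //; lia.
Qed.

End Presentations.

(** * Degenerations between presentations *)

(* Elements of [{poly {poly k}}] are families of polynomials: the coefficients
   depend polynomially on the parameter [t]. *)
Section Families.
Variable k : closedFieldType.

Definition eval_at (t : k) : {poly {poly k}} -> {poly k} := map_poly (horner_eval t).
HB.instance Definition _ t := GRing.RMorphism.copy (eval_at t) (map_poly (horner_eval t)).

Definition const_fam (p : {poly k}) : {poly {poly k}} := map_poly polyC p.
HB.instance Definition _ := GRing.RMorphism.copy const_fam (map_poly (@polyC k)).

Definition param : {poly {poly k}} := ('X : {poly k})%:P.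

Lemma eval_const t p : eval_at t (const_fam p) = p.
Proof.
by apply/polyP => i; rewrite coef_map coef_map /= /horner_eval hornerC.
Qed.

Lemma eval_param t : eval_at t param = t%:P.
Proof. by rewrite /eval_at /param map_polyC /= /horner_eval hornerX. Qed.

Lemma eval_atM t p q : eval_at t (p * q) = eval_at t p * eval_at t q.
Proof. exact: (rmorphM (eval_at t)). Qed.

Lemma eval_atD t p q : eval_at t (p + q) = eval_at t p + eval_at t q.
Proof. exact: (rmorphD (eval_at t)). Qed.

Lemma eval_atB t p q : eval_at t (p - q) = eval_at t p - eval_at t q.
Proof. exact: (rmorphB (eval_at t)). Qed.

Lemma eval_atXn t e : eval_at t 'X^e = 'X^e.
Proof. exact: map_polyXn. Qed.

Lemma eval_minors t r (M : 'M[{poly {poly k}}]_(r.+1, r)) i :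
  eval_at t (minors M 0 i) = minors (map_mx (eval_at t) M) 0 i.
Proof. by rewrite (map_minors (eval_at t)) [RHS]mxE. Qed.

Lemma map_rows_mx t p (N : 'I_p -> nat) L (rho : 'I_p -> nat -> {poly {poly k}}) :
  map_mx (horner_eval t) (rows_mx N L rho) = rows_mx N L (fun i a => eval_at t (rho i a)).
Proof. by apply/matrixP => x y; rewrite !mxE coef_map. Qed.

Lemma closure_family d j (S : Grass k d j -> Prop) V p (N : 'I_p -> nat)
    (rho : 'I_p -> nat -> {poly {poly k}}) Q :
    (\sum_i N i = d)%N -> Q != 0 ->
    (rows_mx N j.+1 (fun i a => eval_at 0 (rho i a)) :=: grass_mx V)%MS ->
    (forall t, Q.[t] != 0 -> forall W : Grass k d j,
       (grass_mx W :=: rows_mx N j.+1 (fun i a => eval_at t (rho i a)))%MS ->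
       zariski_closure S W) ->
  zariski_closure S V.
Proof.
move=> sN Q0 V0 VS; subst d.
apply: (closure_curve (A := rows_mx N j.+1 rho) Q0); first by rewrite map_rows_mx.
by move=> t Qt W; rewrite map_rows_mx; apply: VS.
Qed.

End Families.

(** The matrix is [E *m N], with [E] an elementary operation followed by a transposition. The
    claimed row satisfies the equation of [minors_mull], and [E] cancels since its determinant [- t]
    is nonzero. *)
Lemma minors_row_op (R : idomainType) r (N : 'M[R]_(r.+1, r)) a b t x :
  a != b -> t != 0 ->
  minors (\matrix_(i, l) (if i == a then N b l else
                          if i == b then t * N a l + x * N b l else N i l))
  = \row_i (if i == a then x * minors N 0 a - t * minors N 0 b else
            if i == b then - minors N 0 a else - t * minors N 0 i).
Proof.
move=> ab t0; set M := \matrix_(_, _) _; set z := \row_i _.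
pose c : 'cV[R]_r.+1 := t *: delta_mx a 0 + x *: delta_mx b 0.
pose E1 := (col_repl 1%:M a c)^T; pose E := tperm_mx a b *m E1.
have ba : (b == a) = false by rewrite eq_sym (negPf ab).
have dE : \det E = - t.
  rewrite det_mulmx det_perm odd_tperm ab det_tr det_col_repl1 !mxE !eqxx /=.
  by rewrite expr1 mulN1r (negPf ab) mulr0 addr0 mulr1.
have E1E i l : E1 i l = if i == a then t *+ (l == a) + x *+ (l == b) else (l == i)%:R.
  rewrite !mxE eqxx !andbT; case: (i == a) => //.
  by congr (_ + _); case: (l == _); rewrite ?mulr1 ?mulr0.
have ME : M = E *m N.
  have key i' l : (E1 *m N) i' l = if i' == a then t * N a l + x * N b l else N i' l.
    rewrite mxE; case: eqP => [->|/eqP ne].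
      rewrite (bigD1 a) //= (bigD1 b) /= ?ba // big1 ?addr0 => [|y /andP[ya yb]].
        by rewrite !E1E !eqxx ba (negPf ab) addr0 add0r.
      by rewrite E1E eqxx (negPf ya) (negPf yb) addr0 mul0r.
    rewrite (bigD1 i') //= big1 ?addr0 => [|y /negPf yi].
      by rewrite E1E (negPf ne) eqxx mul1r.
    by rewrite E1E (negPf ne) yi mul0r.
  apply/matrixP => i l; rewrite -mulmxA -row_permE mxE [RHS]mxE key.
  have [->|ia] := eqVneq i a; first by rewrite tpermL ba.
  have [->|ib] := eqVneq i b; first by rewrite tpermR eqxx.
  by rewrite (_ : tperm a b i = i) ?(negPf ia) //; apply: tpermD; rewrite eq_sym.
have zE : z *m E = - t *: minors N.
  pose y := \row_i z 0 (tperm a b i).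
  have -> : z *m E = y *m E1.
    by rewrite mulmxA; congr (_ *m _); rewrite -xcolE; apply/rowP => i; rewrite !mxE.
  apply/rowP => i; rewrite mxE (bigD1 a) //= E1E eqxx.
  have ya : y 0 a = - minors N 0 a by rewrite !mxE tpermL eqxx ba.
  have yb : y 0 b = x * minors N 0 a - t * minors N 0 b by rewrite mxE mxE tpermR eqxx.
  rewrite ya; have [->|ia] := eqVneq i a.
    rewrite big1 ?addr0 => [|l /negPf la]; last by rewrite E1E la eq_sym la mulr0.
    by rewrite (negPf ab) addr0 [RHS]mxE mulr1n mulrC mulrN mulNr.
  rewrite (bigD1 i) //= big1 ?addr0 => [|l /andP[/negPf la /negPf li]]; last first.
    by rewrite E1E la eq_sym li mulr0.
  rewrite E1E (negPf ia) eqxx mulr1 add0r [RHS]mxE; have [->|ib] := eqVneq i b.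
    by rewrite yb mulr1n; ring.
  rewrite mulr0 add0r mxE mxE (_ : tperm a b i = i) ?(negPf ia) ?(negPf ib) //.
  by apply: tpermD; rewrite eq_sym.
have dE0 : - t != 0 by rewrite oppr_eq0.
have e := minors_mull E N; rewrite -ME dE -zE in e.
have : (minors M - z) *m E *m \adj E = 0 by rewrite mulmxBl e subrr mul0mx.
rewrite -mulmxA mul_mx_adj dE mul_mx_scalar => /eqP.
by rewrite scalemx_eq0 (negPf dE0) /= subr_eq0 => /eqP.
Qed.

(** * The elementary moves *)

Section Moves.
Variables (k : closedFieldType) (d j : nat).
Implicit Type V : Grass k d j.

Lemma eq_presents r (n n' : 'I_r.+1 -> nat) m m' c V : n =1 n' -> m =1 m' ->
  @presents k d j r n m c V -> presents n' m' c V.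
Proof.
move=> nn mm [f [M [dM sf Vg]]]; exists f, M; split=> //.
  by move=> i l; rewrite -nn -mm.
exact: eqmx_trans Vg (eqmx_gens _ _ nn).
Qed.

(** A linear factor of [f] goes into column [b]: either ['X - z%:P] for a root [z], or, when the
    size of [f] is not maximal, the factor [y], invisible at [y = 1], so that only the bounds
    change. *)
Lemma move_factor r (n : 'I_r.+1 -> nat) m c b V :
  @presents k d j r n m c.+1 V -> presents n (bump_at m b) c V.
Proof.
case=> f [M [dM sf Vg]].
have [sf'|sf'] := leqP (size f) c.+1.
  exists f, M; split=> // i l; apply: leq_trans (dM i l) _; rewrite /bump_at.
  by case: eqP => [->|_]; lia.
have sf1 : size f != 1%N by rewrite neq_ltn orbC (leq_trans _ sf').
have [z rz] := closed_rootP f sf1.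
have /factor_theorem[f1 fE] := rz.
have f0 : f != 0 by apply: contraTneq sf' => ->; rewrite size_poly0.
have f10 : f1 != 0 by apply: contraNneq f0 => e; rewrite fE e mul0r.
exists f1, (col_repl M b (('X - z%:P) *: col b M)); split.
- move=> i l; rewrite mxE /bump_at; case: eqP => _; last exact: dM.
  rewrite !mxE; apply: leq_trans (size_polyMleq _ _) _; rewrite size_XsubC /=.
  by rewrite addnS; apply: dM.
- by move: sf; rewrite fE size_Mmonic ?monicXsubC // size_XsubC addn2.
suff -> : f1 *: minors (col_repl M b (('X - z%:P) *: col b M)) = f *: minors M by [].
have e : 1 *: (('X - z%:P) *: col b M) = M *m (('X - z%:P) *: delta_mx b 0).
  by rewrite scale1r colE scalemxAr.
have := minors_col_repl b e; rewrite scale1r => ->.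
by rewrite !mxE !eqxx mulr1 scalerA -fE.
Qed.

Lemma size_drop1 (p : {poly k}) : (size (drop_poly 1 p) = (size p).-1)%N.
Proof. by rewrite size_drop_poly subn1. Qed.

Lemma drop1E (p : {poly k}) : p = (p`_0)%:P + 'X * drop_poly 1 p.
Proof. 
rewrite -{1}(poly_take_drop 1 p) expr1 mulrC; congr (_ + _).
by apply/polyP => i; rewrite coef_take_poly coefC; case: i.
Qed.

(* Write the column [a] of [M] as [s = s0 + 'X u] and let [w] be its column [b].
   In the deformed matrix they become [w - t u] and ['X w + t s0], which for
   [t != 0] is a column operation of determinant [- t] on the perturbation
   [N_t] of [M] with columns [s] and [w - t u]. *)
Lemma move_col r (n : 'I_r.+1 -> nat) m c a b V : (\sum_i n i = d)%N -> (m b < m a)%N ->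
  @presents k d j r n m c V -> zariski_closure (presents n (transfer m a b) c) V.
Proof.
move=> sn mab [f [M [dM sf Vg]]].
have ab : a != b by apply: contraTneq mab => ->; rewrite ltnn.
pose u i := drop_poly 1 (M i a).
pose N : 'M[{poly {poly k}}]_(r.+1, r) := \matrix_(i, l)
  if l == b then const_fam (M i b) - @param k * const_fam (u i) else const_fam (M i l).
have NE t : map_mx (eval_at t) N = \matrix_(i, l)
    if l == b then M i b - t%:P * u i else M i l.
  apply/matrixP => i l; rewrite !mxE; case: (l == b); last exact: eval_const.
  by rewrite eval_atB eval_atM eval_param !eval_const.
have gE t i e : eval_at t (const_fam f * minors N 0 i * 'X^e) =
    f * minors (map_mx (eval_at t) N) 0 i * 'X^e.
  by rewrite !eval_atM eval_const eval_minors eval_atXn.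
apply: (closure_family (N := n) (rho := fun i e => const_fam f * minors N 0 i * 'X^e)
   (Q := 'X)) => //; first by rewrite polyX_eq0.
  have -> : rows_mx n j.+1 (fun i a0 => eval_at 0 (const_fam f * minors N 0 i * 'X^a0))
      = gens_mx n j.+1 ((f *: minors M) 0).
    apply: eq_rows_mx => i e; rewrite gE NE [RHS](_ : _ = f * minors M 0 i * 'X^e).
      congr (_ * minors _ 0 _ * _); apply/matrixP => x l; rewrite !mxE.
      by case: eqP => [->|//]; rewrite polyC0 mul0r subr0.
    by congr (_ * _); rewrite mxE.
  exact: eqmx_sym.
move=> t; rewrite hornerX => t0 W WE; apply: sub_zariski_closure.
pose Nt := map_mx (eval_at t) N.
pose h : 'cV_r.+1 := \col_i (t%:P * Nt i a + 'X * Nt i b).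
pose M1 := col_repl Nt a h.
have eM1 : minors M1 = t%:P *: minors Nt.
  have e : 1 *: h = Nt *m (t%:P *: delta_mx a 0 + 'X *: delta_mx b 0).
    rewrite scale1r mulmxDr -!scalemxAr -!colE; apply/colP => i.
    by rewrite !mxE.
  have := minors_col_repl a e; rewrite scale1r => ->.
  by rewrite !mxE !eqxx (negPf ab) mulr0 addr0 mulr1.
pose M2 := col_perm (tperm a b) M1.
have eM2 : minors M2 = (- t)%:P *: minors Nt.
  rewrite /M2 col_permE minors_mulr tpermV det_perm odd_tperm ab eM1 scalerA.
  by rewrite expr1 mulN1r polyCN.
exists ((- t^-1) *: f), M2; split.
- have Nb i : Nt i b = M i b - t%:P * u i by rewrite /Nt NE mxE eqxx.
  have No i l : l != b -> Nt i l = M i l by move=> /negPf lb; rewrite /Nt NE mxE lb.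
  have M1a i : M1 i a = t%:P * Nt i a + 'X * Nt i b by rewrite mxE eqxx mxE.
  have M1o i l : l != a -> M1 i l = Nt i l by move=> /negPf la; rewrite mxE la.
  move=> i l; rewrite mxE /transfer.
  have ua : (size (u i) <= n i + m a)%N.
    by rewrite size_drop1; have := dM i a; move: (size _); lia.
  have Nbs : (size (M i b - t%:P * u i)%R <= n i + m a)%N.
    apply: leq_trans (size_polyD _ _) _; rewrite geq_max size_polyN.
    apply/andP; split; first by apply: leq_trans (dM i b) _; lia.
    by rewrite mul_polyC; apply: leq_trans (size_scale_leq _ _) ua.
  have [->|la] := eqVneq l a.
    rewrite tpermL (negPf ab) M1o ?(eq_sym b) // Nb.
    by apply: leq_trans Nbs _; lia.
  have [->|lb] := eqVneq l b.
    rewrite tpermR M1a Nb No //.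
    have -> : t%:P * M i a + 'X * (M i b - t%:P * u i) =
        (t * (M i a)`_0)%:P + 'X * M i b.
      by rewrite {1}(drop1E (M i a)) polyCM /u; ring.
    apply: leq_trans (size_polyD _ _) _; rewrite geq_max; apply/andP; split.
      by apply: leq_trans (size_polyC_leq1 _) _; lia.
    apply: leq_trans (size_polyMleq _ _) _; rewrite size_polyX /= addnS.
    by apply: dM.
  rewrite (_ : tperm a b l = l); last by apply: tpermD; rewrite eq_sym.
  by rewrite M1o // No //; apply: dM.
- by apply: leq_trans (size_scale_leq _ _) sf.
apply: eqmx_trans WE _.
have -> : ((- t^-1) *: f) *: minors M2 = f *: minors Nt.
  rewrite eM2 scalerA -mul_polyC mulrAC -polyCM mulrNN mulVf //.
  by rewrite polyC1 mul1r.
rewrite (_ : rows_mx _ _ _ = gens_mx n j.+1 ((f *: minors Nt) 0)) //.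
by apply: eq_rows_mx => i e; rewrite gE; congr (_ * _); rewrite [RHS]mxE.
Qed.

(* The same deformation on rows.  The space presented by the deformed matrix is
   spanned by multiples of ['X g_a - t g_b] and [g_a], so that it contains
   [t 'X^e g_b] for [e < n b]; dividing these by [t] gives a basis [rho] that
   still is one at [t = 0]. *)
Lemma move_row r (n : 'I_r.+1 -> nat) m c a b V : (\sum_i n i = d)%N -> (n b < n a)%N ->
  @presents k d j r n m c V -> zariski_closure (presents (transfer n a b) m c) V.
Proof.
move=> sn nab [f [M [dM sf Vg]]].
have ab : a != b by apply: contraTneq nab => ->; rewrite ltnn.
pose u l := drop_poly 1 (M a l).
pose N : 'M[{poly {poly k}}]_(r.+1, r) := \matrix_(i, l)
  if i == b then const_fam (M b l) - @param k * const_fam (u l) else const_fam (M i l).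
have NE t : map_mx (eval_at t) N = \matrix_(i, l)
    if i == b then M b l - t%:P * u l else M i l.
  apply/matrixP => i l; rewrite !mxE; case: (i == b); last exact: eval_const.
  by rewrite eval_atB eval_atM eval_param !eval_const.
pose G i e := const_fam f * minors N 0 i * 'X^e.
have gE t i e : eval_at t (G i e) = f * minors (map_mx (eval_at t) N) 0 i * 'X^e.
  by rewrite !eval_atM eval_const eval_minors eval_atXn.
pose rho i e := if (i == a) && (n b < e)%N then G a e - @param k * G b e.-1 else G i e.
apply: (closure_family (N := n) (rho := rho) (Q := 'X)) => //; first by rewrite polyX_eq0.
  have -> : rows_mx n j.+1 (fun i e => eval_at 0 (rho i e))
      = gens_mx n j.+1 ((f *: minors M) 0).
    have N0 : map_mx (eval_at 0) N = M.
      rewrite NE; apply/matrixP => x l; rewrite !mxE.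
      by case: eqP => [->|//]; rewrite polyC0 mul0r subr0.
    apply: eq_rows_mx => i e; rewrite [RHS](_ : _ = f * minors M 0 i * 'X^e); last first.
      by congr (_ * _); rewrite mxE.
    rewrite /rho; case: andP => [[/eqP -> _]|_]; last by rewrite gE N0.
    by rewrite eval_atB eval_atM eval_param polyC0 mul0r subr0 gE N0.
  exact: eqmx_sym.
move=> t; rewrite hornerX => t0 W WE; apply: sub_zariski_closure.
pose Nt := map_mx (eval_at t) N.
have tP : t%:P != 0 by rewrite polyC_eq0.
pose M' : 'M_(r.+1, r) := \matrix_(i, l) (if i == a then Nt b l else
   if i == b then t%:P * Nt a l + 'X * Nt b l else Nt i l).
have zE := minors_row_op Nt 'X ab tP; rewrite -/M' in zE.
have ba : (b == a) = false by rewrite eq_sym (negPf ab).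
have za : minors M' 0 a = 'X * minors Nt 0 a - t%:P * minors Nt 0 b by rewrite zE mxE eqxx.
have zb : minors M' 0 b = - minors Nt 0 a by rewrite zE mxE ba eqxx.
have zo i : i != a -> i != b -> minors M' 0 i = - t%:P * minors Nt 0 i.
  by move=> /negPf ia /negPf ib; rewrite zE mxE ia ib.
exists f, M'; split=> //.
- have Nb l : Nt b l = M b l - t%:P * u l by rewrite /Nt NE mxE eqxx.
  have No i l : i != b -> Nt i l = M i l by move=> /negPf ib; rewrite /Nt NE mxE ib.
  move=> i l; rewrite mxE /transfer.
  have ul : (size (u l) <= n a + m l)%N.
    by rewrite size_drop1; have := dM a l; move: (size _); lia.
  have Nbs : (size (M b l - t%:P * u l)%R <= n a + m l)%N.
    apply: leq_trans (size_polyD _ _) _; rewrite geq_max size_polyN.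
    apply/andP; split; first by apply: leq_trans (dM b l) _; lia.
    by rewrite mul_polyC; apply: leq_trans (size_scale_leq _ _) ul.
  have [->|ia] := eqVneq i a.
    by rewrite (negPf ab) Nb; apply: leq_trans Nbs _; lia.
  have [_|ib] := eqVneq i b; last by rewrite No.
  rewrite Nb No //.
  have -> : t%:P * M a l + 'X * (M b l - t%:P * u l) = (t * (M a l)`_0)%:P + 'X * M b l.
    by rewrite {1}(drop1E (M a l)) polyCM /u; ring.
  apply: leq_trans (size_polyD _ _) _; rewrite geq_max; apply/andP; split.
    by apply: leq_trans (size_polyC_leq1 _) _; lia.
  apply: leq_trans (size_polyMleq _ _) _; rewrite size_polyX /= addSn.
  by apply: dM.
set n' := transfer n a b.
have n'a : n' a = (n a).-1 by rewrite /n' /transfer (negPf ab) eqxx.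
have n'b : n' b = (n b).+1 by rewrite /n' /transfer eqxx.
have n'o i : i != a -> i != b -> n' i = n i.
  by move=> /negPf ia /negPf ib; rewrite /n' /transfer ia ib.
have sn' : (\sum_i n' i = d)%N.
  rewrite -sn (bigD1 a) //= (bigD1 b) ?ba //= [RHS](bigD1 a) //= [in RHS](bigD1 b) ?ba //=.
  rewrite n'a n'b (eq_bigr n) => [|i /andP[ia ib]]; last exact: n'o.
  by move: (\sum_(i < r.+1 | _) n i)%N; lia.
set g' := (f *: minors M') 0.
have g'E i : g' i = f * minors M' 0 i by rewrite /g' mxE.
have sub i e : (e < n' i)%N -> (poly_rV (g' i * 'X^e) <= gens_mx n' j.+1 g')%MS.
  exact: sub_gens_mx1.
have le : (grass_mx W <= gens_mx n' j.+1 g')%MS.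
  rewrite WE; apply: rows_mx_sub => i e ei; rewrite /rho.
  case: andP => [[/eqP ia be]|nae].
    rewrite eval_atB eval_atM eval_param !gE.
    have -> : f * minors Nt 0 a * 'X^e - t%:P * (f * minors Nt 0 b * 'X^(e.-1))
        = g' a * 'X^(e.-1).
      have {1}-> : e = e.-1.+1 by lia.
      by rewrite g'E za exprS; ring.
    by apply: sub; rewrite n'a; rewrite ia in ei; lia.
  rewrite gE; have [ia|ia] := eqVneq i a.
    have -> : f * minors Nt 0 i * 'X^e = - (g' b * 'X^e) by rewrite ia g'E zb mulrN mulNr opprK.
    rewrite linearN /= eqmx_opp; apply: sub; rewrite n'b ltnS leqNgt.
    by apply/negP => be; apply: nae; rewrite ia eqxx.
  have [ib|ib] := eqVneq i b.
    have -> : f * minors Nt 0 i * 'X^e = (- t^-1) *: (g' b * 'X^(e.+1) + g' a * 'X^e).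
      rewrite ib !g'E za zb -mul_polyC exprS.
      have tt : t^-1%:P * t%:P = 1 :> {poly k} by rewrite -polyCM mulVf.
      transitivity (t^-1%:P * t%:P * (f * minors Nt 0 b * 'X^e)); first by rewrite tt mul1r.
      by rewrite polyCN; ring.
    rewrite ib in ei; rewrite linearZ scalemx_sub // linearD addmx_sub //; apply: sub; lia.
  have -> : f * minors Nt 0 i * 'X^e = (- t^-1) *: (g' i * 'X^e).
    rewrite g'E zo // -mul_polyC.
    have tt : t^-1%:P * t%:P = 1 :> {poly k} by rewrite -polyCM mulVf.
    transitivity (t^-1%:P * t%:P * (f * minors Nt 0 i * 'X^e)); first by rewrite tt mul1r.
    by rewrite polyCN; ring.
  by rewrite linearZ scalemx_sub // sub // n'o.
(* The inclusion is an equality: [W] has rank [d] and the larger space is spanned by [d] rows. *)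
apply/eqmxP; rewrite -(geq_leqif (mxrank_leqif_eq le)) (eqP (grass_mx_free W)).
by rewrite -[X in (_ <= X)%N]sn' rank_leq_row.
Qed.

End Moves.

(** * The generic presentation *)

Section Growth.
Variables (k : fieldType) (p : nat) (N : 'I_p -> nat) (L : nat) (g : 'I_p -> {poly k}).

(** Without growth the next space would be ['X] times the present one, which it also contains. Every
    element would then be divisible by ['X] within the space, again and again, and so vanish. *)
Lemma rank_gens_growth : gens_mx N L g != 0 ->
    (forall i, size (g i) + N i <= L.+1)%N ->
  (\rank (gens_mx N L g) < \rank (gens_mx (fun i => N i + 1)%N L.+1 g))%N.
Proof.
set A := gens_mx N L g; set B := gens_mx _ _ _ => A0 sg.
have AB a : (a <= 1)%N -> (A *m shift_mx k a L L.+1 <= B)%MS.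
  move=> a1; apply/row_subP => x; rewrite row_mul mul_shift_mx.
  have /sub_gens_mxP[h sh ->] := row_sub x A.
  rewrite poly_rV_K; last first.
    apply: leq_trans (size_sum _ _ _) _; apply/bigmax_leqP => i _.
    have [->|hi] := eqVneq (h i) 0; first by rewrite mul0r size_poly0.
    apply: leq_trans (size_polyMleq _ _) _; rewrite -size_poly_gt0 in hi.
    by move: hi (sh i) (sg i); move: (size (h i)) (size (g i)); lia.
  rewrite mulr_suml (eq_bigr (fun i => (h i * 'X^a) * g i)); last by move=> i _; ring.
  apply: sub_gens_mx => i; apply: leq_trans (size_polyMleq _ _) _.
  by rewrite size_polyXn addnS /=; apply: leq_add.
have <- : \rank (A *m shift_mx k 1 L L.+1) = \rank A.
  by rewrite mxrankMfree // shift_mx_free // addn1.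
rewrite ltn_neqAle mxrankS ?AB // andbT; apply: contraNneq A0 => e.
have BA : (B <= A *m shift_mx k 1 L L.+1)%MS.
  by rewrite -(geq_leqif (mxrank_leqif_sup (AB 1%N isT))) e.
have desc (v : 'rV_L) : (v <= A)%MS ->
    exists2 w : 'rV_L, (w <= A)%MS & rVpoly v = rVpoly w * 'X.
  move=> vA; have : (v *m shift_mx k 0 L L.+1 <= A *m shift_mx k 1 L L.+1)%MS.
    by apply: submx_trans BA; apply: submx_trans (AB 0%N isT); apply: submxMr.
  case/submxP => w; rewrite mulmxA !mul_shift_mx expr0 mulr1 expr1 => /poly_rV_inj e1.
  exists (w *m A); first exact: submxMl.
  apply: e1; first by apply: leqW; apply: size_rVpoly.
  by rewrite (leq_trans (size_polyMleq _ _)) // size_polyX addn2 /= ltnS size_rVpoly.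
have vanish o (v : 'rV_L) : (v <= A)%MS -> (rVpoly v)`_o = 0.
  elim: o v => [|o IHo] v /desc[w wA ->]; rewrite coefMX //=.
  exact: IHo.
apply/eqP/row_matrixP => x; rewrite row0 -[row x A]rVpolyK.
have -> : rVpoly (row x A) = 0 by apply/polyP => o; rewrite vanish ?row_sub // coef0.
exact: poly_rV0.
Qed.

End Growth.

Section Generic.
Variables (k : closedFieldType) (r : nat) (n : 'I_r.+1 -> nat) (m : 'I_r -> nat).
Hypothesis n0 : forall i, (0 < n i)%N.
Hypothesis m0 : forall l, (0 < m l)%N.

(* Its maximal minors are the generators of a monomial space. *)
Definition monomial_mx : 'M[{poly k}]_(r.+1, r) := \matrix_(i, l)
  if i == l :> nat then 'X^(n i + m l) else if i == l.+1 :> nat then -1 else 0.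

Lemma deg_le_monomial_mx : deg_le n m monomial_mx.
Proof.
move=> i l; rewrite mxE; case: eqP => _; first by rewrite size_polyXn.
by case: eqP => _; rewrite ?size_polyN ?size_poly1 ?size_poly0.
Qed.

(** Omitting the first row leaves a triangular matrix with diagonal -1, so one minor is a unit. In
    the top matrix the entries -1 disappear because [n i + m l] is positive, and the first [r] rows
    form the identity. *)
Lemma good_monomial_mx : good n m monomial_mx.
Proof.
split.
  suff [u [u0 e]] : exists u : k, u != 0 /\ minors monomial_mx 0 ord0 = u%:P.
    exists (u^-1%:P *: delta_mx ord0 0).
    by rewrite -scalemxAr mxE mul_rV_delta e -polyCM mulVf.
  exists ((-1) ^+ (r + (ord0 : 'I_r.+1) + 0)); split; first by rewrite signr_eq0.
  rewrite mxE /cofactor; set A : 'M[{poly k}]_r := row' ord0 (col' 0 _).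
  have AE x y : A x y = monomial_mx (lift ord0 x) y.
    rewrite !mxE; case: splitP => [z|z]; rewrite /= ?ord1 //.
    rewrite {1}/bump /= => [[zy]]; rewrite mxE; have -> : y = z by apply: val_inj.
    by [].
  have -> : \det A = (-1) ^+ r.
    rewrite -det_tr det_trig; last first.
      apply/is_trig_mxP => x y xy; rewrite mxE AE mxE /= /bump /= add1n.
      by do 2! [case: eqP => [e|_]; first by move: xy e; clear; lia].
    rewrite (eq_bigr (fun=> -1)); first by rewrite prodr_const card_ord.
    move=> x _; rewrite mxE AE mxE /= /bump /= add1n eqxx.
    by rewrite gtn_eqF.
  by rewrite -exprD rmorphXn rmorphN rmorph1 /=; congr (_ ^+ _); lia.
move=> c tc; apply/colP => l; have /colP/(_ (widen_ord (leqnSn r) l)) := tc.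
rewrite !mxE (bigD1 l) //= big1 ?addr0 => [|x xl].
  by rewrite !mxE /= eqxx coefXn eqxx mul1r.
rewrite !mxE /= (negPf (_ : (l : nat) != x)); last by rewrite eq_sym.
case: eqP => _; rewrite ?coef0 ?mul0r // coefN coefC.
by rewrite gtn_eqF ?oppr0 ?mul0r // addn_gt0 n0.
Qed.

End Generic.

(** * Presented spaces as limits of spaces with the given Hilbert function *)

Section Closure.
Variables (k : closedFieldType) (d j : nat).
Implicit Type V : Grass k d j.
Variables (r : nat) (n : 'I_r.+1 -> nat) (m : 'I_r -> nat) (H : nat -> nat).
Hypothesis d0 : (0 < d)%N.
Hypothesis typeH : has_type n m d j H.

Let n0 : forall i, (0 < n i)%N. Proof. by case: typeH => -[]. Qed.
Let m0 : forall l, (0 < m l)%N. Proof. by case: typeH => -[]. Qed.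
Let sn : (\sum_i n i = d)%N. Proof. by case: typeH => _ []. Qed.

Lemma sum_shift s : (\sum_i (n i + s) = d + r.+1 * s)%N.
Proof. by rewrite big_split /= sn sum_nat_const card_ord. Qed.

(** At [s = 1] the rank condition says that there is no syzygy in degree [j.+1]. This freeness
    forces the ancestor ideal below [j] to be generated by the same [g], so those values of [H]
    follow. *)
Lemma GrassH_of_ranks V (g : 'I_r.+1 -> {poly k}) :
    (grass_mx V :=: gens_mx n j.+1 g)%MS -> (forall i, (size (g i) + n i <= j.+2)%N) ->
    (forall s, \rank (gens_mx (fun i => n i + s)%N (j.+1 + s) g) = d + s + min_sum m s)%N ->
  GrassH H V.
Proof.
move=> Vg sg rk; case: (typeH) => _ [_ sm] HD HU.
have K1 : row_free (gens_mx (fun i => n i + 1)%N (j.+1 + 1) g).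
  by rewrite /row_free rk sum_shift (min_sum1 m0); lia.
have Hup s : ancestor_hilbert V (j + s) = H (j + s)%N.
  have := HU s; rewrite ancestor_hilbert_up (eqmx_up _ _ Vg).
  by rewrite (up_gens s (fun i => or_introl (n0 i)) sg) rk; lia.
move=> i; have [ji|ij] := leqP j i; first by rewrite -(subnKC ji) Hup.
have [s sE] : exists s, s = (j - i)%N by exists (j - i)%N.
have iE : i = (j - s)%N by lia.
have sj : (0 < s <= j)%N by lia.
rewrite iE ancestor_hilbert_down // (eqmx_down _ _ Vg).
have sj' : (s <= j)%N by lia.
suff -> : \rank (down (gens_mx n j.+1 g) (j - s).+1 s) = (\sum_i (n i - s))%N.
  by have := HD s sj'; have := sum_sub_min n s; rewrite sn; lia.
have sgs x : (size (g x) + (n x - s) <= (j - s).+2)%N \/ (n x <= s)%N.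
  case: (leqP (n x) s) => nx; [by right | left].
  by have := sg x; move: (size _) => z; lia.
have size_comb (h : 'I_r.+1 -> {poly k}) (N : 'I_r.+1 -> nat) L :
    (forall x, size (h x) <= N x)%N -> (forall x, (0 < N x)%N -> (size (g x) + N x <= L.+1)%N) ->
    (size (\sum_x h x * g x)%R <= L)%N.
  move=> sh sN; apply: leq_trans (size_sum _ _ _) _; apply/bigmax_leqP => x _.
  have [->|hi] := eqVneq (h x) 0; first by rewrite mul0r size_poly0.
  apply: leq_trans (size_polyMleq _ _) _; rewrite -size_poly_gt0 in hi.
  have Nx : (0 < N x)%N by apply: leq_trans hi (sh x).
  by move: hi (sh x) (sN x Nx); move: (size (h x)) (size (g x)); lia.
have free_s : row_free (gens_mx (fun x => n x - s)%N (j - s).+1 g).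
  apply/gens_mx_free => h sh /poly_rV_eq0 e; move/gens_mx_free: K1; apply.
    by move=> x; apply: leq_trans (sh x) _; lia.
  rewrite e ?poly_rV0 //; apply: (size_comb h _ _ sh) => x; case: (sgs x) => //; lia.
apply/eqP; rewrite eqn_leq; apply/andP; split; last first.
  rewrite -(eqP free_s); apply: mxrankS; apply: gens_mx_sub => x a ax.
  apply/down_subP => b bs; rewrite mul_shift_mx poly_rV_K.
    by rewrite -mulrA -exprD; apply: sub_gens_mx1; lia.
  apply: leq_trans (size_polyMleq _ _) _; rewrite size_polyXn.
  by have := sg x; move: (size _) => z; lia.
rewrite -[X in (_ <= X)%N](eqP free_s); apply: mxrankS; apply/rV_subP => v /down_subP vD.
have /fin_all_exists2[h sh hE] : forall a : 'I_s.+1, exists2 h : 'I_r.+1 -> {poly k},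
    (forall x, size (h x) <= n x)%N & rVpoly v * 'X^a = \sum_x h x * g x.
  move=> a; have as_ : (a <= s)%N by rewrite -ltnS.
  have := vD a as_; rewrite mul_shift_mx => /sub_gens_mxP[h sh e]; exists h => //.
  apply: (poly_rV_inj _ _ e).
    apply: leq_trans (size_polyMleq _ _) _; rewrite size_polyXn.
    by have := size_rVpoly v; move: (size _) as_ => z; lia.
  by apply: (size_comb h n) => // x _; apply: sg.
(* The differences of consecutive multipliers, after a shift by ['X], are syzygies one degree up,
   hence zero. So the multipliers for ['X^s] times [v] are ['X^s] times those of [v], whose sizes
   are therefore at most [n x - s]. *)
have hX a (as_ : (a < s.+1)%N) x : h (Ordinal as_) x = h ord0 x * 'X^a.
  elim: a as_ x => [|a IHa] as_ x; first by rewrite mulr1; congr (h _ x); apply: val_inj.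
  have as' : (a < s.+1)%N by apply: ltnW.
  apply/eqP; rewrite -subr_eq0 exprSr mulrA -IHa; apply/eqP.
  move/gens_mx_free: K1 => /(_ (fun x => h (Ordinal as_) x - h (Ordinal as') x * 'X)); apply.
    move=> y; apply: leq_trans (size_polyD _ _) _; rewrite geq_max size_polyN.
    rewrite (leq_trans (sh _ y)) ?leq_addr //=.
    by apply: leq_trans (size_polyMleq _ _) _; rewrite size_polyX addn2 addn1 ltnS.
  rewrite (_ : \sum_y _ = 0) ?poly_rV0 //.
  rewrite (eq_bigr (fun y => h (Ordinal as_) y * g y - (h (Ordinal as') y * g y) * 'X)); last first.
    by move=> y _; ring.
  by rewrite sumrB -mulr_suml -!hE /= exprSr mulrA subrr.
have vE : rVpoly v = \sum_x h ord0 x * g x by rewrite -hE expr0 mulr1.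
rewrite -[v]rVpolyK vE; apply: sub_gens_mx => x.
have [->|hx] := eqVneq (h ord0 x) 0; first by rewrite size_poly0.
have := sh ord_max x; rewrite -[ord_max](_ : Ordinal (ltnSn s) = _); last exact: val_inj.
rewrite hX size_Mmonic ?monicXn // size_polyXn addnS /=.
by move: (size _); lia.
Qed.

End Closure.

Lemma rank_generic (k : fieldType) p q (A : 'M[{poly k}]_(p, q)) t0 a :
  (a <= \rank (map_mx (horner_eval t0) A))%N ->
  exists2 Q : {poly k}, Q != 0 &
    forall t, Q.[t] != 0 -> (a <= \rank (map_mx (horner_eval t) A))%N.
Proof.
move=> /rank_ge_det[X [Y D]].
pose Q := \det (map_mx polyC X *m A *m map_mx polyC Y).
have QE t : Q.[t] = \det (X *m map_mx (horner_eval t) A *m Y).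
  rewrite -/(horner_eval t _) -det_map_mx !map_mxM; congr (\det (_ *m _ *m _));
  by apply/matrixP => x y; rewrite !mxE /= /horner_eval hornerC.
exists Q; first by apply: contraNneq D => Q0; rewrite -QE Q0 horner0.
by move=> t; rewrite QE => Dt; apply/rank_ge_det; exists X, Y.
Qed.

Section Closure.
Variables (k : closedFieldType) (d j : nat).
Implicit Type V : Grass k d j.
Variables (r : nat) (n : 'I_r.+1 -> nat) (m : 'I_r -> nat) (H : nat -> nat).
Hypothesis d0 : (0 < d)%N.
Hypothesis typeH : has_type n m d j H.

(** The pair of [f] and [M] is joined to that of 1, standing for [y^c], and [monomial_mx]. Upper
    rank bounds hold wherever the minors are nonzero; lower ones hold at [t = 1], hence
    generically. *)
Lemma presents_closure c V : (d + \sum_l m l + c = j.+1)%N ->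
  presents n m c V -> zariski_closure (GrassH H) V.
Proof.
move=> sc [f [M [dM sf Vg]]].
have [[n0 m0] [sn sm] HD HU] := typeH.
pose fam (p q : {poly k}) := const_fam p + @param k * const_fam (q - p).
have famE t p q : eval_at t (fam p q) = p + t%:P * (q - p).
  by rewrite eval_atD eval_atM eval_param !eval_const.
pose M1 : 'M[{poly k}]_(r.+1, r) := monomial_mx k n m.
pose Mf : 'M[{poly {poly k}}]_(r.+1, r) := \matrix_(i, l) fam (M i l) (M1 i l).
pose Mt t : 'M[{poly k}]_(r.+1, r) := map_mx (eval_at t) Mf.
pose ft t := eval_at t (fam f 1).
pose gt t : 'rV[{poly k}]_r.+1 := ft t *: minors (Mt t).
pose G i := fam f 1 * minors Mf 0 i.
have GE t i : eval_at t (G i) = gt t 0 i by rewrite eval_atM eval_minors [RHS]mxE.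
have Mt0 : Mt 0 = M by apply/matrixP => i l; rewrite !mxE famE polyC0 mul0r addr0.
have Mt1 : Mt 1 = M1 by apply/matrixP => i l; rewrite !mxE famE polyC1 mul1r addrC subrK.
have ft0 : ft 0 = f by rewrite /ft famE polyC0 mul0r addr0.
have ft1 : ft 1 = 1 by rewrite /ft famE polyC1 mul1r addrC subrK.
have size_fam a (p q : {poly k}) t : (size p <= a)%N -> (size q <= a)%N -> (size (p + t%:P * (q - p))%R <= a)%N.
  move=> sp sq; apply: leq_trans (size_polyD _ _) _; rewrite geq_max sp /= mul_polyC.
  apply: leq_trans (size_scale_leq _ _) _; apply: leq_trans (size_polyD _ _) _.
  by rewrite geq_max size_polyN sp sq.
have dMt t : deg_le n m (Mt t).
  move=> i l; rewrite mxE mxE famE; apply: size_fam; first exact: dM.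
  exact: deg_le_monomial_mx.
have sft t : (size (ft t) <= c.+1)%N.
  by rewrite /ft famE; apply: size_fam => //; rewrite size_poly1.
have sgt t i : (size (gt t 0%R i) + n i <= j.+2)%N.
  rewrite /gt mxE; have [-> | gn] := eqVneq (ft t * minors (Mt t) 0 i) 0.
    by rewrite size_poly0; have := leq_sum_ord n i; rewrite sn; lia.
  have [sM _] := size_coef_minors (dMt t) i; have := sum_lift n i; rewrite sn => e.
  have := size_polyMleq (ft t) (minors (Mt t) 0 i); have := sft t; move: sM e.
  move: (size (ft t * minors (Mt t) 0 i)) (size (ft t)) (size (minors (Mt t) 0 i)).
  by move: (\sum_x n (lift i x))%N; lia.
have rowsE t : rows_mx n j.+1 (fun i e => eval_at t (G i * 'X^e)) = gens_mx n j.+1 (gt t 0%R).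
  by apply: eq_rows_mx => i e; rewrite eval_atM eval_atXn GE.
have gens_fam t s : gens_mx (fun i => n i + s)%N (j.+1 + s) (gt t 0%R) =
    map_mx (horner_eval t) (rows_mx (fun i => n i + s)%N (j.+1 + s) (fun i e => G i * 'X^e)).
  by rewrite map_rows_mx; apply: eq_rows_mx => i e; rewrite eval_atM eval_atXn GE.
have rk1 s : (d + s + min_sum m s <= \rank (gens_mx (fun i => n i + s)%N (j.+1 + s) (gt 1%R 0%R)))%N.
  have sg1 i : (size (gt 1%R 0%R i) + n i + s <= (j.+1 + s).+1)%N.
    by have := sgt 1 i; move: (size _) => z; lia.
  have gd1 : good n m M1 by apply: good_monomial_mx.
  have dM1 : deg_le n m M1 by apply: deg_le_monomial_mx.
  have ge1 : gt 1 = 1 *: minors M1 by rewrite /gt ft1 Mt1.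
  have := rank_gens_ge dM1 gd1 (oner_neq0 _) ge1 sg1.
  have e := sum_subr_min m s; move: (\rank _) => R0; rewrite (sum_shift typeH) mulSn.
  by move: e; move: (min_sum m s) (\sum_l (s - m l))%N => A B; lia.
(* Only finitely many open conditions can be imposed together. From [S] on [min_sum m] is constant,
   so the required rank rises by one per degree, which [rank_gens_growth] guarantees. *)
pose S := (\sum_l m l).+1.
have [Q Q0 QP] : exists2 Q : {poly k}, Q != 0 & forall t, Q.[t] != 0 ->
    forall s, (s <= S)%N ->
    (d + s + min_sum m s <= \rank (gens_mx (fun i => n i + s)%N (j.+1 + s) (gt t 0%R)))%N.
  elim: (S) => [|N [Q Q0 QP]].
    have := rk1 0%N; rewrite gens_fam => /rank_generic[Q Q0 QP].
    exists Q; first exact: Q0.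
    move=> t Qt s; rewrite leqn0 => /eqP ->.
    rewrite gens_fam.
    exact: QP.
  have := rk1 N.+1; rewrite gens_fam => /rank_generic[Q' Q'0 Q'P].
  exists (Q * Q'); first exact: mulf_neq0.
  move=> t; rewrite hornerM mulf_eq0 negb_or => /andP[Qt Q't] s.
  rewrite leq_eqVlt => /predU1P[->|sN]; last exact: QP.
  by rewrite gens_fam; apply: Q'P.
apply: (closure_family (N := n) (rho := fun i e => G i * 'X^e) sn Q0).
  by rewrite rowsE /gt ft0 Mt0; apply: eqmx_sym.
move=> t Qt W WE; apply: sub_zariski_closure.
have Wg : (grass_mx W :=: gens_mx n j.+1 (gt t 0%R))%MS.
  by rewrite rowsE in WE.
have gtM : gt t *m Mt t = 0 by rewrite -scalemxAl mul_minors scaler0.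
have gt0 : gt t != 0.
  apply: contraTneq d0 => g0; rewrite -leqNgt -(eqP (grass_mx_free W)) Wg leqn0 mxrank_eq0.
  rewrite -submx0; apply: gens_mx_sub => i a _.
  by rewrite g0 mxE mul0r poly_rV0 sub0mx.
have Mtn : minors (Mt t) != 0 by apply: contraNneq gt0 => e; rewrite /gt e scaler0.
have upper s : (\rank (gens_mx (fun i => n i + s)%N (j.+1 + s) (gt t 0%R)) <= d + s + min_sum m s)%N.
  have := rank_gens_le s (j.+1 + s) (dMt t) Mtn gtM.
  have e := sum_subr_min m s; move: (\rank _) => R0; rewrite (sum_shift typeH) mulSn.
  by move: e; move: (min_sum m s) (\sum_l (s - m l))%N => A B; lia.
apply: (GrassH_of_ranks d0 typeH Wg (sgt t)) => s.
apply/eqP; rewrite eqn_leq upper /=; have [sS|Ss] := leqP s S; first exact: QP.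
have mS u : (S <= u)%N -> min_sum m u = (\sum_l m l)%N.
  by move=> Su; apply: min_sum_large => l; apply: leq_trans (leq_sum_ord m l) _; rewrite /S in Su; lia.
clearbody S.
have [u ->] : exists u, s = (S + u)%N by exists (s - S)%N; lia.
elim: u {s Ss} => [|u IHu]; first by rewrite addn0; apply: QP.
have growth := @rank_gens_growth k r.+1 (fun i => n i + (S + u))%N (j.+1 + (S + u)) (gt t 0%R).
apply: leq_trans (_ : _ <= (d + (S + u) + min_sum m (S + u)).+1)%N _.
  by rewrite !mS; lia.
have e : \rank (gens_mx (fun i => n i + (S + u).+1)%N (j.+1 + (S + u)).+1 (gt t 0%R))
   = \rank (gens_mx (fun i => n i + (S + u) + 1)%N (j.+1 + (S + u)).+1 (gt t 0%R)).
  by rewrite (eqmx_gens _ _ (fun i => etrans (addnS (n i) (S + u)) (esym (addn1 _)))).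
rewrite !addnS e; apply: leq_ltn_trans (IHu) _.
apply: growth.
  rewrite -mxrank_eq0 -lt0n; apply: leq_trans IHu; lia.
by move=> i; have := sgt t i; move: (size _) => z; lia.
Qed.

End Closure.

(** * Chains of moves *)

Section Chain.
Variables (k : closedFieldType) (d j : nat).
Implicit Type V : Grass k d j.

(** While [n] changes its sum stays [d], so no unit comes from outside. For [m] such units are paid
    for by [c], which stays available as long as the sum is below that of the target. *)
Lemma dominance_closure r (n n' : 'I_r.+1 -> nat) (m m' : 'I_r -> nat) c V :
    (forall i i' : 'I_r.+1, (i <= i')%N -> (n i' <= n i)%N) ->
    (forall i i' : 'I_r.+1, (i <= i')%N -> (n' i' <= n' i)%N) ->
    (forall l l' : 'I_r, (l <= l')%N -> (m l' <= m l)%N) ->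
    (forall l l' : 'I_r, (l <= l')%N -> (m' l' <= m' l)%N) ->
    (\sum_i n i = d)%N -> (\sum_i n' i = d)%N -> (d + \sum_l m l <= j.+1)%N ->
    (d + \sum_l m' l + c = j.+1)%N ->
    (forall s, min_sum n' s <= min_sum n s)%N -> (forall s, min_sum m' s <= min_sum m s)%N ->
    presents n' m' c V ->
  exists2 c0, (d + \sum_l m l + c0 = j.+1)%N & zariski_closure (presents n m c0) V.
Proof.
move=> ns n's ms m's sn sn' sm sm' nn mm V'.
have transfer_sum p (v : 'I_p -> nat) a b : (v b < v a)%N ->
    (\sum_x transfer v a b x = \sum_x v x)%N.
  move=> ab; have ba : b != a by apply: contraTneq ab => ->; rewrite ltnn.
  rewrite (bigD1 a) //= (bigD1 b) //= [RHS](bigD1 a) //= [in RHS](bigD1 b) //=.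
  rewrite {1 2}/transfer !eqxx eq_sym (negPf ba).
  rewrite (eq_bigr v) => [|x /andP[/negPf xa /negPf xb]]; last by rewrite /transfer xa xb.
  by move: (\sum_(x < p | _) v x)%N; lia.
have Vn : zariski_closure (presents n m' c) V.
  pose Q v := (\sum_i v i = d)%N /\ zariski_closure (presents v m' c) V.
  suff [] : Q n by [].
  apply: (@dominance_ind _ n ns Q _ _ _ n') => //.
  - move=> v w vw [sv cv]; split; first by rewrite -sv; apply: eq_bigr => x _; rewrite vw.
    apply: zariski_closure_trans cv => W pW; apply: sub_zariski_closure.
    exact: eq_presents pW.
  - move=> v a b ab [sv cv]; split; first by rewrite transfer_sum.
    by apply: zariski_closure_trans cv => W; apply: move_row.
  - by move=> v b lt [sv _]; move: lt; rewrite sv sn ltnn.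
  - by split=> //; apply: sub_zariski_closure.
pose Q v := exists2 c0, (d + \sum_l v l + c0 = j.+1)%N & zariski_closure (presents n v c0) V.
suff : Q m by [].
apply: (@dominance_ind _ m ms Q _ _ _ m') => //; last by exists c.
- move=> v w vw [c0 sv cv]; exists c0; first by rewrite -sv; congr (_ + _ + _)%N; apply: eq_bigr.
  apply: zariski_closure_trans cv => W pW; apply: sub_zariski_closure.
  exact: eq_presents pW.
- move=> v a b ab [c0 sv cv]; exists c0; first by rewrite transfer_sum.
  by apply: zariski_closure_trans cv => W; apply: move_col.
move=> v b lt [c0 sv cv]; case: c0 => [|c0] in sv cv *; first by lia.
exists c0.
  have -> : (\sum_x bump_at v b x = (\sum_x v x).+1)%N.
    rewrite (bigD1 b) //= [in RHS](bigD1 b) //= /bump_at eqxx; congr (_ + _).+1%N.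
    by apply: eq_bigr => x /negPf ->.
  by lia.
apply: zariski_closure_trans cv => W pW; apply: sub_zariski_closure.
exact: move_factor.
Qed.

End Chain.

Theorem theoremC (k : closedFieldType) (d j : nat) (hd : (0 < d)%N)
    (hdj : (d <= j)%N) (H : nat -> nat) (hH : acceptable d j H)
    (V : Grass k d j) :
  zariski_closure (GrassH H) V <->
  exists H' : nat -> nat, [/\ acceptable d j H', geP j H' H & GrassH H' V].
Proof.
have dj : (0 < d <= j)%N by rewrite hd.
have [r [n [m [typeH ns ms]]]] := acceptable_type dj hH.
have [[n0 m0] [sn sm] HD HU] := typeH.
split=> [VH|[H' [aH' [leH' geH'] VH']]].
  exists (ancestor_hilbert V); split=> //.
    have [r' [n' [m' tV]]] := grass_has_type V hd.
    exact: type_acceptable tV.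
  case: d hd hdj hH V dj typeH sn sm HD HU VH => // d' hd hdj hH V dj typeH sn sm HD HU VH.
  split=> i ij.
    have [->|ne] := eqVneq i j.
      have e : (ancestor_hilbert V j + d'.+1 = j.+1)%N.
        have [r' [n' [m' [_ _ _ HU']]]] := grass_has_type V hd.
        by have := HU' 0%N; rewrite addn0 min_sum0 addn0.
      by have := HU 0%N; rewrite addn0 min_sum0; lia.
    have [s sE] : exists s, s = (j - i)%N by exists (j - i)%N.
    have iE : i = (j - s)%N by lia.
    have sj : (0 < s <= j)%N by lia.
    have Hi : (H i <= i.+1)%N.
      by have := HD s; have := min_sum_leq n s; rewrite sn iE; lia.
    (* A closed condition valid on [GrassH H] passes to [V]. Below [j] an upper bound on the Hilbert
       function is a lower bound on the dimension of the ancestor ideal. *)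
    have := VH (fun W : Grass k d'.+1 j => i.+1 - H i <= \rank (down (grass_mx W) i.+1 s))%N.
    move=> /(_ ltac:(by apply: rank_down_closed; apply: leq_subr)) cl.
    have {}cl : (i.+1 - H i <= \rank (down (grass_mx V) i.+1 s))%N.
      apply: cl => W WH; have := WH i; rewrite iE ancestor_hilbert_down // -iE => <-.
      by have := rank_leq_col (down (grass_mx W) i.+1 s); lia.
    by rewrite iE ancestor_hilbert_down // -iE; lia.
  have [s sE] : exists s, i = (j + s)%N by exists (i - j)%N; lia.
  have Hi : (H i <= i.+1)%N by have := HU s; rewrite -sE; lia.
  have := VH (fun W : Grass k d'.+1 j => \rank (up (grass_mx W) i.+1 s) <= i.+1 - H i)%N.
  move=> /(_ ltac:(by apply: rank_up_closed)) cl.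
  have {}cl : (\rank (up (grass_mx V) i.+1 s) <= i.+1 - H i)%N.
    apply: cl => W WH; have := WH i; rewrite sE ancestor_hilbert_up -sE => <-.
    by have := rank_leq_col (up (grass_mx W) i.+1 s); lia.
  by rewrite sE ancestor_hilbert_up -sE; lia.
have [r' [n' [g' [gV n'0 n's _]]]] := grass_generators V hd.
(* [min_sum n 1] is the number of parts, so the Hilbert function in degree [j - 1] counts the
   generators and the order bounds their number. *)
have rr : (r' <= r)%N.
  case: gV => _ _ _ _ /(_ 1%N) HD'; have := HD 1%N; have := leH' (j - 1)%N.
  rewrite -(VH' (j - 1)%N) (min_sum1 n0); move: HD'; rewrite (min_sum1 n'0); lia.
have [n1 [g1 [gV1 n1s]]] := generates_pad rr n's gV.
have [m1 [c1 [pV sc1 HU1 _]]] := generates_presentation hd gV1.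
have [s ss] := exists_sorting_perm m1.
have sm1 : (\sum_l (m1 \o s) l = \sum_l m1 l)%N.
  by rewrite [RHS](reindex_inj (@perm_inj _ s)).
have msum1 t : min_sum (m1 \o s) t = min_sum m1 t.
  by rewrite /min_sum [RHS](reindex_inj (@perm_inj _ s)).
case: gV1 => _ _ _ sn1 HD1.
(* Both halves of the order become comparisons of [min_sum]; for [t] beyond [j] the sum for [n] has
   already reached [d]. *)
have nn t : (min_sum n1 t <= min_sum n t)%N.
  have [tj|jt] := leqP t j.
    by have := HD t tj; have := HD1 t tj; have := leH' (j - t)%N; rewrite VH' leq_subr; lia.
  rewrite (_ : min_sum n t = d); first by rewrite -sn1 min_sum_leq.
  rewrite -sn; apply: min_sum_large => i.
  by apply: leq_trans (leq_sum_ord n i) _; rewrite sn; lia.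
have mm t : (min_sum (m1 \o s) t <= min_sum m t)%N.
  rewrite msum1; have := HU t; have := HU1 t; have := geH' (j + t)%N.
  by rewrite VH' leq_addr; lia.
have sc1' : (d + \sum_l (m1 \o s) l + c1 = j.+1)%N by rewrite sm1.
have [c0 sc0 cl] := dominance_closure ns n1s ms ss sn sn1 sm sc1' nn mm (presents_col_perm s pV).
by apply: zariski_closure_trans cl => W; apply: presents_closure hd typeH _ _ sc0.
Qed.
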